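(* Let $\mathcal{C}$ be a triangulated category that has all small coproducts, and let $Q$ be a set of compact objects of $\mathcal{C}$. 1. Then $t=(\mathcal{C}^{t\le 0},\mathcal{C}^{t\ge 0})$ is a smashing $t$-structure on $\mathcal{C}$, where $\mathcal{C}^{t\le 0}$ is the smallest extension-closed subclass of $\mathrm{Obj}\,\mathcal{C}$ that is closed under small coproducts and contains $\bigcup_{i\ge 0}Q[i]$, and $\mathcal{C}^{t\ge 0}=\bigcap_{i\ge 1}Q^{\perp}[i]$. Moreover, the heart $\underline{Ht}$ has an injective cogenerator and satisfies the AB3* axiom; it is anti-equivalent to the subcategory of $\mathrm{AddFun}(\mathrm{Inj}\,\underline{Ht},\mathrm{Ab})$ consisting of those functors that send products in $\mathrm{Inj}\,\underline{Ht}$ into products of abelian groups, where $\mathrm{Inj}\,\underline{Ht}$ is the full subcategory of injective objects of $\underline{Ht}$. 2. Assume in addition that $\mathcal{C}$ satisfies the Brown representability condition. Then there exists a weight structure $w$ on $\mathcal{C}$ that is right adjacent to $t$, with $\underline{Hw}\cong\mathrm{Inj}\,\underline{Ht}$, and $\mathcal{C}_{w\ge 0}$ equals the big hull in $\mathcal{C}^{op}$ of $\{\hat{q}[i]:\ q\in Q,\ i\ge 0\}$, where $\hat{q}$ is the Brown-Comenetz dual of $q$, i.e., the object that represents the functor $M\mapsto\mathrm{Ab}(\mathcal{C}(q,M),\mathbb{Q}/\mathbb{Z})$. 3. Assume that the $t$-structure $t$ of part 1 is non-degenerate. Then $\underline{Ht}$ is Grothendieck abelian.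
   Context: $S^{\perp}=\{Y: \mathcal{C}(X,Y)=0\ \forall X\in S\}$. An object $M$ is compact if $\mathcal{C}(M,-)$ respects small coproducts. A class is extension-closed if it contains $0$ and for every distinguished triangle $A\to B\to C\to A[1]$ with $A,C$ in the class, $B$ is in the class. $t$-structures are in the cohomological convention, $\mathcal{C}^{t\ge n}=\mathcal{C}^{t\ge 0}[-n]$, $\mathcal{C}^{t\le n}=\mathcal{C}^{t\le 0}[-n]$. $t$ is smashing if $\mathcal{C}$ has coproducts and $\mathcal{C}^{t\ge 0}$ is closed under small coproducts; it is non-degenerate if $\bigcap_{i}\mathcal{C}^{t\ge i}=\{0\}=\bigcap_i\mathcal{C}^{t\le i}$. Brown representability condition: $\mathcal{C}$ has coproducts and every cohomological functor $\mathcal{C}^{op}\to\mathrm{Ab}$ that converts $\mathcal{C}$-coproducts into products is representable. Weight structures: a pair $(\mathcal{C}_{w\le 0},\mathcal{C}_{w\ge 0})$ of classes of objects such that: (i) both are closed under retracts in $\mathcal{C}$; (ii) $\mathcal{C}_{w\le 0}\subset \mathcal{C}_{w\le 0}[1]$ and $\mathcal{C}_{w\ge 0}[1]\subset \mathcal{C}_{w\ge 0}$; (iii) $\mathcal{C}(X,Y)=0$ for $X\in\mathcal{C}_{w\le 0}$, $Y\in \mathcal{C}_{w\ge 0}[1]$; (iv) every object $M$ fits in a distinguished triangle $LM\to M\to RM\to LM[1]$ with $LM\in\mathcal{C}_{w\le 0}$, $RM\in \mathcal{C}_{w\ge 0}[1]$. The heart $\underline{Hw}$ is the full subcategory on $\mathcal{C}_{w\le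 0}\cap\mathcal{C}_{w\ge 0}$. $w$ is right adjacent to $t$ if $\mathcal{C}_{w\le 0}=\mathcal{C}^{t\ge 0}$. Big hulls in a triangulated category $\mathcal{D}$ with coproducts (here $\mathcal{D}=\mathcal{C}^{op}$; under the assumption of part 2 the category $\mathcal{C}$ has products): for a sequence $Y_0\xrightarrow{\phi_0} Y_1\xrightarrow{\phi_1}\cdots$ the homotopy colimit $\varinjlim Y_i$ is a cone of the morphism $\coprod_i Y_i\to\coprod_i Y_i$ whose restriction to $Y_i$ is $\mathrm{id}_{Y_i}-\phi_i: Y_i\to Y_i\oplus Y_{i+1}$. With $\coprod S$ the closure of a class $S$ under small coproducts, the big hull of $S$ is the closure under retracts of the class of homotopy colimits of sequences with $Y_0\in\coprod S$ and $\mathrm{Cone}(\phi_i)\in\coprod S$ for all $i\ge 0$. $\mathrm{AddFun}(C,D)$ is the category of additive (covariant) functors from $C$ to $D$. *)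

(* Defs.v *)
(* Hom-sets are [zmodType]s, with carriers in the universe [small], over which
   the index sets of small families range too; the objects of a category live
   in an unrelated universe.  Classes of objects are predicates. *)
From HB Require Import structures.
From mathcomp Require Import all_boot all_order all_algebra.
From mathcomp Require Import boolp.

Set Implicit Arguments.
Unset Strict Implicit.
Unset Printing Implicit Defensive.
Import Order.TTheory GRing.Theory Num.Theory.
Local Open Scope ring_scope.

(* Exactly the universe of the carriers of zmodTypes. *)
Notation small := Type@{Algebra.Zmodule.axioms_.u0} (only parsing).

Declare Scope cat_scope.
Delimit Scope cat_scope with cat.
Local Open Scope cat_scope.

Record category := Category {
  Ob :> Type;
  Mor : Ob -> Ob -> Type;
  cid : forall X, Mor X X;
  ccomp : forall X Y Z, Mor Y Z -> Mor X Y -> Mor X Z;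
  ccomp1l : forall X Y (f : Mor X Y), ccomp (cid Y) f = f;
  ccomp1r : forall X Y (f : Mor X Y), ccomp f (cid X) = f;
  ccompA : forall X Y Z W (h : Mor Z W) (g : Mor Y Z) (f : Mor X Y),
    ccomp h (ccomp g f) = ccomp (ccomp h g) f
}.
Arguments cid {c} X.
Arguments ccomp {c X Y Z} g f.

Definition is_iso (C : category) (X Y : C) (f : Mor X Y) : Prop :=
  exists g : Mor Y X, ccomp g f = cid X /\ ccomp f g = cid Y.

Definition isomorphic (C : category) (X Y : C) : Prop :=
  exists f : Mor X Y, is_iso f.

Record functor (C D : category) := Functor {
  fobj :> C -> D;
  farr : forall X Y, Mor X Y -> Mor (fobj X) (fobj Y);
  farr1 : forall X, farr (cid X) = cid (fobj X);
  farrM : forall X Y Z (g : Mor Y Z) (f : Mor X Y),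
    farr (ccomp g f) = ccomp (farr g) (farr f)
}.
Arguments farr {C D} _ {X Y}.

Definition equivalent (C D : category) : Prop :=
  exists (F : functor C D) (G : functor D C)
         (eta : forall X : C, Mor X (G (F X)))
         (eps : forall Y : D, Mor (F (G Y)) Y),
    [/\ forall X, is_iso (eta X),
        forall Y, is_iso (eps Y),
        forall X X' (f : Mor X X'),
          ccomp (eta X') f = ccomp (farr G (farr F f)) (eta X)
      & forall Y Y' (g : Mor Y Y'),
          ccomp (eps Y') (farr F (farr G g)) = ccomp g (eps Y)].

Definition full_subcat (C : category) (P : C -> Prop) : category :=
  @Category {X : C | P X} (fun X Y => Mor (sval X) (sval Y))
    (fun X => cid (sval X)) (fun X Y Z g f => ccomp g f)
    (fun X Y => @ccomp1l C _ _) (fun X Y => @ccomp1r C _ _)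
    (fun X Y Z W => @ccompA C _ _ _ _).

Record preadditive := Preadditive {
  pOb :> Type;
  Hom : pOb -> pOb -> zmodType;
  idm : forall X, Hom X X;
  comp : forall X Y Z, Hom Y Z -> Hom X Y -> Hom X Z;
  comp1l : forall X Y (f : Hom X Y), comp (idm Y) f = f;
  comp1r : forall X Y (f : Hom X Y), comp f (idm X) = f;
  compA : forall X Y Z W (h : Hom Z W) (g : Hom Y Z) (f : Hom X Y),
    comp h (comp g f) = comp (comp h g) f;
  compDl : forall X Y Z (g g' : Hom Y Z) (f : Hom X Y),
    comp (g + g') f = comp g f + comp g' f;
  compDr : forall X Y Z (g : Hom Y Z) (f f' : Hom X Y),
    comp g (f + f') = comp g f + comp g f'
}.
Arguments idm {p} X.
Arguments comp {p X Y Z} g f.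
Notation "g ∘ f" := (comp g f)
  (at level 40, left associativity) : cat_scope.

Coercion cat_of (A : preadditive) : category :=
  @Category A (fun X Y => Hom X Y) (@idm A) (@comp A)
    (@comp1l A) (@comp1r A) (@compA A).

Definition op (A : preadditive) : preadditive :=
  @Preadditive A (fun X Y => Hom Y X) (@idm A) (fun X Y Z g f => f ∘ g)
    (fun X Y f => comp1r f) (fun X Y f => comp1l f)
    (fun X Y Z W h g f => esym (compA f g h))
    (fun X Y Z g g' f => compDr f g g') (fun X Y Z g f f' => compDl f f' g).

Definition full_sub (A : preadditive) (P : A -> Prop) : preadditive :=
  @Preadditive {X : A | P X} (fun X Y => Hom (sval X) (sval Y))
    (fun X => idm (sval X)) (fun X Y Z g f => g ∘ f)
    (fun X Y => @comp1l A _ _) (fun X Y => @comp1r A _ _)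
    (fun X Y Z W => @compA A _ _ _ _)
    (fun X Y Z => @compDl A _ _ _) (fun X Y Z => @compDr A _ _ _).

Record additive_functor (A B : preadditive) := AdditiveFunctor {
  aobj :> A -> B;
  fmap : forall X Y, {additive Hom X Y -> Hom (aobj X) (aobj Y)};
  fmap1 : forall X, fmap X X (idm X) = idm (aobj X);
  fmapM : forall X Y Z (g : Hom Y Z) (f : Hom X Y),
    fmap X Z (g ∘ f) = fmap Y Z g ∘ fmap X Y f
}.
Arguments fmap {A B} _ {X Y}.

Definition op_functor (A B : preadditive) (F : additive_functor A B) :
    additive_functor (op A) (op B) :=
  @AdditiveFunctor (op A) (op B) F (fun X Y => @fmap A B F Y X)
    (fun X => fmap1 F X) (fun X Y Z g f => fmapM F f g).

Definition comp_functor (A B D : preadditive)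
    (G : additive_functor B D) (F : additive_functor A B) :
    additive_functor A D.
Proof.
refine (@AdditiveFunctor A D (fun X => G (F X))
  (fun X Y => (fmap G \o fmap F : {additive Hom X Y -> Hom (G (F X)) (G (F Y))}))
  _ _).
- by move=> X /=; rewrite !fmap1.
- by move=> X Y Z g f /=; rewrite !fmapM.
Defined.

Record nat_trans (A B : preadditive) (F G : additive_functor A B) := NatTrans {
  ntc :> forall X, Hom (F X) (G X);
  ntcP : forall X Y (f : Hom X Y), ntc Y ∘ fmap F f = fmap G f ∘ ntc X
}.

Lemma nat_trans_eq (A B : preadditive) (F G : additive_functor A B)
    (a b : nat_trans F G) : (forall X, a X = b X) -> a = b.
Proof.
case: a b => a aP [b bP] /= ab.
have {}ab : a = b by exact: functional_extensionality_dep.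
by subst b; congr NatTrans; exact: Prop_irrelevance.
Qed.

Definition nt_id (A B : preadditive) (F : additive_functor A B) :
  nat_trans F F.
Proof.
by exists (fun X => idm (F X)) => X Y f; rewrite comp1l comp1r.
Defined.

Definition nt_comp (A B : preadditive) (F G H : additive_functor A B)
  (b : nat_trans G H) (a : nat_trans F G) : nat_trans F H.
Proof.
by exists (fun X => b X ∘ a X) => X Y f; rewrite -compA ntcP compA ntcP -compA.
Defined.

Definition AddFun (A B : preadditive) : category.
Proof.
refine (@Category (additive_functor A B) (@nat_trans A B) (@nt_id A B)
          (@nt_comp A B) _ _ _).
- by move=> F G a; apply: nat_trans_eq => X /=; rewrite comp1l.
- by move=> F G a; apply: nat_trans_eq => X /=; rewrite comp1r.
- by move=> F G H K c b a; apply: nat_trans_eq => X /=; rewrite compA.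
Defined.

Definition AbHom (U V : zmodType) := {additive U -> V}.

Lemma AbHom_eq (U V : zmodType) (f g : AbHom U V) : f =1 g -> f = g.
Proof.
move: f g => [f [[fP]]] [g [[gP]]] /= fg.
have {}fg : f = g by exact: functional_extensionality_dep.
by subst g; rewrite (Prop_irrelevance fP gP).
Qed.

Section AbHomZmod.
Variables U V : zmodType.

HB.instance Definition _ := gen_eqMixin (AbHom U V).
HB.instance Definition _ := gen_choiceMixin (AbHom U V).

Definition AbHom0 : AbHom U V := (\0 : {additive U -> V}).
Definition AbHomN (f : AbHom U V) : AbHom U V := (\- f : {additive U -> V}).
Definition AbHomD (f g : AbHom U V) : AbHom U V :=
  (f \+ g : {additive U -> V}).

Lemma AbHomDA : associative AbHomD.
Proof. by move=> f g h; apply: AbHom_eq => x /=; rewrite addrA. Qed.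
Lemma AbHomDC : commutative AbHomD.
Proof. by move=> f g; apply: AbHom_eq => x /=; rewrite addrC. Qed.
Lemma AbHom0D : left_id AbHom0 AbHomD.
Proof. by move=> f; apply: AbHom_eq => x /=; rewrite add0r. Qed.
Lemma AbHomND : left_inverse AbHom0 AbHomN AbHomD.
Proof. by move=> f; apply: AbHom_eq => x /=; rewrite addNr. Qed.

HB.instance Definition _ :=
  GRing.isZmodule.Build (AbHom U V) AbHomDA AbHomDC AbHom0D AbHomND.
End AbHomZmod.

Definition Ab : preadditive.
Proof.
refine (@Preadditive zmodType (fun U V => AbHom U V : zmodType)
  (fun U => (idfun : {additive U -> U}))
  (fun U V W g f => (g \o f : {additive U -> W})) _ _ _ _ _).
- by move=> U V f; exact: AbHom_eq.
- by move=> U V f; exact: AbHom_eq.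
- by move=> U V W T h g f; exact: AbHom_eq.
- by move=> U V W g g' f; exact: AbHom_eq.
- by move=> U V W g f f'; apply: AbHom_eq => x /=; rewrite raddfD.
Defined.

Definition QmodZ : zmodType :=
  Quotient.quot (GRing.ZmodClosed.clone rat (@Num.int_num_subdef rat) _).

Section Corep.
Variables (A : preadditive) (X : A).

Fact postcomp_is_nmod_morphism (Y Z : A) (g : Hom Y Z) :
  nmod_morphism (fun f : Hom X Y => g ∘ f).
Proof.
split=> [|f f']; last exact: compDr.
by apply: (addrI (g ∘ 0)); rewrite -compDr !addr0.
Qed.

Definition postcomp (Y Z : A) (g : Hom Y Z) : AbHom (Hom X Y) (Hom X Z) :=
  GRing.Additive.Pack (GRing.Additive.Class
    (GRing.isNmodMorphism.Build _ _ _ (postcomp_is_nmod_morphism g))).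

Fact postcomp_nmod_morphism (Y Z : A) : nmod_morphism (@postcomp Y Z).
Proof.
have postD : {morph @postcomp Y Z : g g' / g + g'}.
  by move=> g g'; apply: AbHom_eq => f; exact: compDl.
by split=> //; apply: (addrI (postcomp 0)); rewrite -postD !addr0.
Qed.

Fact postcomp_id (Y : A) : postcomp (idm Y) = idm (Hom X Y : Ab).
Proof. by apply: AbHom_eq => f; exact: comp1l. Qed.

Fact postcomp_comp (Y Z W : A) (h : Hom Z W) (g : Hom Y Z) :
  postcomp (h ∘ g) =
  @comp Ab (Hom X Y) (Hom X Z) (Hom X W) (postcomp h) (postcomp g).
Proof. by apply: AbHom_eq => f; rewrite /= compA. Qed.

Definition corep : additive_functor A Ab :=
  @AdditiveFunctor A Ab (fun Y => Hom X Y)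
    (fun Y Z => GRing.Additive.Pack (GRing.Additive.Class
      (GRing.isNmodMorphism.Build _ _ _ (@postcomp_nmod_morphism Y Z))))
    postcomp_id postcomp_comp.

End Corep.

Definition rep (A : preadditive) (X : A) : additive_functor (op A) Ab :=
  @corep (op A) X.

Definition representable (A : preadditive) (H : additive_functor (op A) Ab) :
    Prop :=
  exists X : A, isomorphic (C := AddFun (op A) Ab) (rep X) H.

(* The functor M |-> Ab(A(q, M), Q/Z). *)
Definition BC_functor (A : preadditive) (q : A) : additive_functor (op A) Ab :=
  comp_functor (rep (A := Ab) QmodZ) (op_functor (corep q)).

Definition BC_dual (A : preadditive) (q qhat : A) : Prop :=
  isomorphic (C := AddFun (op A) Ab) (rep qhat) (BC_functor q).

Section InPreadditive.
Variable A : preadditive.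

Definition is_zero (X : A) : Prop :=
  forall Y : A, (forall f : Hom X Y, f = 0) /\ (forall f : Hom Y X, f = 0).

Definition is_biproduct (X Y P : A) : Prop :=
  exists (i1 : Hom X P) (i2 : Hom Y P) (p1 : Hom P X) (p2 : Hom P Y),
    [/\ p1 ∘ i1 = idm X, p2 ∘ i2 = idm Y, p1 ∘ i2 = 0, p2 ∘ i1 = 0
      & i1 ∘ p1 + i2 ∘ p2 = idm P].

Definition additive_cat : Prop :=
  (exists Z, is_zero Z) /\ (forall X Y, exists P, is_biproduct X Y P).

Definition is_coproduct (I : small) (F : I -> A) (S : A)
    (inj : forall i, Hom (F i) S) : Prop :=
  forall (Y : A) (f : forall i, Hom (F i) Y),
    exists! g : Hom S Y, forall i, g ∘ inj i = f i.

Definition is_product (I : small) (F : I -> A) (P : A)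
    (pr : forall i, Hom P (F i)) : Prop :=
  forall (Y : A) (f : forall i, Hom Y (F i)),
    exists! g : Hom Y P, forall i, pr i ∘ g = f i.

Definition has_coproducts : Prop :=
  forall (I : small) (F : I -> A), exists S inj, @is_coproduct I F S inj.

Definition has_products : Prop :=
  forall (I : small) (F : I -> A), exists P pr, @is_product I F P pr.

Definition coproduct_closed (P : A -> Prop) : Prop :=
  forall (I : small) (F : I -> A) S inj, @is_coproduct I F S inj ->
    (forall i, P (F i)) -> P S.

Definition coproduct_closure (S : A -> Prop) (X : A) : Prop :=
  forall P : A -> Prop,
    coproduct_closed P -> (forall Y, S Y -> P Y) -> P X.

Definition retract (X Y : A) : Prop :=
  exists (i : Hom X Y) (p : Hom Y X), p ∘ i = idm X.

Definition retract_closed (P : A -> Prop) : Prop :=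
  forall X Y, retract X Y -> P Y -> P X.

Definition retract_closure (P : A -> Prop) (X : A) : Prop :=
  exists Y, P Y /\ retract X Y.

Definition mono (X Y : A) (f : Hom X Y) : Prop :=
  forall W (g h : Hom W X), f ∘ g = f ∘ h -> g = h.

Definition epi (X Y : A) (f : Hom X Y) : Prop :=
  forall W (g h : Hom Y W), g ∘ f = h ∘ f -> g = h.

Definition is_kernel (X Y K : A) (f : Hom X Y) (k : Hom K X) : Prop :=
  f ∘ k = 0 /\
  forall W (g : Hom W X), f ∘ g = 0 -> exists! h : Hom W K, k ∘ h = g.

Definition is_cokernel (X Y K : A) (f : Hom X Y) (k : Hom Y K) : Prop :=
  k ∘ f = 0 /\
  forall W (g : Hom Y W), g ∘ f = 0 -> exists! h : Hom K W, h ∘ k = g.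

Definition abelian : Prop :=
  [/\ additive_cat,
      forall (X Y : A) (f : Hom X Y), exists K (k : Hom K X), is_kernel f k,
      forall (X Y : A) (f : Hom X Y), exists K (k : Hom Y K), is_cokernel f k,
      forall (X Y : A) (f : Hom X Y), mono f ->
        exists Z (g : Hom Y Z), is_kernel g f
    & forall (X Y : A) (f : Hom X Y), epi f ->
        exists W (g : Hom W X), is_cokernel g f].

Definition AB3star : Prop := abelian /\ has_products.

Definition injective_object (E : A) : Prop :=
  forall (X Y : A) (m : Hom X Y) (f : Hom X E), mono m ->
    exists g : Hom Y E, g ∘ m = f.

Definition cogenerator (E : A) : Prop :=
  forall (X Y : A) (f : Hom X Y), f <> 0 -> exists g : Hom Y E, g ∘ f <> 0.

Definition generator (G : A) : Prop :=
  forall (X Y : A) (f : Hom X Y), f <> 0 -> exists g : Hom G X, f ∘ g <> 0.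

Definition short_exact (X Y Z : A) (f : Hom X Y) (g : Hom Y Z) : Prop :=
  is_kernel g f /\ is_cokernel f g.

Definition Inj : preadditive := full_sub injective_object.

Definition small_class (Q : A -> Prop) : Prop :=
  exists (I : small) (F : I -> A), forall X, Q X <-> exists i, F i = X.

End InPreadditive.

Definition preserves_coproducts (A B : preadditive)
    (F : additive_functor A B) : Prop :=
  forall (I : small) (G : I -> A) S inj, is_coproduct (F := G) (S := S) inj ->
    is_coproduct (fun i => fmap F (inj i)).

Definition preserves_products (A B : preadditive)
    (F : additive_functor A B) : Prop :=
  forall (I : small) (G : I -> A) P pr, is_product (F := G) (P := P) pr ->
    is_product (fun i => fmap F (pr i)).

Definition compact (A : preadditive) (M : A) : Prop :=
  preserves_coproducts (corep M).

Definition AddFunProd (A : preadditive) : category :=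
  full_subcat (C := AddFun A Ab) (@preserves_products A Ab).

Record small_category := SmallCategory {
  sOb : small;
  sMor : sOb -> sOb -> small;
  sid : forall X, sMor X X;
  scomp : forall X Y Z, sMor Y Z -> sMor X Y -> sMor X Z;
  scomp1l : forall X Y (f : sMor X Y), scomp (sid Y) f = f;
  scomp1r : forall X Y (f : sMor X Y), scomp f (sid X) = f;
  scompA : forall X Y Z W (h : sMor Z W) (g : sMor Y Z) (f : sMor X Y),
    scomp h (scomp g f) = scomp (scomp h g) f
}.

Coercion cat_of_small (J : small_category) : category :=
  @Category (sOb J) (@sMor J) (@sid J) (@scomp J)
    (@scomp1l J) (@scomp1r J) (@scompA J).

Definition filtered (J : category) : Prop :=
  [/\ inhabited J,
      forall j k : J, exists l, inhabited (Mor j l) /\ inhabited (Mor k l)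
    & forall (j k : J) (u v : Mor j k),
        exists l (w : Mor k l), ccomp w u = ccomp w v].

Definition is_colimit (J : small_category) (A : preadditive)
    (F : functor J A) (L : A) (c : forall j : J, Hom (F j) L) : Prop :=
  (forall (j k : J) (u : Mor j k), c k ∘ farr F u = c j) /\
  forall (Y : A) (d : forall j : J, Hom (F j) Y),
    (forall (j k : J) (u : Mor j k), d k ∘ farr F u = d j) ->
    exists! g : Hom L Y, forall j, g ∘ c j = d j.

Definition filtered_colimits_exact (A : preadditive) : Prop :=
  forall (J : small_category) (F G H : functor J A)
    (a : forall j : J, Hom (F j) (G j)) (b : forall j : J, Hom (G j) (H j))
    (LF LG LH : A) (cF : forall j : J, Hom (F j) LF)
    (cG : forall j : J, Hom (G j) LG) (cH : forall j : J, Hom (H j) LH)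
    (f : Hom LF LG) (g : Hom LG LH),
    filtered J ->
    (forall (j k : J) (u : Mor j k), a k ∘ farr F u = farr G u ∘ a j) ->
    (forall (j k : J) (u : Mor j k), b k ∘ farr G u = farr H u ∘ b j) ->
    (forall j, short_exact (a j) (b j)) ->
    is_colimit cF -> is_colimit cG -> is_colimit cH ->
    (forall j, f ∘ cF j = cG j ∘ a j) ->
    (forall j, g ∘ cG j = cH j ∘ b j) ->
    short_exact f g.

Definition grothendieck_abelian (A : preadditive) : Prop :=
  [/\ abelian A, has_coproducts A, filtered_colimits_exact A
    & exists G : A, generator G].

(* The translation is an auto-equivalence with a chosen quasi-inverse; a
   strictly invertible translation is the case where [sh_unit] and [sh_counit]
   are identities.  Data and axioms are separated so that big hulls in the
   opposite category only need the opposite of the data. *)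
Record tri_data := TriData {
  tcat :> preadditive;
  sh : additive_functor tcat tcat;
  unsh : additive_functor tcat tcat;
  sh_unit : forall X : tcat, Hom X (sh (unsh X));
  sh_counit : forall X : tcat, Hom (unsh (sh X)) X;
  dist : forall X Y Z : tcat, Hom X Y -> Hom Y Z -> Hom Z (sh X) -> Prop
}.
Arguments sh {t}.
Arguments unsh {t}.
Arguments sh_unit {t} X.
Arguments sh_counit {t} X.
Arguments dist {t X Y Z} u v w.

(* X -u-> Y -v-> Z -w-> X[-1] is distinguished in the opposite category iff
   X[-1] -w-> Z -v-> Y -u-> X = X[-1][1] is distinguished; the usual
   alternative with a sign on w has the same cones. *)
Definition tri_op (D : tri_data) : tri_data :=
  @TriData (op D) (op_functor unsh) (op_functor sh)
    (fun X => sh_counit X : @Hom (op D) X (unsh (sh X)))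
    (fun X => sh_unit X : @Hom (op D) (sh (unsh X)) X)
    (fun X Y Z (u : @Hom (op D) X Y) (v : @Hom (op D) Y Z)
       (w : @Hom (op D) Z (unsh X)) =>
       @dist D (unsh X) Z Y w v (sh_unit X ∘ (u : @Hom D Y X))).

Record tri_axioms (C : tri_data) : Prop := TriAxioms {
  tri_additive : additive_cat C;
  sh_unit_iso : forall X : C, is_iso (C := C) (sh_unit X);
  sh_counit_iso : forall X : C, is_iso (C := C) (sh_counit X);
  sh_unit_nat : forall (X Y : C) (f : Hom X Y),
    sh_unit Y ∘ f = fmap sh (fmap unsh f) ∘ sh_unit X;
  sh_counit_nat : forall (X Y : C) (f : Hom X Y),
    f ∘ sh_counit X = sh_counit Y ∘ fmap unsh (fmap sh f);
  dist_iso : forall (X Y Z X' Y' Z' : C)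
    (u : Hom X Y) (v : Hom Y Z) (w : Hom Z (sh X))
    (u' : Hom X' Y') (v' : Hom Y' Z') (w' : Hom Z' (sh X'))
    (a : Hom X X') (b : Hom Y Y') (c : Hom Z Z'),
    is_iso (C := C) a -> is_iso (C := C) b -> is_iso (C := C) c ->
    b ∘ u = u' ∘ a -> c ∘ v = v' ∘ b -> fmap sh a ∘ w = w' ∘ c ->
    dist u v w -> dist u' v' w';
  dist_id : forall (X Z : C) (v : Hom X Z) (w : Hom Z (sh X)),
    is_zero Z -> dist (idm X) v w;
  dist_cone : forall (X Y : C) (u : Hom X Y),
    exists Z (v : Hom Y Z) (w : Hom Z (sh X)), dist u v w;
  dist_rotate : forall (X Y Z : C)
    (u : Hom X Y) (v : Hom Y Z) (w : Hom Z (sh X)),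
    dist u v w <-> dist v w (- fmap sh u);
  dist_morphism : forall (X Y Z X' Y' Z' : C)
    (u : Hom X Y) (v : Hom Y Z) (w : Hom Z (sh X))
    (u' : Hom X' Y') (v' : Hom Y' Z') (w' : Hom Z' (sh X'))
    (a : Hom X X') (b : Hom Y Y'),
    dist u v w -> dist u' v' w' -> b ∘ u = u' ∘ a ->
    exists c : Hom Z Z', c ∘ v = v' ∘ b /\ fmap sh a ∘ w = w' ∘ c;
  dist_octahedron : forall (X Y Z U V W : C) (f : Hom X Y) (g : Hom Y Z)
    (f1 : Hom Y U) (f2 : Hom U (sh X)) (g1 : Hom Z W) (g2 : Hom W (sh Y))
    (h1 : Hom Z V) (h2 : Hom V (sh X)),
    dist f f1 f2 -> dist g g1 g2 -> dist (g ∘ f) h1 h2 ->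
    exists (a : Hom U V) (b : Hom V W),
      [/\ dist a b (fmap sh f1 ∘ g2),
          a ∘ f1 = h1 ∘ g, h2 ∘ a = f2, b ∘ h1 = g1
        & g2 ∘ b = fmap sh f ∘ h2]
}.

Record triangulated := Triangulated {
  tri_of :> tri_data;
  triP : tri_axioms tri_of
}.

Section InTriangulated.
Variable C : tri_data.

Definition shiftz (n : int) (X : C) : C :=
  match n with
  | Posz k => iter k (fun Y : C => sh Y) X
  | Negz k => iter k.+1 (fun Y : C => unsh Y) X
  end.

Definition shift_class (S : C -> Prop) (n : int) (Y : C) : Prop :=
  exists X, S X /\ isomorphic (C := C) Y (shiftz n X).

Definition perp (S : C -> Prop) (Y : C) : Prop :=
  forall X, S X -> forall f : Hom X Y, f = 0.

Definition extension_closed (P : C -> Prop) : Prop :=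
  (forall Z, is_zero Z -> P Z) /\
  forall X Y Z (u : Hom X Y) (v : Hom Y Z) (w : Hom Z (sh X)),
    dist u v w -> P X -> P Z -> P Y.

Definition iso_closed (P : C -> Prop) : Prop :=
  forall X Y, isomorphic (C := C) X Y -> P X -> P Y.

Definition cohomological (H : additive_functor (op C) Ab) : Prop :=
  forall X Y Z (u : Hom X Y) (v : Hom Y Z) (w : Hom Z (sh X)), dist u v w ->
  forall y : H Y,
    (@fmap _ _ H Y X u : AbHom _ _) y = 0 <->
    exists z : H Z, (@fmap _ _ H Z Y v : AbHom _ _) z = y.

(* [preserves_products H] concerns products in [op C], that is, coproducts
   in C. *)
Definition brown_representability : Prop :=
  has_coproducts C /\
  forall H : additive_functor (op C) Ab,
    cohomological H -> preserves_products H -> representable H.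

(* Cohomological convention: [le] is C^{t<=0}, [ge] is C^{t>=0}. *)
Section TStructure.
Variables le ge : C -> Prop.

Definition t_le (n : int) : C -> Prop := shift_class le (- n).
Definition t_ge (n : int) : C -> Prop := shift_class ge (- n).

Record t_structure : Prop := TStructure {
  t_le_iso : iso_closed le;
  t_ge_iso : iso_closed ge;
  t_le_shift : forall X, shift_class le 1 X -> le X;
  t_ge_shift : forall X, ge X -> shift_class ge 1 X;
  t_orth : forall (X Y : C) (f : Hom X Y), le X -> t_ge 1 Y -> f = 0;
  t_decomp : forall M, exists L R (u : Hom L M) (v : Hom M R) (w : Hom R (sh L)),
    [/\ dist u v w, le L & t_ge 1 R]
}.

Definition t_smashing : Prop := has_coproducts C /\ coproduct_closed ge.

Definition t_nondegenerate : Prop :=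
  (forall X, (forall i, t_ge i X) <-> is_zero X) /\
  (forall X, (forall i, t_le i X) <-> is_zero X).

Definition t_heart : preadditive := full_sub (fun X : C => le X /\ ge X).

End TStructure.

(* [le] is C_{w<=0}, [ge] is C_{w>=0}; here the shift by n is [n], whereas
   [t_le n] and [t_ge n] use [-n]. *)
Section WStructure.
Variables le ge : C -> Prop.

Record w_structure : Prop := WStructure {
  w_le_retract : retract_closed le;
  w_ge_retract : retract_closed ge;
  w_le_shift : forall X, le X -> shift_class le 1 X;
  w_ge_shift : forall X, shift_class ge 1 X -> ge X;
  w_orth : forall (X Y : C) (f : Hom X Y), le X -> shift_class ge 1 Y -> f = 0;
  w_decomp : forall M, exists L R (u : Hom L M) (v : Hom M R) (w : Hom R (sh L)),
    [/\ dist u v w, le L & shift_class ge 1 R]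
}.

Definition w_heart : preadditive := full_sub (fun X : C => le X /\ ge X).

End WStructure.

Definition hocolim (Y : nat -> C) (phi : forall i, Hom (Y i) (Y i.+1)) (H : C) :
    Prop :=
  exists (S : C) (inj : forall i, Hom (Y i) S) (s : Hom S S)
         (v : Hom S H) (w : Hom H (sh S)),
    [/\ is_coproduct inj,
        forall i, s ∘ inj i = inj i - inj i.+1 ∘ phi i
      & dist s v w].

Definition big_hull (S : C -> Prop) : C -> Prop :=
  retract_closure (fun H => exists (Y : nat -> C)
      (phi : forall i, Hom (Y i) (Y i.+1)),
    [/\ coproduct_closure S (Y 0),
        forall i, exists Z (v : Hom (Y i.+1) Z) (w : Hom Z (sh (Y i))),
          dist (phi i) v w /\ coproduct_closure S Z
      & hocolim phi H]).

Definition gen_le (Q : C -> Prop) (X : C) : Prop :=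
  forall P : C -> Prop, extension_closed P -> coproduct_closed P ->
    (forall (i : nat) Y, shift_class Q i%:Z Y -> P Y) -> P X.

Definition gen_ge (Q : C -> Prop) (X : C) : Prop :=
  forall i : nat, (1 <= i)%N -> shift_class (perp Q) i%:Z X.

(* [qhat] ranges over all representatives of the Brown-Comenetz dual of q. *)
Definition BC_shifts (Q : C -> Prop) (Y : C) : Prop :=
  exists (q qhat : C) (i : nat),
    [/\ Q q, BC_dual q qhat & isomorphic (C := C) Y (shiftz i%:Z qhat)].

End InTriangulated.

Definition op_big_hull (C : tri_data) (S : C -> Prop) : C -> Prop :=
  @big_hull (tri_op C) S.

(* Main.v *)
(* The t-structure is built by a countable tower of cell attachments.  The heart
   is abelian, and by compactness its objects are "sheaves" on finite extensions
   of the objects q[i], i >= 0: an epimorphism of the heart becomes surjective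
   on maps from such an extension d after replacing d by some d' -> d that
   remains jointly epic towards the heart.  This yields a set of generators and
   exactness of filtered colimits.  An abelian category with coproducts and a
   generator G represents every contravariant functor that
   sends cokernels to kernels and coproducts to products; applied to products of
   Hom functors this gives AB3*, and applied to Y |-> Hom_R(Hom(G, Y), J), where
   R = End(G) and J is an injective hull of Hom(G, X), it embeds X into an
   injective object.  The weight structure comes from a dual tower, with products
   of shifted Brown-Comenetz duals instead of coproducts of shifts of q; its
   lim^1 terms vanish by a Mittag-Leffler argument. *)
From HB Require Import structures.
From mathcomp Require Import all_boot all_order all_algebra.
From mathcomp Require Import boolp classical_sets.
From mathcomp Require Import zify generic_quotient ring_quotient.
Require Import Defs.
Set Implicit Arguments.
Unset Strict Implicit.
Unset Printing Implicit Defensive.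
Import GRing.Theory Num.Theory.
Local Open Scope ring_scope.
Local Open Scope cat_scope.

(** * Subgroups and characters of abelian groups *)

(** The generator G of the heart is an infinite coproduct of covers and is not assumed projective,
    so Hom(G, -) need be neither right exact nor compatible with coproducts. This shapes the
    construction of injectives: for an arbitrary injective module J the functor Hom_R(Hom(G, -), J)
    need not be right exact. If J is an essential extension of Hom(G, X), a nonzero value can be
    multiplied into Hom(G, X), where it is tested after pulling back along an epimorphism of the
    heart. Compactness is used in the form [finfac]: a map into a coproduct is a finite sum of maps
    through summands. This form passes through triangles and requires no direct sums of abelian
    groups. The characters into Q/Z serve three purposes: they turn compactness into [finfac], they
    embed modules into cofree ones, and their extension property makes the Brown-Comenetz functors
    cohomological. Filtered colimits of the heart need not be colimits in C, hence the detour
    through covers by finite extensions. Brown representability also splits idempotents, which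
    realizes every injective of the heart by an object of the weight heart. *)

Section RationalsModZ.

Local Notation intQ := (GRing.ZmodClosed.clone rat (@Num.int_num_subdef rat) _).

Definition qz (x : rat) : QmodZ := (\pi_(Quotient.quot intQ) x)%qT.

Lemma qzD x y : qz (x + y) = qz x + qz y.
Proof. by rewrite /qz Quotient.pi_add. Qed.

Lemma qz0 : qz 0 = 0.
Proof. by apply: (addrI (qz 0)); rewrite -qzD !addr0. Qed.

Lemma qzN x : qz (- x) = - qz x.
Proof. by apply: (addrI (qz x)); rewrite -qzD !subrr qz0. Qed.

Lemma qzMn x n : qz (x *+ n) = qz x *+ n.
Proof.
by elim: n => [|n IH]; rewrite ?mulr0n ?qz0 // !mulrS qzD IH.
Qed.

Lemma qzMz x n : qz (x *~ n) = qz x *~ n.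
Proof. by case: n => n; rewrite ?NegzE ?mulrNz ?qzN -?pmulrn qzMn. Qed.

Lemma qz_eq0 x : (qz x = 0) <-> x \in Num.int.
Proof.
have e : (x \in Num.int) = (qz x == qz 0).
  by rewrite -[x in LHS]subr0; exact: (Quotient.idealrBE intQ x 0).
by rewrite e qz0; split=> [->|/eqP].
Qed.

Lemma qz_surj u : exists x, u = qz x.
Proof. by exists (repr u); rewrite /qz reprK. Qed.

Lemma QmodZ_div (u : QmodZ) (k : int) : k != 0 -> exists v, v *~ k = u.
Proof.
move=> k0; have [x ->] := qz_surj u; exists (qz (x / k%:~R)).
by rewrite -qzMz -mulrzl mulrC divfK ?intr_eq0.
Qed.

(** Here [k] will be the order of an element modulo a subgroup, with 0 standing for infinite order;
    in that case any nonzero element would do, and 1/2 is taken. *)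
Lemma QmodZ_order (k : nat) : (k != 1)%N ->
  exists2 v : QmodZ, v != 0 & v *+ k = 0.
Proof.
case: k => [|k] k1.
  exists (qz 2^-1); last by rewrite mulr0n.
  by apply/eqP => /qz_eq0.
exists (qz k.+1%:R^-1).
  apply/eqP => /qz_eq0 /intrP[m /(congr1 ( *%R k.+1%:R))].
  rewrite mulfV ?pnatr_eq0 // pmulrn -intrM => /eqP.
  rewrite -[1]/(1%:~R) eqr_int => /eqP e.
  have [m0|m0] : m <= 0 \/ 0 < m by lia.
    by nia.
  by nia.
by rewrite -qzMn -[_^-1 *+ _]mulr_natl mulfV ?pnatr_eq0 //; apply/qz_eq0; exact: rpred1.
Qed.

End RationalsModZ.

Definition subgroup (M : zmodType) (S : M -> Prop) : Prop :=
  S 0 /\ forall x y, S x -> S y -> S (x - y).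

Section Subgroups.
Variables (M : zmodType) (S : M -> Prop) (Ssub : subgroup S).

Lemma subgroup0 : S 0. Proof. by case: Ssub. Qed.
Lemma subgroupB x y : S x -> S y -> S (x - y).
Proof. by case: Ssub => _; exact. Qed.
Lemma subgroupN x : S x -> S (- x).
Proof. by rewrite -sub0r; apply: subgroupB; exact: subgroup0. Qed.
Lemma subgroupD x y : S x -> S y -> S (x + y).
Proof. by move=> Sx Sy; rewrite -[y]opprK; apply: subgroupB => //; exact: subgroupN. Qed.
Lemma subgroupMn x n : S x -> S (x *+ n).
Proof.
move=> Sx; elim: n => [|n IH]; rewrite ?mulr0n ?mulrS; first exact: subgroup0.
exact: subgroupD.
Qed.
Lemma subgroupMz x (n : int) : S x -> S (x *~ n).
Proof.
by case: n => n Sx; rewrite ?NegzE ?mulrNz -?pmulrn;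
  [exact: subgroupMn | apply: subgroupN; exact: subgroupMn].
Qed.

End Subgroups.

Lemma int_subgroup (S : int -> Prop) : subgroup S ->
  exists k : nat, forall n : int, S n <-> exists m : int, n = m * k%:Z.
Proof.
move=> Ssub.
have [[k [k0 Sk]]|none] := pselect (exists k : nat, (0 < k)%N /\ S k%:Z); last first.
  exists 0%N => n; split=> [Sn|[m ->]]; last by rewrite mulr0; exact: subgroup0.
  exists 0; rewrite mul0r.
  case: n Sn => [[|n]|n] Sn //; exfalso; apply: none; exists n.+1; split=> //.
  by rewrite NegzE in Sn; rewrite -[_%:Z]opprK; exact: subgroupN.
have ex : exists k, (0 < k)%N && `[< S k%:Z >].
  by exists k; rewrite k0; apply/asboolP.
case: (ex_minnP ex) => {ex k k0 Sk} k /andP[k0 /asboolP Sk] kmin.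
exists k => n; split=> [Sn|[m ->]]; last first.
  by rewrite mulrC -mulrzz; exact: subgroupMz.
exists (divz n k%:Z).
have kz : k%:Z != 0 by lia.
have Sr : S (modz n k%:Z).
  rewrite /modz; apply: subgroupB => //.
  by rewrite mulrC -mulrzz; exact: subgroupMz.
have r0 := modz_ge0 n kz.
have rk : (modz n k%:Z < k%:Z) by rewrite ltz_pmod //; lia.
rewrite {1}(divz_eq n k%:Z).
suff -> : modz n k%:Z = 0 by rewrite addr0.
case: (modz n k%:Z) Sr r0 rk => // [[|r]] // Sr _ rk; exfalso.
have : (k <= r.+1)%N by apply: kmin => /=; apply/asboolP.
lia.
Qed.

(** [A] is a bare type of operators: with [void] this gives subgroups, with an endomorphism ring it
    gives submodules. *)
Definition submod (M : zmodType) (A : Type) (act : A -> M -> M) (P : M -> Prop)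
    : Prop :=
  subgroup P /\ forall a x, P x -> P (act a x).

Lemma maximal_complement (M : zmodType) (A : Type) (act : A -> M -> M)
    (K B : M -> Prop) :
  submod act B -> (forall x, K x -> B x -> x = 0) ->
  exists B', [/\ submod act B', forall x, B x -> B' x,
    forall x, K x -> B' x -> x = 0 &
    forall B'', submod act B'' -> (forall x, B' x -> B'' x) ->
      (forall x, K x -> B'' x -> x = 0) -> forall x, B'' x -> B' x].
Proof.
move=> Bsub KB.
pose good (X : set M) := [/\ submod act X, forall x, B x -> X x &
  forall x, K x -> X x -> x = 0].
pose P (X : set M) := (forall x, ~ X x) \/ good X.
have [F FP totF|X [PX Xmax]] := @Zorn_bigcup M P.
  have [[X0 [FX0 gX0]]|none] := pselect (exists X, F X /\ good X); last first.
    left=> x [X FX Xx]; have [/(_ x)//|gX] := FP X FX.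
    by apply: none; exists X.
  have two X Y x y : F X -> F Y -> X x -> Y y -> exists Z, [/\ F Z, Z x & Z y].
    move=> FX FY Xx Yy; have [XY|YX] := totF X Y FX FY.
      by exists Y; split=> //; exact: XY.
    by exists X; split=> //; exact: YX.
  have gF X x : F X -> X x -> good X.
    by move=> FX Xx; have [/(_ x)//|] := FP X FX.
  right; split; first split; first split.
  - by exists X0 => //; case: gX0 => -[[? _] _].
  - move=> x y [X FX Xx] [Y FY Yy]; have [Z [FZ Zx Zy]] := two _ _ _ _ FX FY Xx Yy.
    by exists Z => //; have [[[_ ZB] _] _ _] := gF Z x FZ Zx; exact: ZB.
  - move=> a x [X FX Xx]; exists X => //.
    by have [[_ XA] _ _] := gF X x FX Xx; exact: XA.
  - by move=> x Bx; exists X0 => //; case: gX0 => _ h _; exact: h.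
  - by move=> x Kx [X FX Xx]; have [_ _ h] := gF X x FX Xx; exact: h.
have gB : good B by split.
have gX : good X.
  case: PX => // X0; exfalso; apply: (Xmax B); last by right.
  rewrite properEneq; split; last by move=> x /X0.
  apply/eqP => XB; apply: (X0 0); rewrite XB; case: Bsub => -[]//.
case: gX => Xsub BX KX; exists X; split=> // Y Ysub XY KY.
apply: contrapT => nYX; apply: (Xmax Y); last first.
  by right; split=> // x Bx; apply: XY; exact: BX.
by split.
Qed.

Section AdditiveOf.
Variables (U V : zmodType) (f : U -> V) (fD : forall x y, f (x + y) = f x + f y).

Lemma additive_of_subproof : nmod_morphism f.
Proof. by split=> //; apply: (addrI (f 0)); rewrite -fD !addr0. Qed.

Definition additive_of : {additive U -> V} :=
  GRing.Additive.Pack (GRing.Additive.Class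
    (GRing.isNmodMorphism.Build _ _ _ additive_of_subproof)).

End AdditiveOf.

(** [G] is the graph of a homomorphism defined on a subgroup of [M]. Such graphs are the subgroups
    of the product that meet 0 x Q/Z trivially, so a maximal one is a relative complement;
    divisibility of Q/Z makes its domain all of [M]. *)
Lemma QmodZ_extend (M : zmodType) (G : M -> QmodZ -> Prop) :
  G 0 0 -> (forall m m' y y', G m y -> G m' y' -> G (m - m') (y - y')) ->
  (forall y, G 0 y -> y = 0) ->
  exists f : {additive M -> QmodZ}, forall m y, G m y -> f m = y.
Proof.
move=> G0 GB Guniq.
pose act (a : void) (p : M * QmodZ) := p.
pose B (p : M * QmodZ) := G p.1 p.2; pose K (p : M * QmodZ) := p.1 = 0.
have [||B' [[Bs _] BB' KB' Bmax]] := @maximal_complement _ _ act K B.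
- by split=> //; split=> // x y; exact: GB.
- by move=> [m y]; rewrite /K /B /= => -> /Guniq ->.
have fun_ m y y' : B' (m, y) -> B' (m, y') -> y = y'.
  move=> h h'; have [] := KB' ((m, y) - (m, y')) (subrr m) (subgroupB Bs h h').
  by move=> _ /eqP; rewrite subr_eq0 => /eqP.
have tot m : exists y, B' (m, y).
  have [k kP] : exists k : nat, forall n : int,
      (exists y, B' (m *~ n, y)) <-> exists j : int, n = j * k%:Z.
    apply: int_subgroup; split; first by exists 0; exact: (subgroup0 Bs).
    move=> x y [u Bu] [v Bv]; exists (u - v); rewrite mulrzBr.
    exact: (subgroupB Bs Bu Bv).
  have [y0 By0] : exists y, B' (m *~ k%:Z, y) by apply/kP; exists 1; rewrite mul1r.
  have [y yk] : exists y, y *~ k%:Z = y0.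
    have [k0|k0] := eqVneq k 0%N; last by apply: QmodZ_div; lia.
    rewrite k0 mulr0z in By0 *; exists 0; rewrite mul0rz.
    exact: (fun_ _ _ _ (subgroup0 Bs) By0).
  (* The multiples of [m] in the domain are those of [m *~ k], whose value is [y0]; since
     [y *~ k = y0], the graph can be enlarged by sending [m] to [y]. *)
  exists y; pose B2 (p : M * QmodZ) := exists n q, B' q /\ p = q + (m, y) *~ n.
  suff : B2 (m, y).
    apply: Bmax.
    - split=> //; split; first by exists 0, 0; rewrite mulr0z addr0; split=> //; exact: (subgroup0 Bs).
      move=> p p' [n [q [Bq ->]]] [n' [q' [Bq' ->]]].
      exists (n - n'), (q - q'); split; first exact: (subgroupB Bs).
      by rewrite mulrzBr opprD addrACA.
    - by move=> p Bp; exists 0, p; rewrite mulr0z addr0.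
    - move=> p Kp [n [[m1 y1] [Bq e]]].
      have e1 : p.1 = m1 + m *~ n /\ p.2 = y1 + y *~ n.
        by rewrite e; split=> /=; congr (_ + _); [exact: (raddfMz fst) | exact: (raddfMz snd)].
      case: e1; rewrite Kp => /esym/eqP; rewrite addr_eq0 => /eqP m1E p2.
      have [j nE] : exists j : int, n = j * k%:Z.
        apply/kP; exists (- y1); rewrite -[_ *~ n]opprK -m1E.
        exact: (subgroupN Bs Bq).
      have Bj : B' ((m *~ k%:Z, y0) *~ j) by exact: (subgroupMz Bs j By0).
      have jE : (m *~ k%:Z, y0) *~ j = (m *~ n, y *~ n).
        rewrite -yk nE mulrC !mulrzA [LHS]surjective_pairing.
        by congr pair; [exact: (raddfMz fst) | exact: (raddfMz snd)].
      rewrite jE in Bj.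
      have := subgroupD Bs Bq Bj.
      have -> : (m1, y1) + (m *~ n, y *~ n) = (0, p.2).
        by rewrite [LHS]surjective_pairing /= m1E addNr p2.
      move=> h; have [p20] := KB' (0, p.2) erefl h.
      by rewrite [p]surjective_pairing Kp p20.
  by exists 1, 0; rewrite add0r; split=> //; exact: (subgroup0 Bs).
have [f fP] := boolp.choice tot.
have fD x y : f (x + y) = f x + f y.
  by apply: fun_ (fP _) _; exact: (subgroupD Bs (fP x) (fP y)).
exists (additive_of fD) => m y Gm /=.
by apply: fun_ (fP m) _; exact: BB'.
Qed.

(** * Functors to abelian groups *)

Lemma dep_choice (I : Type) (T : I -> Type) (P : forall i, T i -> Prop) :
  (forall i, exists x, P i x) -> exists f, forall i, P i (f i).
Proof.
by move=> h; exists (fun i => sval (boolp.cid (h i))) => i; exact: svalP.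
Qed.

(** On the subgroup generated by [S] and [z], send [S] to 0 and [z] to a nonzero element killed by
    the order of [z] modulo [S]; then extend to [M]. *)
Lemma QmodZ_separate (M : zmodType) (S : M -> Prop) z : subgroup S -> ~ S z ->
  exists f : {additive M -> QmodZ}, (forall s, S s -> f s = 0) /\ f z <> 0.
Proof.
move=> Ssub nSz.
have [k kP] : exists k : nat, forall n : int, S (z *~ n) <-> exists m : int, n = m * k%:Z.
  apply: int_subgroup; split; first by rewrite mulr0z; exact: subgroup0.
  by move=> x y Sx Sy; rewrite mulrzBr; exact: subgroupB.
have k1 : (k != 1)%N.
  by apply/eqP => k1; apply: nSz; apply/(kP 1); exists 1; rewrite k1 mul1r.
have [v v0 vk] := QmodZ_order k1.
pose G m y := exists s n, [/\ S s, m = s + z *~ n & y = v *~ n].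
have [|||f fG] := @QmodZ_extend _ G.
- by exists 0, 0; rewrite !mulr0z addr0; split=> //; exact: subgroup0.
- move=> m m' y y' [s [n [Ss -> ->]]] [s' [n' [Ss' -> ->]]].
  exists (s - s'), (n - n'); rewrite !mulrzBr; split=> //; first exact: subgroupB.
  by rewrite opprD addrACA.
- move=> y [s [n [Ss e ->]]].
  have /kP[m ->] : S (z *~ n).
    move/esym/eqP: e; rewrite addr_eq0 => /eqP e.
    by rewrite -[_ *~ _]opprK -e; exact: subgroupN.
  by rewrite mulrC mulrzA -pmulrn vk mul0rz.
exists f; split=> [s Ss|].
  by apply: fG; exists s, 0; rewrite !mulr0z addr0.
rewrite (fG z v); first exact/eqP.
by exists 0, 1; rewrite !mulr1z add0r; split=> //; exact: subgroup0.
Qed.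

Lemma QmodZ_cogen (M : zmodType) (z : M) :
  (forall f : {additive M -> QmodZ}, f z = 0) -> z = 0.
Proof.
move=> fz; apply: contrapT => z0.
have [|f [_ /(_ (fz f))]//] := @QmodZ_separate M (fun x => x = 0) z _ z0.
by split=> // x y -> ->; rewrite subrr.
Qed.

Definition Pi_zmod (I : Type) (V : I -> zmodType) := forall i, V i.

Section PiZmod.
Variables (I : small) (V : I -> zmodType).
HB.instance Definition _ := gen_eqMixin (Pi_zmod V).
HB.instance Definition _ := gen_choiceMixin (Pi_zmod V).
Let Pi0 : Pi_zmod V := fun=> 0.
Let PiN (f : Pi_zmod V) : Pi_zmod V := fun i => - f i.
Let PiD (f g : Pi_zmod V) : Pi_zmod V := fun i => f i + g i.
Let PiDA : associative PiD.
Proof. by move=> f g h; apply: functional_extensionality_dep => i; rewrite /PiD addrA. Qed.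
Let PiDC : commutative PiD.
Proof. by move=> f g; apply: functional_extensionality_dep => i; rewrite /PiD addrC. Qed.
Let Pi0D : left_id Pi0 PiD.
Proof. by move=> f; apply: functional_extensionality_dep => i; rewrite /PiD add0r. Qed.
Let PiND : left_inverse Pi0 PiN PiD.
Proof. by move=> f; apply: functional_extensionality_dep => i; rewrite /PiD addNr. Qed.
HB.instance Definition _ := GRing.isZmodule.Build (Pi_zmod V) PiDA PiDC Pi0D PiND.
End PiZmod.

Definition sub_zmod (M : zmodType) (S : M -> Prop) (Ssub : subgroup S) := {x : M | S x}.

Section SubZmod.
Variables (M : zmodType) (S : M -> Prop) (Ssub : subgroup S).
Let T := sub_zmod Ssub.
HB.instance Definition _ := gen_eqMixin (sub_zmod Ssub).
HB.instance Definition _ := gen_choiceMixin (sub_zmod Ssub).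
Let S0 : T := exist _ 0 (subgroup0 Ssub).
Let SN (x : T) : T := exist _ _ (subgroupN Ssub (svalP x)).
Let SD (x y : T) : T := exist _ _ (subgroupD Ssub (svalP x) (svalP y)).
Let SDA : associative SD.
Proof. by move=> x y z; apply: eq_exist => /=; rewrite addrA. Qed.
Let SDC : commutative SD.
Proof. by move=> x y; apply: eq_exist => /=; rewrite addrC. Qed.
Let S0D : left_id S0 SD.
Proof. by case=> x Sx; apply: eq_exist => /=; rewrite add0r. Qed.
Let SND : left_inverse S0 SN SD.
Proof. by move=> x; apply: eq_exist => /=; rewrite addNr. Qed.
HB.instance Definition _ := GRing.isZmodule.Build (sub_zmod Ssub) SDA SDC S0D SND.

Lemma sub_zmod_eq (x y : sub_zmod Ssub) : sval x = sval y -> x = y.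
Proof. by case: x y => [x Sx] [y Sy] /= e; exact: eq_exist. Qed.
End SubZmod.

Section AbFunctors.
Variable A : preadditive.

Definition fap (H : additive_functor A Ab) X Y (f : Hom X Y) (x : H X) : H Y :=
  (fmap H f : AbHom _ _) x.

Variable H : additive_functor A Ab.

Lemma fap1 X (x : H X) : fap (idm X) x = x.
Proof. by rewrite /fap fmap1. Qed.

Lemma fapM X Y Z (g : Hom Y Z) (f : Hom X Y) (x : H X) :
  fap (g ∘ f) x = fap g (fap f x).
Proof. by rewrite /fap fmapM. Qed.

Lemma fapB X Y (f : Hom X Y) (x y : H X) : fap f (x - y) = fap f x - fap f y.
Proof. by rewrite /fap raddfB. Qed.

Lemma fap0 X Y (f : Hom X Y) : fap f (0 : H X) = 0.
Proof. by rewrite /fap raddf0. Qed.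

Lemma fapBl X Y (f g : Hom X Y) (x : H X) : fap (f - g) x = fap f x - fap g x.
Proof. by rewrite /fap raddfB. Qed.

Lemma fap0l X Y (x : H X) : fap (0 : Hom X Y) x = 0.
Proof. by rewrite /fap raddf0. Qed.

End AbFunctors.
Arguments fap {A} H {X Y} f x.

Section AbFunctorOf.
Variables (A : preadditive) (V : A -> zmodType).
Variable a : forall X Y, Hom X Y -> V X -> V Y.
Hypothesis aD : forall X Y (f : Hom X Y) x y, a f (x + y) = a f x + a f y.
Hypothesis aDl : forall X Y (f g : Hom X Y) x, a (f + g) x = a f x + a g x.
Hypothesis a1 : forall X x, a (idm X) x = x.
Hypothesis aM : forall X Y Z (g : Hom Y Z) (f : Hom X Y) x,
  a (g ∘ f) x = a g (a f x).

Definition ab_arrow X Y (f : Hom X Y) : AbHom (V X) (V Y) :=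
  additive_of (aD f).

Lemma ab_arrowD X Y (f g : Hom X Y) :
  ab_arrow (f + g) = ab_arrow f + ab_arrow g.
Proof. by apply: AbHom_eq => x; exact: aDl. Qed.

Lemma ab_arrow1 X : ab_arrow (idm X) = idm (V X : Ab).
Proof. by apply: AbHom_eq => x; exact: a1. Qed.

Lemma ab_arrowM X Y Z (g : Hom Y Z) (f : Hom X Y) :
  ab_arrow (g ∘ f) = @comp Ab (V X) (V Y) (V Z) (ab_arrow g) (ab_arrow f).
Proof. by apply: AbHom_eq => x; exact: aM. Qed.

Definition ab_functor : additive_functor A Ab :=
  @AdditiveFunctor A Ab V (fun X Y => additive_of (@ab_arrowD X Y))
    ab_arrow1 ab_arrowM.

End AbFunctorOf.

(** Elements of an abelian group are maps from [int], which turns the universal property into unique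
    existence of elements. *)
Lemma Ab_product_elt (I : small) (F : I -> Ab) (P : Ab) (pr : forall i, Hom P (F i)) :
  is_product pr <->
  forall x : (forall i, F i : zmodType),
    exists! y : (P : zmodType), forall i, (pr i : AbHom _ _) y = x i.
Proof.
split=> [prP x|prP Y f].
  have iD (V : zmodType) (v : V) (m n : int) : v *~ (m + n) = v *~ m + v *~ n.
    by rewrite mulrzDr.
  pose el (V : zmodType) (v : V) : @Hom Ab (int : zmodType) V := additive_of (iD V v).
  have [g [gP gu]] := prP (int : zmodType) (fun i => el _ (x i)).
  have elE (V : zmodType) (h : @Hom Ab (int : zmodType) V) : h = el V ((h : AbHom _ _) 1).
    by apply: AbHom_eq => n /=; rewrite -raddfMz intz.
  exists ((g : AbHom _ _) 1); split=> [i|y yP].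
    have := congr1 (fun h : AbHom _ _ => h 1) (gP i).
    by rewrite /= mulr1z ?yP.
  have -> : g = el _ y.
    apply: gu => i; rewrite [LHS]elE; congr (el _ _).
    by rewrite /= mulr1z ?yP.
  by rewrite /= mulr1z.
have [g gP] := boolp.choice (fun y : (Y : zmodType) => prP (fun i => (f i : AbHom _ _) y)).
have gD x y : g (x + y) = g x + g y.
  have [_] := gP (x + y); apply=> i.
  have [gx _] := gP x; have [gy _] := gP y.
  by rewrite !raddfD gx gy.
exists (additive_of gD : AbHom _ _); split=> [i|h hP].
  by apply: AbHom_eq => y; have [/(_ i)] := gP y.
apply: AbHom_eq => y /=; have [_] := gP y; apply=> i.
by rewrite -(hP i).
Qed.

Definition pull (A : preadditive) (H : additive_functor (op A) Ab) (X Y : A)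
    (f : Hom X Y) (y : H Y) : H X :=
  @fap (op A) H Y X f y.

Section Pull.
Variables (A : preadditive) (H : additive_functor (op A) Ab).

Lemma pullM (X Y Z : A) (g : Hom Y Z) (f : Hom X Y) (z : H Z) :
  pull (g ∘ f) z = pull f (pull g z).
Proof. exact: (@fapM (op A) H Z Y X f g z). Qed.

Lemma pullB (X Y : A) (f : Hom X Y) (x y : H Y) :
  pull f (x - y) = pull f x - pull f y.
Proof. exact: fapB. Qed.

Lemma pull0 (X Y : A) (f : Hom X Y) : pull f (0 : H Y) = 0.
Proof. exact: fap0. Qed.

Lemma pullBl (X Y : A) (f g : Hom X Y) (y : H Y) :
  pull (f - g) y = pull f y - pull g y.
Proof. exact: fapBl. Qed.

Lemma pull0l (X Y : A) (y : H Y) : pull (0 : Hom X Y) y = 0.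
Proof. exact: (@fap0l (op A) H Y X y). Qed.

Lemma preserves_products_elt : preserves_products H <->
  forall (I : small) (F : I -> A) S (inj : forall i, Hom (F i) S),
    is_coproduct inj -> forall x : (forall i, H (F i) : zmodType),
    exists! y : H S, forall i, pull (inj i) y = x i.
Proof.
split=> [HP I F S inj injP|h I F S inj injP].
  by have /Ab_product_elt := HP I F S inj injP.
by apply/Ab_product_elt; exact: (h I F S inj injP).
Qed.

End Pull.

(** A universal element in the sense of Yoneda: representability of [H] without natural
    transformations. *)
Definition universal (A : preadditive) (H : additive_functor (op A) Ab) (X : A)
    (x : H X) : Prop :=
  forall (Y : A) (y : H Y), exists! g : Hom Y X, pull g x = y.

Lemma iso_universal (A : preadditive) (H : additive_functor (op A) Ab) (X : A) :
  isomorphic (C := AddFun (op A) Ab) (rep X) H -> exists x : H X, universal x.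
Proof.
case=> a [b [ba ab]].
have baE Y (f : Hom Y X) : (b Y : AbHom _ _) ((a Y : AbHom _ _) f) = f.
  have := congr1 (fun c : @nat_trans (op A) Ab (rep X) (rep X) => (c Y : AbHom _ _) f) ba.
  by [].
have abE Y y : (a Y : AbHom _ _) ((b Y : AbHom _ _) y) = y.
  exact: (congr1 (fun c : @nat_trans (op A) Ab H H => (c Y : AbHom _ _) y) ab).
have aE Y (g : Hom Y X) : pull g ((a X : AbHom _ _) (idm X)) = (a Y : AbHom _ _) g.
  have := congr1 (fun h : AbHom _ _ => h (idm X)) (ntcP a (g : @Hom (op A) X Y)).
  by move=> e; apply: etrans (esym e) _; congr ((a Y : AbHom _ _) _); exact: (@comp1l A Y X g).
exists ((a X : AbHom _ _) (idm X)) => Y y.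
exists ((b Y : AbHom _ _) y); split=> [|g]; first by rewrite aE abE.
by rewrite aE => <-; rewrite baE.
Qed.

(** * Coproducts and compact objects *)

Section PreadditiveBasics.
Variable A : preadditive.

Lemma comp0l (X Y Z : A) (f : Hom X Y) : (0 : Hom Y Z) ∘ f = 0.
Proof. by apply: (addrI (0 ∘ f)); rewrite -compDl !addr0. Qed.

Lemma comp0r (X Y Z : A) (g : Hom Y Z) : g ∘ (0 : Hom X Y) = 0.
Proof. by apply: (addrI (g ∘ 0)); rewrite -compDr !addr0. Qed.

Lemma compNl (X Y Z : A) (g : Hom Y Z) (f : Hom X Y) : (- g) ∘ f = - (g ∘ f).
Proof. by apply: (addrI (g ∘ f)); rewrite -compDl !subrr comp0l. Qed.

Lemma compNr (X Y Z : A) (g : Hom Y Z) (f : Hom X Y) : g ∘ (- f) = - (g ∘ f).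
Proof. by apply: (addrI (g ∘ f)); rewrite -compDr !subrr comp0r. Qed.

Lemma compBl (X Y Z : A) (g h : Hom Y Z) (f : Hom X Y) :
  (g - h) ∘ f = g ∘ f - h ∘ f.
Proof. by rewrite compDl compNl. Qed.

Lemma compBr (X Y Z : A) (g : Hom Y Z) (f h : Hom X Y) :
  g ∘ (f - h) = g ∘ f - g ∘ h.
Proof. by rewrite compDr compNr. Qed.

Lemma comp_suml (X Y Z : A) (I : Type) (r : seq I) (g : I -> Hom Y Z)
    (f : Hom X Y) :
  (\sum_(i <- r) g i) ∘ f = \sum_(i <- r) (g i ∘ f).
Proof.
elim: r => [|i r IH]; first by rewrite !big_nil comp0l.
by rewrite !big_cons compDl IH.
Qed.

Lemma epiP (X Y : A) (f : Hom X Y) :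
  epi f <-> forall W (g : Hom Y W), g ∘ f = 0 -> g = 0.
Proof.
split=> [ef W g gf|ef W g h gh]; first by apply: ef; rewrite gf comp0l.
by apply/eqP; rewrite -subr_eq0; apply/eqP/ef; rewrite compBl gh subrr.
Qed.

Lemma monoP (X Y : A) (f : Hom X Y) :
  mono f <-> forall W (g : Hom W X), f ∘ g = 0 -> g = 0.
Proof.
split=> [ef W g gf|ef W g h gh]; first by apply: ef; rewrite gf comp0r.
by apply/eqP; rewrite -subr_eq0; apply/eqP/ef; rewrite compBr gh subrr.
Qed.

Lemma idm_zero (X : A) : idm X = 0 -> is_zero X.
Proof.
by move=> X0 Y; split=> f; [rewrite -[f]comp1r X0 comp0r | rewrite -[f]comp1l X0 comp0l].
Qed.

Lemma isoP (X Y : A) (f : Hom X Y) :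
  is_iso (C := A) f <-> exists g, g ∘ f = idm X /\ f ∘ g = idm Y.
Proof. by []. Qed.

Lemma isomorphicP (X Y : A) : isomorphic (C := A) X Y <->
  exists (f : Hom X Y) (g : Hom Y X), g ∘ f = idm X /\ f ∘ g = idm Y.
Proof. by []. Qed.

Lemma iso_id (X : A) : is_iso (C := A) (idm X).
Proof. by exists (idm X); split; exact: comp1l. Qed.

Lemma is_kernel_mono (X Y K : A) (f : Hom X Y) (k : Hom K X) :
  is_kernel f k -> mono k.
Proof.
case=> fk kP W g h e; have [|x [_ u]] := kP W (k ∘ g).
  by rewrite compA fk comp0l.
by rewrite -(u g) // -(u h).
Qed.

Lemma is_cokernel_epi (X Y K : A) (f : Hom X Y) (k : Hom Y K) :
  is_cokernel f k -> epi k.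
Proof.
case=> fk kP W g h e; have [|x [_ u]] := kP W (g ∘ k).
  by rewrite -compA fk comp0r.
by rewrite -(u g) // -(u h).
Qed.

Lemma kernel_lift (X Y K : A) (f : Hom X Y) (k : Hom K X) W (g : Hom W X) :
  is_kernel f k -> f ∘ g = 0 -> exists h, k ∘ h = g.
Proof. by case=> _ kP /kP[h [hP _]]; exists h. Qed.

Lemma cokernel_desc (X Y K : A) (f : Hom X Y) (k : Hom Y K) W (g : Hom Y W) :
  is_cokernel f k -> g ∘ f = 0 -> exists h, h ∘ k = g.
Proof. by case=> _ kP /kP[h [hP _]]; exists h. Qed.

End PreadditiveBasics.

Section Coproducts.
Variables (A : preadditive) (I : small) (F : I -> A) (S : A).
Variable inj : forall i, Hom (F i) S.

Lemma coproductP :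
  (forall Y (f : forall i, Hom (F i) Y), exists g : Hom S Y, forall i, g ∘ inj i = f i) ->
  (forall Y (g : Hom S Y), (forall i, g ∘ inj i = 0) -> g = 0) ->
  is_coproduct inj.
Proof.
move=> ex un Y f; have [g gP] := ex Y f; exists g; split=> // h hP.
apply/eqP; rewrite -subr_eq0; apply/eqP/un => i.
by rewrite compBl gP hP subrr.
Qed.

Section Facts.
Hypothesis injP : is_coproduct inj.

Lemma coproduct_desc Y (f : forall i, Hom (F i) Y) :
  exists g : Hom S Y, forall i, g ∘ inj i = f i.
Proof. by have [g [gP _]] := injP f; exists g. Qed.

Lemma coproduct_ext Y (g h : Hom S Y) : (forall i, g ∘ inj i = h ∘ inj i) -> g = h.
Proof. by move=> e; have [x [_ u]] := injP (fun i => h ∘ inj i); rewrite -(u g) // -(u h). Qed.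

Lemma coproduct_eq0 Y (g : Hom S Y) : (forall i, g ∘ inj i = 0) -> g = 0.
Proof. by move=> e; apply: coproduct_ext => i; rewrite e comp0l. Qed.

Lemma coproduct_proj : exists p : (forall i, Hom S (F i)),
  (forall i, p i ∘ inj i = idm (F i)) /\ (forall i j, i <> j -> p j ∘ inj i = 0).
Proof.
have h j : exists p : Hom S (F j), forall i, p ∘ inj i =
    match pselect (i = j) with
    | left e => eq_rect i (fun k => Hom (F i) (F k)) (idm (F i)) j e
    | right _ => 0
    end.
  exact: coproduct_desc.
exists (fun j => sval (boolp.cid (h j))); split=> [i|i j ij];
  case: (boolp.cid _) => /= p ->; case: pselect => //.
by move=> e; rewrite (Prop_irrelevance e erefl).
Qed.

End Facts.

(** Adding one summand at a time allows induction over finite maps without forming finite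
    subcoproducts. *)
Inductive finspan (c : A) : Hom c S -> Prop :=
| finspan0 : finspan 0
| finspanD i (g : Hom c (F i)) z : finspan z -> finspan (inj i ∘ g + z).

Lemma finspan_inj c i (g : Hom c (F i)) : finspan (inj i ∘ g).
Proof. by rewrite -[_ ∘ _]addr0; apply: finspanD; exact: finspan0. Qed.

Lemma finspan_add c (z z' : Hom c S) : finspan z -> finspan z' -> finspan (z + z').
Proof.
move=> + Hz'; elim => [|i g y _ IH]; first by rewrite add0r.
by rewrite -addrA; exact: finspanD.
Qed.

Lemma finspan_opp c (z : Hom c S) : finspan z -> finspan (- z).
Proof.
elim => [|i g y _ IH]; first by rewrite oppr0; exact: finspan0.
by rewrite opprD -compNr; exact: finspanD.
Qed.

Lemma finspan_subgroup c : subgroup (@finspan c).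
Proof.
split; first exact: finspan0.
by move=> x y xs ys; apply: finspan_add => //; exact: finspan_opp.
Qed.

Lemma finspan_comp c d (z : Hom c S) (r : Hom d c) : finspan z -> finspan (z ∘ r).
Proof.
elim => [|i g y _ IH]; first by rewrite comp0l; exact: finspan0.
by rewrite compDl -compA; exact: finspanD.
Qed.

(** The expansion holds over every finite set containing the support, so that supports of several
    maps can be merged; [{classic I}] supplies equality tests on the index type. *)
Lemma finspan_sum c (p : forall i, Hom S (F i)) (z : Hom c S) :
  (forall i, p i ∘ inj i = idm (F i)) -> (forall i j, i <> j -> p j ∘ inj i = 0) ->
  finspan z ->
  exists r : seq {classic I}, forall r', uniq r' -> {subset r <= r'} ->
    z = \sum_(i <- r') inj i ∘ (p i ∘ z).
Proof.
move=> p1 p0; elim => [|i g y _ [r rP]].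
  by exists [::] => r' _ _; rewrite big1 // => i _; rewrite !comp0r.
exists ((i : {classic I}) :: r) => r' ur' rr'.
rewrite {1}(rP r') //; last by move=> x xr; apply: rr'; rewrite inE xr orbT.
under [RHS]eq_bigr do rewrite !compDr.
rewrite big_split /=; congr (_ + _).
have ir' : (i : {classic I}) \in r' by apply: rr'; rewrite inE eqxx.
rewrite (bigD1_seq (i : {classic I})) //= [p i ∘ _]compA p1 comp1l.
rewrite big1 ?addr0 // => j /eqP ji.
by rewrite [p j ∘ _]compA p0 ?comp0l ?comp0r // => ij; apply: ji.
Qed.

End Coproducts.
Arguments finspan {A I F S} inj {c}.

(* The elementary form of compactness; unlike [compact] it makes extension
   closure evident. *)
Definition finfac (A : preadditive) (c : A) : Prop :=
  forall (I : small) (F : I -> A) S (inj : forall i, Hom (F i) S),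
    is_coproduct inj -> forall z : Hom c S, finspan inj z.

(** If [z] were outside the subgroup of finite maps, a character of [Hom c S] would kill that
    subgroup but not [z]. It vanishes on every [Hom c (F i)], and [Hom c S] is their coproduct, so
    it is zero. *)
Lemma compact_finfac (A : preadditive) (c : A) : compact c -> finfac c.
Proof.
move=> cc I F S inj injP z; apply: contrapT => nz.
have [f [fS fz]] := QmodZ_separate (finspan_subgroup inj c) nz.
have co := cc I F S inj injP.
have f0 : (f : @Hom Ab (Hom c S) QmodZ) = 0.
  apply: (coproduct_eq0 co) => i; apply: AbHom_eq => g.
  by apply: fS; exact: finspan_inj.
by apply: fz; rewrite f0.
Qed.

(** * Triangulated categories *)

Lemma equiv_preserves_coproducts (A B : preadditive) (F : additive_functor A B) :
  (forall X Y, injective (fmap F : Hom X Y -> _)) ->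
  (forall X Y (g : Hom (F X) (F Y)), exists f, fmap F f = g) ->
  (forall Y : B, exists X, isomorphic (C := B) Y (F X)) ->
  preserves_coproducts F.
Proof.
move=> ff ful es I G S inj injP; apply: coproductP => [Y f|Y g g0].
  have [X /isomorphicP[a [b [ba ab]]]] := es Y.
  have h i : exists f', fmap F f' = a ∘ f i by exact: ful.
  have [g gP] := coproduct_desc injP (fun i => sval (boolp.cid (h i))).
  exists (b ∘ fmap F g) => i.
  rewrite -compA -fmapM gP; case: (boolp.cid _) => /= f' ->.
  by rewrite compA ba comp1l.
have [X /isomorphicP[a [b [ba ab]]]] := es Y.
have [g' g'P] := ful _ _ (a ∘ g).
have g'0 : g' = 0.
  apply: (coproduct_eq0 injP) => i; apply: ff.
  by rewrite fmapM g'P -compA g0 comp0r raddf0.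
move: g'P; rewrite g'0 raddf0 => e.
by rewrite -[g]comp1l -ba -compA -e comp0r.
Qed.

Lemma equiv_preserves_products (A B : preadditive) (F : additive_functor A B) :
  (forall X Y, injective (fmap F : Hom X Y -> _)) ->
  (forall X Y (g : Hom (F X) (F Y)), exists f, fmap F f = g) ->
  (forall Y : B, exists X, isomorphic (C := B) Y (F X)) ->
  preserves_products F.
Proof.
move=> ff ful es.
apply: (@equiv_preserves_coproducts (op A) (op B) (op_functor F)) => [X Y|X Y g|Y].
- exact: ff.
- exact: ful.
- have [X [a [b [ba ab]]]] := es Y; exists X, b, a; split.
    exact: ba.
  exact: ab.
Qed.

Section TriangulatedBasics.
Variable C : triangulated.
Let ax := triP C.

Lemma sh_inj (X Y : C) : injective (fmap sh : Hom X Y -> _).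
Proof.
move=> f g e; have [a [_ ea]] := sh_counit_iso ax X.
rewrite -[f]comp1r -[g]comp1r.
have <- : sh_counit X ∘ a = idm X by exact: ea.
by rewrite !compA !(sh_counit_nat ax) e.
Qed.

Lemma unsh_inj (X Y : C) : injective (fmap unsh : Hom X Y -> _).
Proof.
move=> f g e; have [a [ea _]] := sh_unit_iso ax Y.
rewrite -[f]comp1l -[g]comp1l.
have <- : (a : Hom (sh (unsh Y)) Y) ∘ sh_unit Y = idm Y by exact: ea.
by rewrite -!compA !(sh_unit_nat ax) e.
Qed.

Lemma sh_full (X Y : C) (g : Hom (sh X) (sh Y)) : exists f, fmap sh f = g.
Proof.
have [a [ea _]] := sh_counit_iso ax X.
have {}ea : (a : Hom X (unsh (sh X))) ∘ sh_counit X = idm _ by exact: ea.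
exists (sh_counit Y ∘ fmap unsh g ∘ a); apply: unsh_inj.
have [b [eb _]] := sh_counit_iso ax Y.
have {}eb : (b : Hom Y (unsh (sh Y))) ∘ sh_counit Y = idm _ by exact: eb.
rewrite -[LHS]comp1l -eb -[LHS]compA -(sh_counit_nat ax).
by rewrite -!compA ea comp1r compA eb comp1l.
Qed.

Lemma unsh_full (X Y : C) (g : Hom (unsh X) (unsh Y)) : exists f, fmap unsh f = g.
Proof.
have [a [ea ae]] := sh_unit_iso ax Y.
have {}ae : sh_unit Y ∘ (a : Hom _ Y) = idm _ by exact: ae.
exists (a ∘ fmap sh g ∘ sh_unit X); apply: sh_inj.
have [b [_ be]] := sh_unit_iso ax X.
have {}be : sh_unit X ∘ (b : Hom _ X) = idm _ by exact: be.
rewrite -[LHS]comp1r -be [LHS]compA -(sh_unit_nat ax).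
by rewrite !compA ae comp1l -compA be comp1r.
Qed.

Lemma sh_ess (Y : C) : exists X : C, isomorphic (C := C) Y (sh X).
Proof. by exists (unsh Y), (sh_unit Y); exact: (sh_unit_iso ax). Qed.

Lemma unsh_ess (Y : C) : exists X : C, isomorphic (C := C) Y (unsh X).
Proof.
exists (sh Y); have [a [h1 h2]] := sh_counit_iso ax Y.
by exists a, (sh_counit Y).
Qed.

Lemma sh_coproducts : preserves_coproducts (@sh C).
Proof. exact: equiv_preserves_coproducts sh_inj sh_full sh_ess. Qed.
Lemma unsh_coproducts : preserves_coproducts (@unsh C).
Proof. exact: equiv_preserves_coproducts unsh_inj unsh_full unsh_ess. Qed.
Lemma sh_products : preserves_products (@sh C).
Proof. exact: equiv_preserves_products sh_inj sh_full sh_ess. Qed.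
Definition eta (X : C) : Hom X (sh (unsh X)) := sh_unit X.
Definition eti (X : C) : Hom (sh (unsh X)) X := sval (boolp.cid (sh_unit_iso ax X)).

Lemma etiK X : eti X ∘ eta X = idm X.
Proof. by rewrite /eti; case: (boolp.cid _) => /= a [ea _]; exact: ea. Qed.

Lemma etaK X : eta X ∘ eti X = idm _.
Proof. by rewrite /eti; case: (boolp.cid _) => /= a [_ ea]; exact: ea. Qed.

Lemma eta_nat (X Y : C) (f : Hom X Y) :
  eta Y ∘ f = fmap sh (fmap unsh f) ∘ eta X.
Proof. exact: sh_unit_nat. Qed.

Lemma to_sh (W X : C) (f : Hom W (sh X)) :
  exists f' : Hom (unsh W) X, f = fmap sh f' ∘ eta W.
Proof.
have [f' e] := sh_full (f ∘ eti W).
by exists f'; rewrite e -compA etiK comp1r.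
Qed.

Lemma from_sh (W X : C) (f : Hom (sh W) X) :
  exists f' : Hom W (unsh X), f = eti X ∘ fmap sh f'.
Proof.
have [f' e] := sh_full (eta X ∘ f).
by exists f'; rewrite e compA etiK comp1l.
Qed.

Lemma zero_object : exists Z : C, is_zero Z.
Proof. by case: (tri_additive ax). Qed.

Lemma sh_zero (X : C) : is_zero X -> is_zero (sh X).
Proof.
move=> X0; apply: idm_zero; rewrite -fmap1.
by rewrite (proj1 (X0 X) (idm X)) raddf0.
Qed.

Lemma zero_to (X Y : C) (f : Hom X Y) : is_zero Y -> f = 0.
Proof. by move=> /(_ X)[]. Qed.

Lemma zero_from (X Y : C) (f : Hom X Y) : is_zero X -> f = 0.
Proof. by move=> /(_ Y)[]. Qed.

Section Triangle.
Variables (X Y Z : C) (u : Hom X Y) (v : Hom Y Z) (w : Hom Z (sh X)).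
Hypothesis T : dist u v w.

Lemma rot : dist v w (- fmap sh u).
Proof. exact: (proj1 (dist_rotate ax u v w) T). Qed.

Lemma tri_vu : v ∘ u = 0.
Proof.
have [O O0] := zero_object.
have [c [e _]] := dist_morphism ax (dist_id ax (X := X) (Z := O) 0 0 O0) T
  (erefl : u ∘ idm X = u ∘ idm X).
by rewrite -e comp0r.
Qed.

End Triangle.

Section Exactness.
Variables (X Y Z : C) (u : Hom X Y) (v : Hom Y Z) (w : Hom Z (sh X)).
Hypothesis T : dist u v w.

Lemma tri_wv : w ∘ v = 0.
Proof. exact: tri_vu (rot T). Qed.

Lemma tri_uw : fmap sh u ∘ w = 0.
Proof. by apply/eqP; rewrite -oppr_eq0 -compNl; apply/eqP; exact: tri_vu (rot (rot T)). Qed.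

Lemma tri_lift W (f : Hom W Y) : v ∘ f = 0 -> exists g, u ∘ g = f.
Proof.
move=> vf; have [O O0] := zero_object.
have idT : dist (0 : Hom W O) (0 : Hom O (sh W)) (- fmap sh (idm W)).
  exact: rot (dist_id ax _ _ O0).
have [|c [_ e]] := dist_morphism ax idT (rot T) (a := f) (b := 0 : Hom O Z).
  by rewrite vf comp0l.
have [g gE] := sh_full c; exists g; apply: sh_inj.
rewrite fmapM gE; apply/oppr_inj; rewrite -compNl -e.
by rewrite fmap1 compNr comp1r.
Qed.

Lemma tri_desc W (f : Hom Y W) : f ∘ u = 0 -> exists g, g ∘ v = f.
Proof.
move=> fu; have [O O0] := zero_object.
have idT : dist (0 : Hom O W) (idm W) (0 : Hom W (sh O)).
  apply: (proj2 (dist_rotate ax _ _ _)); rewrite raddf0 oppr0; apply: (dist_id ax).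
  exact: sh_zero.
have [|c [e _]] := dist_morphism ax T idT (a := 0 : Hom X O) (b := f).
  by rewrite fu comp0l.
by exists c; rewrite e comp1l.
Qed.

End Exactness.

Section MoreExactness.
Variables (X Y Z : C) (u : Hom X Y) (v : Hom Y Z) (w : Hom Z (sh X)).
Hypothesis T : dist u v w.

Lemma tri_lift2 W (f : Hom W Z) : w ∘ f = 0 -> exists g, v ∘ g = f.
Proof. exact: tri_lift (rot T) _ _. Qed.

Lemma tri_lift3 W (f : Hom W (sh X)) : fmap sh u ∘ f = 0 -> exists g, w ∘ g = f.
Proof. by move=> e; apply: (tri_lift (rot (rot T))); rewrite compNl e oppr0. Qed.

Lemma tri_desc2 W (f : Hom Z W) : f ∘ v = 0 -> exists g, g ∘ w = f.
Proof. exact: tri_desc (rot T) _ _. Qed.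

Lemma tri_desc3 W (f : Hom (sh X) W) : f ∘ w = 0 -> exists g, g ∘ fmap sh u = f.
Proof.
move=> e; have [g gE] := tri_desc (rot (rot T)) e.
by exists (- g); rewrite compNl -compNr.
Qed.

(** Three rotations put a minus sign on all three maps; negating the middle object removes two of
    the signs. *)
Lemma dist_sh : dist (fmap sh u) (fmap sh v) (- fmap sh w).
Proof.
have iN (W : C) : is_iso (C := C) (- idm W).
  by exists (- idm W); split; rewrite /= compNl compNr comp1l opprK.
apply: (dist_iso ax (iso_id _) (iN _) (iso_id _) _ _ _ (rot (rot (rot T)))).
- by rewrite comp1r compNl compNr comp1l opprK.
- by rewrite comp1l compNr comp1r.
- by rewrite fmap1 comp1l comp1r.
Qed.

Lemma tri_iso_u : is_zero Z -> is_iso (C := C) u.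
Proof.
move=> Z0; have [|g gP] := tri_lift T (f := idm Y); first exact: zero_to.
exists g; split; last exact: gP.
have [|h hP] := tri_lift3 (f := fmap sh (g ∘ u - idm X)).
  by rewrite -fmapM compBr compA gP comp1l comp1r subrr raddf0.
apply/eqP; rewrite -subr_eq0; apply/eqP/sh_inj.
by rewrite /= -hP (zero_to h Z0) comp0r raddf0.
Qed.

End MoreExactness.

Lemma tri_iso_v (X Y Z : C) (u : Hom X Y) (v : Hom Y Z) (w : Hom Z (sh X)) :
  dist u v w -> is_zero X -> is_iso (C := C) v.
Proof. by move=> T X0; apply: (tri_iso_u (rot T)); exact: sh_zero. Qed.

Lemma fiber3 (X Z : C) (g : Hom Z (sh X)) : exists Y (u : Hom X Y) (v : Hom Y Z), dist u v g.
Proof.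
have [W [a [b T]]] := dist_cone ax g.
have [a' a'E] := sh_full (eta W ∘ a).
have [b' b'E] := sh_full (b ∘ eti W).
exists (unsh W), (- a'), (- b').
do 2 apply: (proj2 (dist_rotate ax _ _ _)); rewrite !raddfN !opprK a'E b'E.
apply: (dist_iso ax (iso_id _) (iso_id _) (sh_unit_iso ax W) _ _ _ T).
- by rewrite comp1l comp1r.
- by rewrite comp1r.
- by rewrite fmap1 comp1l -compA [eti _ ∘ _]etiK comp1r.
Qed.

Lemma fiber (Y Z : C) (v : Hom Y Z) : exists X (u : Hom X Y) (w : Hom Z (sh X)), dist u v w.
Proof.
have [W [a [b T]]] := dist_cone ax v.
have [u uE] := sh_full (b ∘ eti W).
exists (unsh W), (- u), (eta W ∘ a).
apply: (proj2 (dist_rotate ax _ _ _)); rewrite raddfN opprK uE.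
apply: (dist_iso ax (iso_id _) (iso_id _) (sh_unit_iso ax W) _ _ _ T).
- by rewrite comp1l comp1r.
- by rewrite comp1r.
- by rewrite fmap1 comp1l -compA [eti _ ∘ _]etiK comp1r.
Qed.

Lemma dist_biproduct (X Y P : C) (i1 : Hom X P) (i2 : Hom Y P) (p1 : Hom P X)
    (p2 : Hom P Y) :
  [/\ p1 ∘ i1 = idm X, p2 ∘ i2 = idm Y, p1 ∘ i2 = 0, p2 ∘ i1 = 0
    & i1 ∘ p1 + i2 ∘ p2 = idm P] -> dist i1 p2 0.
Proof.
case=> e11 e22 e12 e21 e; have [Z [v [w T]]] := dist_cone ax i1.
have w0 : w = 0.
  by rewrite -[w]comp1l -fmap1 -e11 fmapM -compA (tri_uw T) comp0r.
have [c cv] := tri_desc T e21.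
have [|t vt] := tri_lift2 T (f := idm Z); first by rewrite w0 comp0l.
have vi : v ∘ i2 ∘ p2 = v.
  rewrite -compA; have -> : i2 ∘ p2 = idm P - i1 ∘ p1 by rewrite -e addrC addKr.
  by rewrite compBr comp1r compA (tri_vu T) comp0l subr0.
have ci : is_iso (C := C) c.
  exists (v ∘ i2); split; last by rewrite /= compA cv.
  by rewrite /= -[_ ∘ c]comp1r -vt compA -[_ ∘ c ∘ v]compA cv vi.
apply: (dist_iso ax (iso_id _) (iso_id _) ci _ _ _ T).
- by rewrite comp1l comp1r.
- by rewrite comp1r.
- by rewrite w0 comp0l comp0r.
Qed.

End TriangulatedBasics.

Notation shn n X := (shiftz (Posz n) X).

Section Finfac.
Variable C : triangulated.

Lemma eti_nat (X Y : C) (f : Hom X Y) :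
  eti Y ∘ fmap sh (fmap unsh f) = f ∘ eti X.
Proof. by rewrite -[LHS]comp1r -etaK -compA [_ ∘ (eta X ∘ _)]compA -eta_nat !compA etiK comp1l. Qed.

Lemma finfac_sh (c : C) : finfac c -> finfac (sh c).
Proof.
move=> cf I F S inj injP z; have [z' ->] := from_sh z.
have := cf _ _ _ _ (unsh_coproducts injP) z'.
elim=> [|i g y _ IH]; first by rewrite raddf0 comp0r; exact: finspan0.
rewrite raddfD compDr fmapM compA eti_nat -compA.
exact: finspanD.
Qed.

Lemma finfac_unsh (c : C) : finfac c -> finfac (unsh c).
Proof.
move=> cf I F S inj injP z.
have := finspan_comp (eti c) (cf _ _ _ _ (sh_coproducts injP) (fmap sh z ∘ eta c)).
rewrite -compA etaK comp1r; move e : (fmap sh z) => y ys.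
elim: ys z e => [|i g {}y _ IH] z e.
  by have -> : z = 0; [apply: sh_inj; rewrite e raddf0 | exact: finspan0].
have [g' gE] := sh_full g.
rewrite -[z](addrNK (inj i ∘ g')) addrC; apply: finspanD; apply: IH.
by rewrite raddfB e fmapM gE addrAC subrr add0r.
Qed.

(** [f ∘ u] lands in finitely many summands, cut out by the projector [e]. Then [f - e ∘ f] kills
    [u] and factors through [Z], while [e ∘ f] is visibly finite. *)
Lemma finfac_ext (X Y Z : C) (u : Hom X Y) (v : Hom Y Z) (w : Hom Z (sh X)) :
  dist u v w -> finfac X -> finfac Z -> finfac Y.
Proof.
move=> T Xf Zf I F S inj injP f.
have [p [p1 p0]] := coproduct_proj injP.
have [r rP] := finspan_sum p1 p0 (Xf _ _ _ _ injP (f ∘ u)).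
pose e := \sum_(i <- undup r) inj i ∘ p i.
have [|g gv] := tri_desc T (f := f - e ∘ f).
  rewrite compBl -compA {1}(rP (undup r)) ?undup_uniq //; last by move=> x; rewrite mem_undup.
  rewrite /e comp_suml; apply/eqP; rewrite subr_eq0; apply/eqP.
  by apply: eq_bigr => i _; rewrite compA.
rewrite -[f](subrK (e ∘ f)); apply: finspan_add.
  by rewrite -gv; apply: finspan_comp; exact: Zf.
rewrite /e comp_suml; elim: (undup r) => [|i l IH]; first by rewrite big_nil; exact: finspan0.
by rewrite big_cons -compA; exact: finspanD.
Qed.

Lemma finfac_zero (X : C) : is_zero X -> finfac X.
Proof. by move=> X0 I F S inj _ z; rewrite (zero_from z X0); exact: finspan0. Qed.

Lemma finfac_shn n (c : C) : finfac c -> finfac (shn n c).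
Proof. by move=> cf; elim: n => [|n IH] //; exact: finfac_sh. Qed.

End Finfac.

(** * Mapping telescopes and maps into them from compact objects *)

Section Hocolim.
Variables (C : triangulated) (L : nat -> C) (l : forall k, Hom (L k) (L k.+1)).
Variables (S H : C) (inj : forall k, Hom (L k) S) (s : Hom S S) (v : Hom S H)
  (w : Hom H (sh S)).
Hypothesis injP : is_coproduct inj.
Hypothesis sE : forall k, s ∘ inj k = inj k - inj k.+1 ∘ l k.
Hypothesis T : dist s v w.

Lemma hocolim_step k : v ∘ inj k = v ∘ inj k.+1 ∘ l k.
Proof.
apply/eqP; rewrite -subr_eq0 -compA -compBr -sE compA (tri_vu T) comp0l.
exact/eqP.
Qed.

Lemma hocolim_later k m W (x : Hom W (L k)) : (k <= m)%N ->
  exists x', v ∘ inj k ∘ x = v ∘ inj m ∘ x'.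
Proof.
move=> km; rewrite -(subnKC km); elim: (m - k)%N => [|j [x' IH]]; first by rewrite addn0; exists x.
by rewrite addnS IH; exists (l (k + j)%N ∘ x'); rewrite hocolim_step compA.
Qed.

(** The coordinates of [s ∘ t] force those of [t] to vanish one after the other, starting at 0; a
    finite map is determined by its coordinates. *)
Lemma telescope_inj W (t : Hom W S) : finspan inj t -> s ∘ t = 0 -> t = 0.
Proof.
move=> tf st; have [p [p1 p0]] := coproduct_proj injP.
have ps0 : p 0%N ∘ s = p 0%N.
  apply: (coproduct_ext injP) => j; rewrite -compA sE compBr [_ ∘ (inj j.+1 ∘ _)]compA.
  by rewrite (p0 j.+1 0%N) // comp0l subr0.
have ps k : p k.+1 ∘ s = p k.+1 - l k ∘ p k.
  apply: (coproduct_ext injP) => j; rewrite -compA sE compBr compBl -compA [_ ∘ (inj j.+1 ∘ _)]compA.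
  congr (_ - _); have [->|kj] := pselect (j = k); first by rewrite !p1 comp1l comp1r.
  by rewrite !p0 ?comp0l ?comp0r // => -[].
have pt k : p k ∘ t = 0.
  elim: k => [|k IH]; first by rewrite -ps0 -compA st comp0r.
  have := congr1 (comp (p k.+1)) st; rewrite compA ps compBl -compA IH.
  by rewrite !comp0r subr0.
have [r rP] := finspan_sum p1 p0 tf.
rewrite (rP (undup r)) ?undup_uniq //; last by move=> x; rewrite mem_undup.
by rewrite big1 // => i _; rewrite pt comp0r.
Qed.

(** The obstruction to lifting [y] to the coproduct is a finite map killed by [s], hence zero by
    [telescope_inj]; the lift is a finite sum and can be pushed to a common stage. *)
Lemma hocolim_factor c (y : Hom c H) : finfac c ->
  exists k x, y = v ∘ inj k ∘ x.
Proof.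
move=> cf; have [t tE] := to_sh (w ∘ y).
have t0 : t = 0.
  apply: telescope_inj; first exact: (finfac_unsh cf).
  apply: sh_inj; rewrite raddf0 -[LHS]comp1r -etaK compA fmapM -[_ ∘ eta c]compA -tE.
  by rewrite compA (tri_uw T) !comp0l.
have [|z <-] := tri_lift2 T (f := y); first by rewrite tE t0 raddf0 comp0l.
have := cf _ _ _ _ injP z; elim=> [|i g {}z _ [k [x IH]]].
  by exists 0%N, 0; rewrite !comp0r.
rewrite compDr IH compA.
have [x1 ->] := hocolim_later x (leq_maxl k i).
have [x2 ->] := hocolim_later g (leq_maxr k i).
by exists (maxn k i), (x2 + x1); rewrite compDr.
Qed.

Lemma hocolim_factor_sh c (y : Hom c (sh H)) : finfac c ->
  exists k x, y = fmap sh (v ∘ inj k) ∘ x.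
Proof.
move=> cf; have [y' ->] := to_sh y.
have [k [x ->]] := hocolim_factor y' (finfac_unsh cf).
by exists k, (fmap sh x ∘ eta c); rewrite fmapM compA.
Qed.

End Hocolim.

Section Shifts.
Variable C : triangulated.
Let ax := triP C.

Lemma isomorphic_refl (X : C) : isomorphic (C := C) X X.
Proof. by exists (idm X); exact: iso_id. Qed.

Lemma isomorphic_sym (X Y : C) : isomorphic (C := C) X Y -> isomorphic (C := C) Y X.
Proof. by case/isomorphicP=> f [g [h1 h2]]; apply/isomorphicP; exists g, f. Qed.

Lemma isomorphic_trans (X Y Z : C) : isomorphic (C := C) X Y ->
  isomorphic (C := C) Y Z -> isomorphic (C := C) X Z.
Proof.
case/isomorphicP=> f [g [h1 h2]] /isomorphicP[f' [g' [h1' h2']]].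
apply/isomorphicP; exists (f' ∘ f), (g ∘ g'); split.
  by rewrite -compA [g' ∘ _]compA h1' comp1l.
by rewrite -compA [f ∘ _]compA h2 comp1l.
Qed.

Lemma isomorphic_sh (X Y : C) : isomorphic (C := C) X Y ->
  isomorphic (C := C) (sh X) (sh Y).
Proof.
case/isomorphicP=> f [g [h1 h2]]; apply/isomorphicP; exists (fmap sh f), (fmap sh g).
by rewrite -!fmapM h1 h2 !fmap1.
Qed.

Lemma isomorphic_eta (X : C) : isomorphic (C := C) X (sh (unsh X)).
Proof. by apply/isomorphicP; exists (eta X), (eti X); rewrite etiK etaK. Qed.

Lemma isomorphic_eps (X : C) : isomorphic (C := C) X (unsh (sh X)).
Proof. by apply: isomorphic_sym; exists (sh_counit X); exact: sh_counit_iso. Qed.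

Lemma iso_shn n (X : C) : exists Y : C, isomorphic (C := C) X (shn n Y).
Proof.
elim: n => [|n [Y IH]]; first by exists X; exact: isomorphic_refl.
exists (unsh Y); apply: isomorphic_trans IH _.
have : isomorphic (C := C) (shn n Y) (shn n (sh (unsh Y))).
  elim: n => [|n IH]; first exact: isomorphic_eta.
  exact: isomorphic_sh.
by congr isomorphic; elim: n => //= n ->.
Qed.

Lemma shn_vanish n (X Y : C) :
  (forall f : Hom X Y, f = 0) <-> (forall f : Hom (shn n X) (shn n Y), f = 0).
Proof.
elim: n => [|n IH] //; rewrite IH; split=> h f.
  by have [f' <-] := sh_full f; rewrite (h f') raddf0.
by apply: sh_inj; rewrite (h (fmap sh f)) raddf0.
Qed.

Lemma iso_vanish (X Y Y' : C) : isomorphic (C := C) Y Y' ->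
  (forall f : Hom X Y, f = 0) -> forall f : Hom X Y', f = 0.
Proof.
case/isomorphicP=> a [b [h1 h2]] h f.
by rewrite -[f]comp1l -h2 -compA (h (b ∘ f)) comp0r.
Qed.

Lemma iso_vanish_l (X X' Y : C) : isomorphic (C := C) X X' ->
  (forall f : Hom X Y, f = 0) -> forall f : Hom X' Y, f = 0.
Proof.
case/isomorphicP=> a [b [h1 h2]] h f.
by rewrite -[f]comp1r -h2 compA (h (f ∘ a)) comp0l.
Qed.

Lemma ext_iso_closed (P : C -> Prop) : extension_closed P -> iso_closed P.
Proof.
case=> P0 Pext X Y [f fi] PX; have [O O0] := zero_object C.
apply: (Pext X Y O f 0 0) => //; last exact: P0.
apply: (dist_iso ax (iso_id _) fi (iso_id _) _ _ _ (dist_id ax (X := X) (0 : Hom _ O) 0 O0)).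
- by [].
- by rewrite comp0l comp0r.
- by rewrite comp0l comp0r.
Qed.

End Shifts.

(** * The t-structure generated by Q *)

(** For [m] = 1 this is the class of the objects t>=0, for [m] = 0 that of the objects t>=1. *)
Definition right_of (C : tri_data) (Q : C -> Prop) (m : nat) (X : C) : Prop :=
  forall q n, Q q -> (m <= n)%N -> forall f : Hom (shn n q) X, f = 0.

Section GeneratedClasses.
Variables (C : triangulated) (Q : C -> Prop).

Lemma gen_geP (X : C) : gen_ge Q X <-> right_of Q 1 X.
Proof.
split=> [h q n Qq n1|h i i1].
  have [Y [QY /isomorphic_sym YX]] := h n n1.
  by apply: (iso_vanish YX); apply: (proj1 (shn_vanish n q Y)); exact: QY.
have [Y XY] := iso_shn i X; exists Y; split=> // q Qq; apply: (proj2 (shn_vanish i q Y)).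
by apply: (iso_vanish XY); exact: h.
Qed.

Lemma right_of_iso m : iso_closed (@right_of C Q m).
Proof. by move=> X Y XY XQ q n Qq mn; apply: (iso_vanish XY); exact: XQ. Qed.

Lemma right_of_retract m : retract_closed (@right_of C Q m).
Proof.
move=> X Y [i [p pi]] YQ q n Qq mn f.
by rewrite -[f]comp1l -pi -compA (YQ q n Qq mn (i ∘ f)) comp0r.
Qed.

Lemma right_of_sh m (X : C) : right_of Q m.+1 (sh X) <-> right_of Q m X.
Proof.
split=> h q n Qq mn f; first by apply: sh_inj; rewrite raddf0; exact: (h q n.+1).
case: n mn f => // n mn f; have [f' <-] := sh_full f.
by rewrite (h q n Qq mn f') raddf0.
Qed.

Lemma right_of_le m m' (X : C) : (m <= m')%N -> right_of Q m X -> right_of Q m' X.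
Proof. by move=> mm h q n Qq mn; apply: h => //; exact: leq_trans mn. Qed.

Lemma gen_le_ext : extension_closed (gen_le Q).
Proof.
split=> [Z Z0 P Pe _ _|X Y Z u v w T XQ ZQ P Pe Pc PQ]; first by case: Pe => h _; exact: h.
by case: (Pe) => _ /(_ _ _ _ _ _ _ T); apply; [exact: XQ|exact: ZQ].
Qed.

Lemma gen_le_coproduct : coproduct_closed (gen_le Q).
Proof.
by move=> I F S inj injP FQ P Pe Pc PQ; apply: (Pc _ _ _ _ injP) => i; exact: FQ.
Qed.

Lemma gen_le_gen n q : Q q -> gen_le Q (shn n q).
Proof.
by move=> Qq P _ _ PQ; apply: (PQ n); exists q; split=> //; exact: isomorphic_refl.
Qed.

Lemma gen_le_sh (X : C) : gen_le Q X -> gen_le Q (sh X).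
Proof.
move=> XQ; apply: (XQ (fun X => gen_le Q (sh X))); first split=> [Z Z0|A B D u v w T].
- by case: gen_le_ext => h _; exact: (h _ (sh_zero Z0)).
- by case: gen_le_ext => _; apply; exact: (dist_sh T).
- by move=> I F S inj injP; exact: (gen_le_coproduct (sh_coproducts injP)).
- move=> n Y [q [Qq /isomorphic_sh Yq]].
  apply: (ext_iso_closed gen_le_ext (isomorphic_sym Yq)).
  exact: (gen_le_gen n.+1 Qq).
Qed.

(** The objects without nonzero maps to [Y] are closed under extensions and coproducts and contain
    the generators. *)
Lemma gen_le_orth (X Y : C) : gen_le Q X -> right_of Q 0 Y -> forall f : Hom X Y, f = 0.
Proof.
move=> XQ YQ; apply: (XQ (fun X => forall f : Hom X Y, f = 0)).
- split=> [Z Z0 f|A B D u v w T A0 D0 f]; first exact: zero_from.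
  have [g <-] := tri_desc T (A0 (f ∘ u)); by rewrite (D0 g) comp0l.
- by move=> I F S inj injP F0 f; apply: (coproduct_eq0 injP) => i; exact: F0.
- move=> n X' [q [Qq /isomorphic_sym X'q]]; apply: (iso_vanish_l X'q).
  exact: YQ.
Qed.

End GeneratedClasses.

Section GeneratedTStructure.
Variables (C : triangulated) (I : small) (Qf : I -> C).
Hypothesis C_coproducts : has_coproducts C.
Hypothesis Qf_finfac : forall i, finfac (Qf i).
Let ax := triP C.
Let Q (X : C) := exists i, Qf i = X.

Let le := gen_le Q.

(** Take the coproduct of the objects q[n], one copy for each map from q[n] to [M]. *)
Lemma tower_start (M : C) : exists L (f : Hom L M), le L /\
  forall i n (x : Hom (shn n (Qf i)) M), exists y, f ∘ y = x.
Proof.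
have [L [inj injP]] := C_coproducts
  (fun t : {i : I & {n : nat & Hom (shn n (Qf i)) M}} => shn (projT1 (projT2 t)) (Qf (projT1 t))).
have [f fP] := coproduct_desc injP (fun t => projT2 (projT2 t)).
exists L, f; split.
  by apply: (gen_le_coproduct injP) => -[i [n x]]; apply: gen_le_gen; exists i.
move=> i n x; exists (inj (existT _ i (existT _ n x))).
exact: (fP (existT _ i (existT _ n x))).
Qed.

(* [L'] is obtained from [L] by killing all maps from q[n], n >= -1, to [L]
   that vanish in [M]; up to a shift these are attached along cells q[n],
   n >= 0. *)
Lemma tower_step (M L : C) (f : Hom L M) : le L ->
  exists L' (f' : Hom L' M) (l : Hom L L'), [/\ le L', f' ∘ l = f &
    forall i n (x : Hom (shn n (Qf i)) (sh L)),
      fmap sh f ∘ x = 0 -> fmap sh l ∘ x = 0].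
Proof.
move=> lL; have [P [inj injP]] := C_coproducts
  (fun t : {i : I & {n : nat & {x : Hom (shn n (Qf i)) (sh L) | fmap sh f ∘ x = 0}}} =>
    shn (projT1 (projT2 t)) (Qf (projT1 t))).
have [p pP] := coproduct_desc injP (fun t => sval (projT2 (projT2 t))).
have [L' [l [b T]]] := fiber3 p.
have [|g gE] := tri_desc3 T (f := fmap sh f).
  apply: (coproduct_eq0 injP) => -[i [n [x x0]]].
  by rewrite -compA pP.
have [f' f'E] := sh_full g.
exists L', f', l; split.
- case: (gen_le_ext Q) => _; apply; [exact: T|exact: lL|].
  by apply: (gen_le_coproduct injP) => -[i [n x]]; apply: gen_le_gen; exists i.
- by apply: sh_inj; rewrite fmapM f'E.
- move=> i n x x0; pose t := existT _ i (existT _ n (exist _ x x0))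
    : {i : I & {n : nat & {x : Hom (shn n (Qf i)) (sh L) | fmap sh f ∘ x = 0}}}.
  have <- : p ∘ (inj t : Hom (shn n (Qf i)) P) = x by exact: (pP t).
  by rewrite compA (tri_uw T) comp0l.
Qed.

(** The left part is the telescope of the tower over [M]. A map from q[n] to the cone gives a map to
    the shifted telescope; by compactness this comes from a finite stage, and it dies in the next
    one. So the map comes from [M], hence from the first stage, hence is zero. *)
Lemma gen_decomp (M : C) : exists L R (u : Hom L M) (v : Hom M R) (w : Hom R (sh L)),
  [/\ dist u v w, le L & right_of Q 0 R].
Proof.
have [L0 [f0 [lL0 f0P]]] := tower_start M.
pose st := {L : C & {f : Hom L M | le L}}.
have nx (s : st) : exists s' : st, exists l : Hom (projT1 s) (projT1 s'),
    sval (projT2 s') ∘ l = sval (projT2 s) /\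
    forall i n (x : Hom (shn n (Qf i)) (sh (projT1 s))),
      fmap sh (sval (projT2 s)) ∘ x = 0 -> fmap sh l ∘ x = 0.
  case: s => L [f lL]; have [L' [f' [l [lL' e h]]]] := tower_step f lL.
  by exists (existT _ L' (exist _ f' lL')), l.
pose nxt s := sval (boolp.cid (nx s)).
pose s k : st := iter k nxt (existT _ L0 (exist _ f0 lL0)).
pose L k := projT1 (s k).
pose f k : Hom (L k) M := sval (projT2 (s k)).
pose l k : Hom (L k) (L k.+1) := sval (boolp.cid (svalP (boolp.cid (nx (s k))))).
have lP k : f k.+1 ∘ l k = f k /\ forall i n (x : Hom (shn n (Qf i)) (sh (L k))),
    fmap sh (f k) ∘ x = 0 -> fmap sh (l k) ∘ x = 0.
  exact: (svalP (boolp.cid (svalP (boolp.cid (nx (s k)))))).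
have [S [inj injP]] := C_coproducts L.
have [t tE] := coproduct_desc injP (fun k => inj k - inj k.+1 ∘ l k).
have [H [v [w T]]] := dist_cone ax t.
have [g gE] := coproduct_desc injP f.
have [|h hE] := tri_desc T (f := g).
  apply: (coproduct_eq0 injP) => k; rewrite -compA tE compBr gE compA gE.
  by rewrite (proj1 (lP k)) subrr.
have hk k : h ∘ (v ∘ inj k) = f k by rewrite compA hE gE.
have lS : le S by apply: (gen_le_coproduct injP) => k; exact: (svalP (projT2 (s k))).
have [R [c [d T']]] := dist_cone ax h.
exists H, R, h, c, d; split=> //.
  (* The telescope is an extension of [sh S] by [S]. *)
  case: (gen_le_ext Q) => _; apply; [exact: (rot T)|exact: lS|].
  exact: gen_le_sh.
move=> _ n [i <-] _ y.
have [k [x xE]] := hocolim_factor_sh injP tE T (d ∘ y) (finfac_shn (n := n) (@Qf_finfac i)).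
have dy : d ∘ y = 0.
  rewrite xE (hocolim_step tE T) fmapM -compA (proj2 (lP k)) ?comp0r //.
  by rewrite -hk fmapM -compA -xE compA (tri_uw T') comp0l.
have [z <-] := tri_lift2 T' dy.
have [z' <-] := f0P i n z.
have -> : f0 = h ∘ (v ∘ inj 0%N) by rewrite hk.
by rewrite !compA (tri_vu T') !comp0l.
Qed.

Lemma right_of_coproduct m : coproduct_closed (right_of (C := C) Q m).
Proof.
move=> J F S inj injP FQ _ n [i <-] mn f.
have := finfac_shn (n := n) (@Qf_finfac i) injP f; elim=> [|j g z _ ->] //.
by rewrite (FQ j (Qf i) n _ mn g) ?comp0r ?addr0 //; exists i.
Qed.

Lemma t_ge1P (X : C) : t_ge (gen_ge Q) 1 X <-> right_of Q 0 X.
Proof.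
split=> [[Y [/gen_geP YQ XY]]|XQ].
  apply: (right_of_iso (isomorphic_sym XY)); apply/right_of_sh.
  by apply: (right_of_iso (isomorphic_eta Y)).
exists (sh X); split; first by apply/gen_geP/right_of_sh.
exact: isomorphic_eps.
Qed.

Lemma gen_t_structure : t_structure le (gen_ge Q).
Proof.
split.
- exact: ext_iso_closed (gen_le_ext Q).
- by move=> X Y XY /gen_geP XQ; apply/gen_geP; exact: right_of_iso XQ.
- move=> X [Y [lY XY]]; apply: (ext_iso_closed (gen_le_ext Q) (isomorphic_sym XY)).
  exact: gen_le_sh.
- move=> X /gen_geP XQ; exists (unsh X); split; last exact: isomorphic_eta.
  apply/gen_geP/right_of_sh; apply: (right_of_iso (isomorphic_eta X)).
  exact: right_of_le XQ.
- by move=> X Y f lX /t_ge1P YQ; exact: gen_le_orth lX YQ f.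
- move=> M; have [L [R [u [v [w [T lL RQ]]]]]] := gen_decomp M.
  by exists L, R, u, v, w; split=> //; apply/t_ge1P.
Qed.

Lemma gen_t_smashing : t_smashing (gen_ge Q).
Proof.
split=> // J F S inj injP FQ; apply/gen_geP.
by apply: (right_of_coproduct injP) => j; apply/gen_geP.
Qed.

End GeneratedTStructure.

(** * The heart of a t-structure *)

Section Heart.
Variables (C : triangulated) (le ge : C -> Prop).
Hypothesis tP : t_structure le ge.
Let ax := triP C.

Lemma t_ge1E (Y : C) : t_ge ge 1 Y <-> ge (sh Y).
Proof.
split=> [[X [gX YX]]|gY].
  apply: (t_ge_iso tP) gX; apply: isomorphic_sym.
  exact: isomorphic_trans (isomorphic_sh YX) (isomorphic_sym (isomorphic_eta X)).
by exists (sh Y); split=> //; exact: isomorphic_eps.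
Qed.

Lemma le_sh (X : C) : le X -> le (sh X).
Proof. by move=> lX; apply: (t_le_shift tP); exists X; split=> //; exact: isomorphic_refl. Qed.

Lemma ge_unsh (X : C) : ge (sh X) -> ge X.
Proof.
case/(t_ge_shift tP)=> Y [gY [f [g [h1 h2]]]].
have [f' f'E] := sh_full (f : Hom (sh X) (sh Y)).
have [g' g'E] := sh_full (g : Hom (sh Y) (sh X)).
apply: (t_ge_iso tP) gY; apply/isomorphicP; exists g', f'.
by split; apply: sh_inj; rewrite fmapM fmap1 f'E g'E.
Qed.

Lemma orth1 (X Y : C) (f : Hom X Y) : le X -> ge (sh Y) -> f = 0.
Proof. by move=> lX gY; apply: (t_orth tP) => //; apply/t_ge1E. Qed.

Lemma orth_sh (X Y : C) (f : Hom (sh X) Y) : le X -> ge Y -> f = 0.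
Proof.
move=> lX gY; have [f' ->] := from_sh f.
rewrite (orth1 f') ?raddf0 ?comp0r //.
exact: t_ge_iso tP _ _ (isomorphic_eta Y) gY.
Qed.

Lemma t_decomp1 (M : C) : exists L R (u : Hom L M) (v : Hom M R) (w : Hom R (sh L)),
  [/\ dist u v w, le L & ge (sh R)].
Proof.
have [L [R [u [v [w [T lL /t_ge1E gR]]]]]] := t_decomp tP M.
by exists L, R, u, v, w.
Qed.

(** If [X -> R] vanishes, the identity of [R] factors through [sh L], which has no nonzero map to
    [R]; so [R] is zero. Closure under extensions, not among the axioms in [t_structure], follows
    from this description. *)
Lemma leP (X : C) : (forall Y, ge (sh Y) -> forall f : Hom X Y, f = 0) -> le X.
Proof.
move=> X0; have [L [R [u [v [w [T lL gR]]]]]] := t_decomp1 X.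
have v0 : v = 0 by exact: X0.
have [|t tw] := tri_desc2 T (f := idm R); first by rewrite v0 comp0r.
have R0 : is_zero R.
  apply: idm_zero; rewrite -tw (orth1 t) ?comp0l //; exact: le_sh.
by apply: (t_le_iso tP) lL; exists u; exact: tri_iso_u T R0.
Qed.

Lemma ge1P (Y : C) : (forall X, le X -> forall f : Hom X Y, f = 0) -> ge (sh Y).
Proof.
move=> Y0; have [L [R [u [v [w [T lL gR]]]]]] := t_decomp1 Y.
have u0 : u = 0 by exact: Y0.
have [|t tw] := tri_lift3 T (f := idm (sh L)); first by rewrite u0 raddf0 comp0l.
have L0 : is_zero L.
  apply: idm_zero; apply: sh_inj; rewrite raddf0 fmap1 -tw (orth_sh t) ?comp0r //.
  exact: ge_unsh.
apply: (t_ge_iso tP) gR; apply: isomorphic_sym; apply: isomorphic_sh.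
by exists v; exact: tri_iso_v T L0.
Qed.

Lemma geP (Y : C) : (forall X, le X -> forall f : Hom (sh X) Y, f = 0) -> ge Y.
Proof.
move=> Y0; apply: (t_ge_iso tP) (isomorphic_sym (isomorphic_eta Y)) _.
apply: ge1P => X lX f; apply: sh_inj; rewrite raddf0 -[LHS]comp1l -etaK -compA.
by rewrite (Y0 X lX (eti Y ∘ fmap sh f)) comp0r.
Qed.

Lemma le_ext : extension_closed le.
Proof.
split=> [Z Z0|X Y Z u v w T lX lZ]; apply: leP => W gW f; first exact: zero_from.
have [|g <-] := tri_desc T (f := f); first exact: orth1.
by rewrite (orth1 g) ?comp0l.
Qed.

Lemma ge_ext : extension_closed ge.
Proof.
split=> [Z Z0|X Y Z u v w T lX lZ]; apply: geP => W lW f; first exact: zero_to.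
have [|g <-] := tri_lift T (f := f); first exact: orth_sh.
by rewrite (orth_sh g) ?comp0r.
Qed.

Lemma ge_fiber (X Y Z : C) (u : Hom X Y) (v : Hom Y Z) (w : Hom Z (sh X)) :
  dist u v w -> ge Y -> ge Z -> ge X.
Proof.
move=> T gY gZ; apply: geP => W lW f; apply: sh_inj; rewrite raddf0.
have [|g <-] := tri_lift3 T (f := fmap sh f).
  by rewrite -fmapM (orth_sh (u ∘ f)) ?raddf0.
by rewrite (orth_sh g) ?comp0r //; exact: le_sh.
Qed.

Lemma le_cofiber (X Y Z : C) (u : Hom X Y) (v : Hom Y Z) (w : Hom Z (sh X)) :
  dist u v w -> le X -> le Y -> le Z.
Proof. by move=> T lX lY; case: le_ext => _; apply; [exact: rot T | | exact: le_sh]. Qed.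

Definition in_heart (X : C) : Prop := le X /\ ge X.

Local Notation Ht := (t_heart le ge).

(** The fiber [F] has cohomology in degrees 0 and 1 only: [A] = H^0(F) will be the kernel of [f] and
    [sh B] = H^1(F) its cokernel. *)
Lemma heart_decomp (X Y F : C) (f : Hom X Y) (i : Hom F X) (w : Hom Y (sh F)) :
  in_heart X -> in_heart Y -> dist i f w ->
  exists A B (u : Hom A F) (v : Hom F B) (z : Hom B (sh A)),
    [/\ dist u v z, in_heart A, in_heart (sh B), ge F & le (sh F)].
Proof.
move=> [lX gX] [lY gY] T; have [A [B [u [v [z [T' lA gB]]]]]] := t_decomp1 F.
have gF := ge_fiber T gX gY.
have lF : le (sh F) by apply: (le_cofiber (rot T)).
exists A, B, u, v, z; split=> //; split=> //.
  by apply: (ge_fiber T' gF); exact: ge_unsh.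
by apply: (le_cofiber (dist_sh T')) => //; exact: le_sh.
Qed.

Section Decomposed.
Variables (X Y F A B : C) (f : Hom X Y) (i : Hom F X) (w : Hom Y (sh F)).
Variables (u : Hom A F) (v : Hom F B) (z : Hom B (sh A)).
Hypotheses (HX : in_heart X) (HY : in_heart Y) (T : dist i f w).
Hypotheses (T' : dist u v z) (HA : in_heart A) (HB : in_heart (sh B)).

Lemma decomposed_kernel_inj (W : C) (h : Hom W A) : le W -> i ∘ u ∘ h = 0 -> h = 0.
Proof.
move=> lW; rewrite -compA => iuh.
have uh : u ∘ h = 0.
  apply: sh_inj; rewrite raddf0.
  have [|t <-] := tri_lift3 T (f := fmap sh (u ∘ h)); first by rewrite -fmapM iuh raddf0.
  by rewrite (orth_sh t lW (proj2 HY)) comp0r.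
apply: sh_inj; rewrite raddf0.
have [|t <-] := tri_lift3 T' (f := fmap sh h); first by rewrite -fmapM uh raddf0.
by rewrite (orth_sh t lW) ?comp0r //; apply: ge_unsh; exact: (proj2 HB).
Qed.

Lemma decomposed_kernel (W : C) (g : Hom W X) : le W -> f ∘ g = 0 ->
  exists h, i ∘ u ∘ h = g.
Proof.
move=> lW /(tri_lift T)[g1 <-].
have [|h <-] := tri_lift T' (f := g1); first by apply: orth1 => //; exact: (proj2 HB).
by exists h; rewrite compA.
Qed.

Lemma decomposed_cokernel_inj (W : C) (h : Hom (sh B) W) : ge W ->
  h ∘ (fmap sh v ∘ w) = 0 -> h = 0.
Proof.
move=> gW; rewrite compA => hvw.
have hv : h ∘ fmap sh v = 0.
  have [t <-] := tri_desc3 T hvw.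
  by rewrite (orth_sh t (proj1 HX) gW) comp0l.
have [t <-] := tri_desc2 (dist_sh T') hv.
by rewrite (orth_sh t _ gW) ?comp0l //; apply: le_sh; exact: (proj1 HA).
Qed.

Lemma decomposed_cokernel (W : C) (g : Hom Y W) : ge W -> g ∘ f = 0 ->
  exists h, h ∘ (fmap sh v ∘ w) = g.
Proof.
move=> gW /(tri_desc2 T)[g1 <-].
have [|h <-] := tri_desc (dist_sh T') (f := g1); first by apply: orth_sh => //; exact: (proj1 HA).
by exists h; rewrite compA.
Qed.

End Decomposed.

(** The kernel [A] vanishes, so [sh F] is the cokernel: a short exact sequence of the heart comes
    from a triangle. *)
Lemma heart_mono_fiber (X Y : Ht) (F : C) (f : Hom X Y) (i : Hom F (sval X))
    (w : Hom (sval Y) (sh F)) :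
  mono f -> dist i (f : Hom (sval X) (sval Y)) w -> in_heart (sh F).
Proof.
move=> /monoP mf T.
have [A [B [u [v [z [T' HA HB gF lF]]]]]] := heart_decomp (svalP X) (svalP Y) T.
have iu : i ∘ u = 0.
  by apply: (mf (exist _ A HA) (i ∘ u)); rewrite /= compA (tri_vu T) comp0l.
have A0 : is_zero A.
  apply: idm_zero; apply: (decomposed_kernel_inj (svalP Y) T T' HB (proj1 HA)).
  by rewrite iu comp0l.
have BF : isomorphic (C := C) (sh B) (sh F).
  by apply/isomorphic_sh/isomorphic_sym; exists v; exact: tri_iso_v T' A0.
by split=> //; apply: (t_ge_iso tP) BF (proj2 HB).
Qed.

Lemma heart_epi_fiber (X Y : Ht) (F : C) (f : Hom X Y) (i : Hom F (sval X))
    (w : Hom (sval Y) (sh F)) :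
  epi f -> dist i (f : Hom (sval X) (sval Y)) w -> in_heart F.
Proof.
move=> /epiP ef T.
have [A [B [u [v [z [T' HA HB gF lF]]]]]] := heart_decomp (svalP X) (svalP Y) T.
have iu : fmap sh v ∘ w = 0.
  by apply: (ef (exist _ (sh B) HB) (fmap sh v ∘ w)); rewrite /= -compA (tri_wv T) comp0r.
have B0 : is_zero (sh B).
  apply: idm_zero; apply: (decomposed_cokernel_inj (svalP X) T T' HA (proj2 HB)).
  by rewrite iu comp0r.
have {}B0 : is_zero B.
  apply: idm_zero; apply: sh_inj; rewrite raddf0; exact: zero_to.
have AF : isomorphic (C := C) A F by exists u; exact: tri_iso_u T' B0.
by split=> //; apply: (t_le_iso tP) AF (proj1 HA).
Qed.

(** Kernels and cokernels are the two truncations of the fiber. A monomorphism is the kernel of the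
    next map of its triangle, whose target lies in the heart by [heart_mono_fiber]; dually for
    epimorphisms. *)
Lemma heart_abelian : abelian Ht.
Proof.
split.
- split.
    have [O O0] := zero_object C.
    have HO : in_heart O by split; [case: le_ext|case: ge_ext] => h _; exact: h.
    exists (exist _ O HO) => Y; split=> f; first exact: (zero_from f O0).
    exact: (zero_to f O0).
  move=> X Y; have [_ /(_ (sval X) (sval Y))[P [i1 [i2 [p1 [p2 e]]]]]] := tri_additive ax.
  have T := dist_biproduct e.
  have HP : in_heart P.
    split; [case: le_ext => _|case: ge_ext => _]; apply; try exact: T.
    - exact: (proj1 (svalP X)).
    - exact: (proj1 (svalP Y)).
    - exact: (proj2 (svalP X)).
    - exact: (proj2 (svalP Y)).
  by exists (exist _ P HP), i1, i2, p1, p2.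
- move=> X Y f; have [F [i [w T]]] := fiber (f : Hom (sval X) (sval Y)).
  have [A [B [u [v [z [T' HA HB gF lF]]]]]] := heart_decomp (svalP X) (svalP Y) T.
  exists (exist _ A HA), (i ∘ u); split=> [|W g fg]; first by rewrite /= compA (tri_vu T) comp0l.
  have [h hE] := decomposed_kernel T T' HB (proj1 (svalP W)) fg.
  exists h; split=> // h' h'E; apply/eqP; rewrite -subr_eq0; apply/eqP.
  apply: (decomposed_kernel_inj (svalP Y) T T' HB (proj1 (svalP W))).
  by rewrite compBr hE (h'E : i ∘ u ∘ (h' : Hom (sval W) A) = g) subrr.
- move=> X Y f; have [F [i [w T]]] := fiber (f : Hom (sval X) (sval Y)).
  have [A [B [u [v [z [T' HA HB gF lF]]]]]] := heart_decomp (svalP X) (svalP Y) T.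
  exists (exist _ (sh B) HB), (fmap sh v ∘ w); split=> [|W g fg].
    by rewrite /= -compA (tri_wv T) comp0r.
  have [h hE] := decomposed_cokernel T T' HA (proj2 (svalP W)) fg.
  exists h; split=> // h' h'E; apply/eqP; rewrite -subr_eq0; apply/eqP.
  apply: (decomposed_cokernel_inj (svalP X) T T' HA (proj2 (svalP W))).
  by rewrite compBl hE (h'E : (h' : Hom (sh B) (sval W)) ∘ (fmap sh v ∘ w) = g) subrr.
- move=> X Y f mf; have [F [i [w T]]] := fiber (f : Hom (sval X) (sval Y)).
  exists (exist _ (sh F) (heart_mono_fiber mf T)), w; split=> [|W g wg].
    exact: tri_wv T.
  have [h hE] := tri_lift2 T wg.
  by exists h; split=> // h' h'E; apply: (mf); exact: etrans hE (esym h'E).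
- move=> X Y f ef; have [F [i [w T]]] := fiber (f : Hom (sval X) (sval Y)).
  exists (exist _ F (heart_epi_fiber ef T)), i; split=> [|W g wg].
    exact: tri_vu T.
  have [h hE] := tri_desc T wg.
  by exists h; split=> // h' h'E; apply: (ef); exact: etrans hE (esym h'E).
Qed.

End Heart.

(** * Abelian categories with a finite generating family *)

Section Abelian.
Variable A : preadditive.
Hypothesis abA : abelian A.

Lemma mono_kernel_coker (X Y K : A) (f : Hom X Y) (c : Hom Y K) :
  mono f -> is_cokernel f c -> is_kernel c f.
Proof.
move=> mf cf; case: abA => _ _ _ /(_ _ _ _ mf)[Z [g gf]] _.
split=> [|W h ch]; first by case: cf.
have [g' g'E] := cokernel_desc cf (proj1 gf).
have [|h' h'E] := kernel_lift (g := h) gf; first by rewrite -g'E -compA ch comp0r.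
by exists h'; split=> // h2 h2E; apply: (mf); rewrite h'E h2E.
Qed.

Lemma epi_coker_kernel (X Y K : A) (f : Hom X Y) (k : Hom K X) :
  epi f -> is_kernel f k -> is_cokernel k f.
Proof.
move=> ef kf; case: abA => _ _ _ _ /(_ _ _ _ ef)[Z [g gf]].
split=> [|W h ch]; first by case: kf.
have [g' g'E] := kernel_lift kf (proj1 gf).
have [|h' h'E] := cokernel_desc (g := h) gf; first by rewrite -g'E compA ch comp0l.
by exists h'; split=> // h2 h2E; apply: (ef); rewrite h'E h2E.
Qed.

Lemma abelian_kernel (X Y : A) (f : Hom X Y) : exists K (k : Hom K X), is_kernel f k.
Proof. by case: abA. Qed.

Lemma abelian_cokernel (X Y : A) (f : Hom X Y) : exists K (k : Hom Y K), is_cokernel f k.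
Proof. by case: abA. Qed.

(** The image is the kernel of the cokernel. If [g] kills [e], then [f] factors through the
    subobject [m ∘ k]; the cokernel of [m ∘ k] kills [f], so it factors through [c] and kills [m].
    Hence [k] is split epic and [g] is zero. *)
Lemma abelian_image (X Y : A) (f : Hom X Y) :
  exists I (e : Hom X I) (m : Hom I Y), [/\ epi e, mono m & m ∘ e = f].
Proof.
have [K [c cP]] := abelian_cokernel f.
have [I [m mP]] := abelian_kernel c.
have mm := is_kernel_mono mP.
have [e eE] := kernel_lift mP (proj1 cP).
exists I, e, m; split=> //; apply/epiP => W g ge.
have [L [k kP]] := abelian_kernel g.
have [e' e'E] := kernel_lift kP ge.
have km : mono (m ∘ k).
  move=> V h1 h2; rewrite -!compA => /mm; exact: (is_kernel_mono kP).
have [M [d dP]] := abelian_cokernel (m ∘ k).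
have [|d' d'E] := cokernel_desc (g := d) cP.
  by rewrite -eE -e'E (compA m) (compA d) (proj1 dP) comp0l.
have [|s sE] := kernel_lift (g := m) (mono_kernel_coker km dP).
  by rewrite -d'E -compA (proj1 mP) comp0r.
have ks : k ∘ s = idm I by apply: mm; rewrite comp1r compA.
by rewrite -[g]comp1r -ks compA (proj1 kP) comp0l.
Qed.

(** Lifting along an epimorphism after an epic base change takes the place of choosing preimages of
    elements. *)
Lemma pullback_epi (Y Z W : A) (p : Hom Y Z) (z : Hom W Z) : epi p ->
  exists P (p' : Hom P W) (a : Hom P Y), epi p' /\ z ∘ p' = p ∘ a.
Proof.
move=> ep; case: (abA) => -[_ /(_ Y W)[S [i1 [i2 [p1 [p2 [e11 e22 e12 e21 e]]]]]]] _ _ _ _.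
pose q := p ∘ p1 - z ∘ p2.
have q1 : q ∘ i1 = p by rewrite compBl -!compA e11 e21 comp1r comp0r subr0.
have eq : epi q.
  by apply/epiP => V h hq; apply: ((epiP p).1 ep); rewrite -q1 compA hq comp0l.
have [P [k kP]] := abelian_kernel q.
exists P, (p2 ∘ k), (p1 ∘ k); split; last first.
  by move/eqP: (proj1 kP); rewrite compBl subr_eq0 -!compA => /eqP ->.
apply/epiP => V g; rewrite compA => gk.
have [h hE] := cokernel_desc (epi_coker_kernel eq kP) gk.
have h0 : h = 0.
  by apply: ((epiP p).1 ep); rewrite -q1 compA hE -compA e21 comp0r.
by rewrite -[g]comp1r -e22 compA -hE h0 comp0l comp0l.
Qed.

End Abelian.

(** * Finite covers and exactness of filtered colimits *)

Section FiniteGenerators.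
Variable A : preadditive.
Hypothesis abA : abelian A.
Hypothesis A_coproducts : has_coproducts A.
Variables (T : small) (B : T -> A).
Hypothesis B_gen : forall (X Y : A) (f : Hom X Y), f <> 0 ->
  exists t (g : Hom (B t) X), f ∘ g <> 0.
Hypothesis B_lift : forall (Y Z : A) (p : Hom Y Z) t (z : Hom (B t) Z), epi p ->
  exists t' (r : Hom (B t') (B t)) y, epi r /\ p ∘ y = z ∘ r.
Hypothesis B_fin : forall t, finfac (B t).

Lemma farr_comp (J : category) (G : functor J A) (i j k : J) (g : Mor j k) (f : Mor i j) :
  farr G (ccomp g f) = farr G g ∘ farr G f.
Proof. exact: farrM. Qed.

Section FilteredColimit.
Variables (J : small_category) (G : functor J A) (L : A)
  (c : forall j : J, Hom (G j) L).
Hypothesis Jf : filtered J.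
Hypothesis cP : is_colimit c.

Lemma colimit_eq0 (Y : A) (g : Hom L Y) : (forall j, g ∘ c j = 0) -> g = 0.
Proof.
move=> g0; have [|h [_ hu]] := cP.2 Y (fun=> 0); first by move=> j k u; rewrite comp0l.
by rewrite -(hu g) // -(hu 0) // => j; rewrite comp0l.
Qed.

(** The colimit is a quotient of the coproduct of the [G j]; after a cover, [x] lifts to a finite
    sum, whose stages have a common bound. *)
Lemma filtered_colimit_factor t (x : Hom (B t) L) :
  exists t' (r : Hom (B t') (B t)) j (y : Hom (B t') (G j)),
    epi r /\ x ∘ r = c j ∘ y.
Proof.
have [S [inj injP]] := A_coproducts (fun j : sOb J => G j).
have [s sE] := coproduct_desc injP c.
have es : epi s.
  apply/epiP => W g gs; apply: colimit_eq0 => j.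
  by rewrite -sE compA gs comp0l.
have [t' [r [y [er yE]]]] := B_lift x es.
suff [j [y' y'E]] : exists j (y' : Hom (B t') (G j)), s ∘ y = c j ∘ y'.
  by exists t', r, j, y'; rewrite -y'E yE.
case: Jf => -[j0] bound _.
elim: (B_fin injP y) => [|i g z _ [j [y' IH]]]; first by exists j0, 0; rewrite !comp0r.
have [l [[u] [v]]] := bound i j.
exists l, (farr G u ∘ g + farr G v ∘ y').
by rewrite !compDr IH !compA sE !cP.1.
Qed.

(* Partial cocones over the diagram J: an apex and arrows to it from some of
   the objects. *)
Let pcocone := {l : J & forall j : J, option (Mor j l)}.
Let refines (p p' : pcocone) := exists m : Mor (projT1 p) (projT1 p'),
  forall j f, projT2 p j = Some f -> projT2 p' j = Some (ccomp m f).
Let leg (p : pcocone) (j : J) : Hom (G j) (G (projT1 p)) :=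
  if projT2 p j is Some f then farr G f else 0.

Let refines_trans p q r : refines p q -> refines q r -> refines p r.
Proof.
move=> [m mP] [n nP]; exists (ccomp n m) => j f /mP/nP ->.
by rewrite ccompA.
Qed.

Let refines_map (p : pcocone) l (m : Mor (projT1 p) l) :
  refines p (existT _ l (fun j => omap (fun f => ccomp m f) (projT2 p j))).
Proof. by exists m => j f /= ->. Qed.

Let refine_at p j : exists q, refines p q /\ exists f, projT2 q j = Some f.
Proof.
case: Jf => _ bound _; have [l [[m] [n]]] := bound (projT1 p) j.
case e : (projT2 p j) => [f|].
  by exists p; split; [exists (cid _) => k g ->; rewrite ccomp1l | exists f].
exists (existT _ l (fun k => if pselect (k = j) is left kj
    then Some (eq_rect_r (fun k => Mor k l) n kj)
    else omap (fun f => ccomp m f) (projT2 p k))); split.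
  exists m => k f /=; case: pselect => [kj|_ ->] //.
  by subst k; rewrite e.
by exists n => /=; case: pselect => // jj; rewrite (Prop_irrelevance jj erefl).
Qed.

Let refine_arrow p (j k : J) (u : Mor j k) : exists q, refines p q /\
  exists g, projT2 q j = Some (ccomp g u) /\ projT2 q k = Some g.
Proof.
have [q1 [pq1 [f1 f1E]]] := refine_at p j.
have [q2 [[m mP] [g gE]]] := refine_at q1 k.
have f2E := mP _ _ f1E.
case: Jf => _ _ coeq; have [l [n nE]] := coeq _ _ (ccomp m f1) (ccomp g u).
exists (existT _ l (fun j => omap (fun f => ccomp n f) (projT2 q2 j))); split.
  have q12 : refines q1 q2 by exists m.
  exact: refines_trans pq1 (refines_trans q12 (refines_map n)).
exists (ccomp n g); split; last first.
  by change (omap (fun f => ccomp n f) (projT2 q2 k) = Some (ccomp n g)); rewrite gE.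
rewrite -ccompA -nE.
change (omap (fun f => ccomp n f) (projT2 q2 j) = Some (ccomp n (ccomp m f1))).
by rewrite f2E.
Qed.

(** The colimit is the cokernel of [th], so after a cover [inj j ∘ v] becomes [th ∘ y] with [y]
    finite. Only finitely many arrows of [J] occur in [y]; a partial cocone commuting with them
    kills [th ∘ y], and its leg at [j] is the required map. *)
Lemma filtered_colimit_zero t j (v : Hom (B t) (G j)) : c j ∘ v = 0 ->
  exists t' (r : Hom (B t') (B t)) k (u : Mor j k),
    epi r /\ farr G u ∘ v ∘ r = 0.
Proof.
move=> cv.
have [S [inj injP]] := A_coproducts (fun j : sOb J => G j).
have [s sE] := coproduct_desc injP c.
have [R [injR injRP]] := A_coproducts
  (fun x : {j : sOb J & {k : sOb J & sMor j k}} => G (projT1 x)).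
have [th thE] := coproduct_desc injRP
  (fun x => inj (projT1 x) - inj (projT1 (projT2 x)) ∘ farr G (projT2 (projT2 x))).
have [I [e [m [ee mm meE]]]] := abelian_image abA th.
have sth : s ∘ th = 0.
  apply: (coproduct_eq0 injRP) => -[i [k u]].
  by rewrite -compA thE compBr compA !sE cP.1 subrr.
have sm : is_cokernel m s.
  split=> [|W g gm].
    by apply: ((epiP e).1 ee); rewrite -compA meE.
  have gth : g ∘ th = 0 by rewrite -meE compA gm comp0l.
  have [|h [hP hu]] := cP.2 W (fun i => g ∘ inj i).
    move=> i k u; have := congr1 (fun h => h ∘ injR (existT _ i (existT _ k u))) gth.
    rewrite -compA thE comp0l compBr compA => /eqP; rewrite subr_eq0 => /eqP e'.
    by rewrite -e'.
  exists h; split; last by move=> h' h'E; apply: hu => i; rewrite -sE compA h'E.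
  by apply: (coproduct_ext injP) => i; rewrite -compA sE hP.
have [|h hE] := kernel_lift (g := inj j ∘ v) (mono_kernel_coker abA mm sm).
  by rewrite compA sE.
have [t' [r [y [er yE]]]] := B_lift h ee.
have thy : th ∘ y = inj j ∘ v ∘ r by rewrite -meE -compA yE compA hE.
(* Quantifying over all refinements [q'] carries the induction: the cocone found so far is refined
   to accommodate one more arrow. *)
have claim p : exists q, refines p q /\ forall q', refines q q' ->
    forall g : Hom S (G (projT1 q')), (forall i, g ∘ inj i = leg q' i) -> g ∘ (th ∘ y) = 0.
  elim: (B_fin injRP y) => [|[i [k u]] g z _ [q [pq IH]]].
    exists p; split; last by move=> q' _ g _; rewrite !comp0r.
    by exists (cid _) => k f ->; rewrite ccomp1l.
  have [q1 [qq1 [f [f1E f2E]]]] := refine_arrow q u.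
  exists q1; split; first exact: refines_trans pq qq1.
  move=> q' q1q' g' g'P; rewrite !compDr (IH q') //; last exact: refines_trans qq1 _.
  rewrite addr0 [th ∘ _]compA thE /= !compA compBr compA !g'P /leg.
  case: q1q' => n nP; rewrite (nP _ _ f1E) (nP _ _ f2E) ccompA farr_comp.
  by rewrite subrr comp0l.
(* Starting with the identity leg at [j] makes the final leg at [j] equal to the refining map. *)
pose p0 : pcocone := existT _ j (fun k => if pselect (k = j) is left kj
    then Some (eq_rect_r (fun k => Mor k j) (cid j) kj) else None).
have p0j : projT2 p0 j = Some (cid j).
  by rewrite /p0 /=; case: pselect => // jj; rewrite (Prop_irrelevance jj erefl).
have [q [[n nP] qP]] := claim p0.
have [g gE] := coproduct_desc injP (leg q).
have qq : refines q q by exists (cid _) => k f ->; rewrite ccomp1l.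
exists t', r, (projT1 q), n; split=> //.
have := qP q qq g gE; rewrite thy !compA gE /leg.
by rewrite (nP _ _ p0j) ccomp1r.
Qed.

End FilteredColimit.

(** Right exactness is formal. If [f ∘ x = 0] with [x] nonzero, [x] is nonzero on some [B t]; a
    cover represents it at one stage of [F], its image in [G] dies at a later stage, and [a k] is
    mono there. *)
Lemma filtered_exact : filtered_colimits_exact A.
Proof.
move=> J F G H a b LF LG LH cF cG cH f g Jf aN bN ab cFP cGP cHP fE gE.
have fg : is_cokernel f g.
  split.
    apply: (colimit_eq0 cFP) => j; rewrite -compA fE compA gE -compA.
    by have [[-> _] _] := ab j; rewrite comp0r.
  move=> W h hf.
  have hj j : exists d, d ∘ b j = h ∘ cG j.
    apply: (cokernel_desc (proj2 (ab j))).
    by rewrite -compA -fE compA hf comp0l.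
  have bepi j : epi (b j) by exact: is_cokernel_epi (proj2 (ab j)).
  pose d j := sval (boolp.cid (hj j)).
  have dE j : d j ∘ b j = h ∘ cG j by exact: svalP (boolp.cid (hj j)).
  have [|l [lP lu]] := cHP.2 W d.
    move=> j k u; apply: (bepi j).
    by rewrite -compA -bN compA !dE -compA cGP.1.
  have eG (h1 h2 : Hom LG W) : (forall j, h1 ∘ cG j = h2 ∘ cG j) -> h1 = h2.
    move=> e; apply/eqP; rewrite -subr_eq0; apply/eqP/(colimit_eq0 cGP) => j.
    by rewrite compBl e subrr.
  exists l; split=> [|l' l'E]; first by apply: eG => j; rewrite -compA gE compA lP dE.
  apply: lu => j; apply: (bepi j).
  by rewrite -compA -gE compA l'E dE.
split=> //; apply: (mono_kernel_coker abA) => //; apply/monoP => W x fx.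
apply: contrapT => /B_gen [t [y xy]]; apply: xy.
have [t' [r [j [z [er zE]]]]] := filtered_colimit_factor Jf cFP (x ∘ y).
have [|t'' [r' [k [u [er' uE]]]]] := @filtered_colimit_zero J G LG cG Jf cGP _ j (a j ∘ z).
  by rewrite compA -fE -compA -zE !compA fx !comp0l.
have ma : mono (a k) by exact: is_kernel_mono (proj1 (ab k)).
have z0 : farr F u ∘ z ∘ r' = 0.
  by apply: ((monoP (a k)).1 ma); rewrite !compA aN -[_ ∘ a j ∘ z]compA.
apply: ((epiP r).1 er); apply: ((epiP r').1 er').
by rewrite zE -(cFP.1 _ _ u) -!compA [farr F u ∘ _]compA z0 comp0r.
Qed.

(** [G] is the coproduct of all [B t] and need not be [finfac]. The second clause is what the
    finiteness of the summands leaves: the endomorphisms [g] with [z ∘ g] finite are jointly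
    epic. *)
Lemma family_generator : exists G : A, generator G /\
  forall (I : small) (F : I -> A) S (inj : forall i, Hom (F i) S), is_coproduct inj ->
  forall X (z : Hom G S) (n : Hom G X),
    (forall g : Hom G G, finspan inj (z ∘ g) -> n ∘ g = 0) -> n = 0.
Proof.
have [G [inc incP]] := A_coproducts B.
have [p [p1 _]] := coproduct_proj incP.
exists G; split=> [X Y f /B_gen[t [g fg]]|I F S inj injP X z n nz].
  exists (g ∘ p t) => fgp; apply: fg.
  by rewrite -[f ∘ g]comp1r -p1 compA -[f ∘ g ∘ p t]compA fgp comp0l.
apply: (coproduct_eq0 incP) => t.
rewrite -[LHS]comp1r -p1 -compA [inc t ∘ _]compA compA nz ?comp0l //.
by rewrite compA; apply: finspan_comp; exact: B_fin.
Qed.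

End FiniteGenerators.

(** * Representability of right exact functors *)

Section ProductFunctor.
Variables (A : preadditive) (I : small) (F : I -> A).

Let V (Y : op A) : zmodType := Pi_zmod (fun i => (Hom (Y : A) (F i) : zmodType)).
Let a (X Y : op A) (f : @Hom (op A) X Y) (x : V X) : V Y :=
  fun i => x i ∘ (f : @Hom A Y X).

Let aD X Y (f : @Hom (op A) X Y) x y : a f (x + y) = a f x + a f y.
Proof. by apply: functional_extensionality_dep => i; exact: compDl. Qed.
Let aDl X Y (f g : @Hom (op A) X Y) x : a (f + g) x = a f x + a g x.
Proof. by apply: functional_extensionality_dep => i; exact: compDr. Qed.
Let a1 X x : a (@idm (op A) X) x = x.
Proof. by apply: functional_extensionality_dep => i; exact: comp1r. Qed.
Let aM X Y Z (g : @Hom (op A) Y Z) (f : @Hom (op A) X Y) x : a (g ∘ f) x = a g (a f x).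
Proof. by apply: functional_extensionality_dep => i; exact: compA. Qed.

Definition prod_functor : additive_functor (op A) Ab := ab_functor aD aDl a1 aM.

Lemma prod_functorE (X Y : A) (f : Hom X Y) (y : prod_functor Y) :
  pull f y = (fun i => y i ∘ f).
Proof. by []. Qed.

Lemma prod_functor_universal (P : A) (pr : prod_functor P) :
  universal pr -> is_product (P := P) pr.
Proof.
move=> U Y f; have [g [gP gu]] := U Y f; exists g; split=> [i|h hP].
  by rewrite -gP.
by apply: gu; apply: functional_extensionality_dep => i; exact: hP.
Qed.

Lemma prod_functor_preserves : preserves_products prod_functor.
Proof.
apply/preserves_products_elt => J D S inj injP x.
have [h hE] := dep_choice (fun i => coproduct_desc injP (fun j => x j i)).
exists h; split=> [j|y yP]; apply: functional_extensionality_dep => i.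
  exact: hE.
by apply: (coproduct_ext injP) => j; rewrite hE -yP.
Qed.

End ProductFunctor.

Section Generated.
Variable A : preadditive.
Hypothesis abA : abelian A.
Hypothesis A_coproducts : has_coproducts A.
Variable G : A.
Hypothesis G_gen : generator G.

Lemma gen_eq0 (X Y : A) (f : Hom X Y) : (forall h : Hom G X, f ∘ h = 0) -> f = 0.
Proof. by move=> f0; apply: contrapT => /G_gen[h]; apply; exact: f0. Qed.

(* The quotient of [X] by the images of all maps [G -> X] satisfying [K]. *)
Lemma kill_maps (X : A) (K : Hom G X -> Prop) :
  exists (D P : A) (c : Hom X D) (k : Hom P X) (inj : {h | K h} -> Hom G P),
  [/\ is_coproduct inj, forall h, k ∘ inj h = sval h, is_cokernel k c &
   forall W (l : Hom W D), (forall V (p : Hom V W) (a : Hom V X), c ∘ a = l ∘ p ->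
     forall h : Hom G V, K (a ∘ h)) -> l = 0].
Proof.
have [P [inj injP]] := A_coproducts (fun _ : {h | K h} => G).
have [k kE] := coproduct_desc injP (fun h => sval h).
have [D [c cP]] := abelian_cokernel abA k.
exists D, P, c, k, inj; split=> // W l lK.
have [V [p [a [ep pa]]]] := pullback_epi abA l (is_cokernel_epi cP).
apply: ((epiP p).1 ep); apply: gen_eq0 => h.
have Kh := lK _ _ _ (esym pa) h.
have e : k ∘ inj (exist _ _ Kh) = a ∘ h := kE _.
by rewrite pa -compA -e compA (proj1 cP) comp0l.
Qed.

(* X0 is the coproduct of copies of G indexed by H(G); dividing out all maps
   from G that kill the tautological element leaves a universal one. *)
Lemma right_exact_representable (H : additive_functor (op A) Ab) :
  preserves_products H ->
  (forall (X Y : A) (c : Hom X Y) (y : H Y), epi c -> pull c y = 0 -> y = 0) ->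
  (forall (X Y K : A) (f : Hom X Y) (c : Hom Y K) (y : H Y), is_cokernel f c ->
    pull f y = 0 -> exists z : H K, pull c z = y) ->
  exists (X : A) (x : H X), universal x.
Proof.
move=> /preserves_products_elt Hprod Hepi Hex.
have [X0 [inj injP]] := A_coproducts (fun _ : (H G : zmodType) => G).
have [x0 [x0E _]] := Hprod _ _ _ _ injP (fun y => y).
have [D [P [c [k [injK [injKP kE cP lK]]]]]] := kill_maps (fun h => pull h x0 = 0).
have ec := is_cokernel_epi cP.
have [|x xE] := Hex _ _ _ _ _ x0 cP.
  have [z [_ zu]] := Hprod _ _ _ _ injKP (fun=> 0).
  have <- : z = pull k x0 by apply: zu => -[h h0]; rewrite -pullM kE.
  by apply: zu => h; rewrite pull0.
exists D, x.
have key W (l : Hom W D) : pull l x = 0 -> l = 0.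
  move=> lx; apply: lK => V p a ca h.
  by rewrite pullM -xE -(pullM c a) ca pullM lx !pull0.
move=> Y y.
suff [g gE] : exists g : Hom Y D, pull g x = y.
  exists g; split=> // g' g'E; apply/eqP; rewrite -subr_eq0; apply/eqP/key.
  by rewrite pullBl gE g'E subrr.
(* [Y] is a quotient of copies of [G], and [m] sends the copy at [g] to the copy in [X0] indexed by
   the pullback of [y] along [g]; by [key], [c ∘ m] descends along [e]. *)
have [Y0 [injY injYP]] := A_coproducts (fun _ : (Hom G Y : zmodType) => G).
have [e eE] := coproduct_desc injYP (fun g => g).
have ee : epi e.
  by apply/epiP => W f fe; apply: gen_eq0 => h; rewrite -(eE h) compA fe comp0l.
have [m mE] := coproduct_desc injYP (fun g => inj (pull g y)).
have mx : pull m x0 = pull e y.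
  have [z [_ zu]] := Hprod _ _ _ _ injYP (fun g => pull g y).
  have <- : z = pull m x0 by apply: zu => g; rewrite -pullM mE x0E.
  by apply: zu => g; rewrite -pullM eE.
have [N [n nP]] := abelian_kernel abA e.
have [|g gE] := cokernel_desc (g := c ∘ m) (epi_coker_kernel abA ee nP).
  apply: key; rewrite !pullM xE mx -pullM (proj1 nP); exact: pull0l.
exists g; apply/eqP; rewrite -subr_eq0; apply/eqP/(Hepi _ _ e _ ee).
by rewrite pullB -!pullM gE pullM xE mx subrr.
Qed.

Lemma generated_products : has_products A.
Proof.
move=> I F.
have [|X Y c y ec cy|X Y K f c y cP fy|P [pr prU]] :=
    right_exact_representable (H := prod_functor F).
- exact: prod_functor_preserves.
- apply: functional_extensionality_dep => i; apply: ((epiP c).1 ec).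
  exact: (congr1 (fun h => h i) cy).
- have [|h hE] := @dep_choice _ _ (fun i z => z ∘ c = y i).
    by move=> i; apply: (cokernel_desc cP); exact: (congr1 (fun h => h i) fy).
  by exists h; apply: functional_extensionality_dep => i; exact: hE.
by exists P, pr; exact: prod_functor_universal.
Qed.

End Generated.

(** * Injective cogenerators *)

(* Right modules over the ring End(G); [cofree L] is the injective module
   Hom(End(G), Q/Z)^L. *)
Section CofreeModules.
Variables (A : preadditive) (G : A) (L : small).
Notation R := (Hom G G).

Definition cofree : zmodType := Pi_zmod (fun _ : L => (AbHom R QmodZ : zmodType)).

Fact ract_subproof (r : R) (i : cofree) (l : L) (s t : R) :
  (i l : AbHom _ _) (r ∘ (s + t)) = (i l : AbHom _ _) (r ∘ s) + (i l : AbHom _ _) (r ∘ t).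
Proof. by rewrite compDr raddfD. Qed.

Definition ract (r : R) (i : cofree) : cofree := fun l => additive_of (ract_subproof r i l).

Lemma cofree_ext (i j : cofree) :
  (forall l s, (i l : AbHom _ _) s = (j l : AbHom _ _) s) -> i = j.
Proof.
by move=> e; apply: functional_extensionality_dep => l; apply: AbHom_eq => s; exact: e.
Qed.

Lemma ractD r i j : ract r (i + j) = ract r i + ract r j.
Proof. by apply: cofree_ext. Qed.

Lemma ract0 r : ract r 0 = 0.
Proof. by apply: cofree_ext. Qed.

Lemma ractB r i j : ract r (i - j) = ract r i - ract r j.
Proof. by apply: cofree_ext. Qed.

Lemma ractBl r s i : ract (r - s) i = ract r i - ract s i.
Proof. by apply: cofree_ext => l t /=; rewrite compBl raddfB. Qed.

Lemma ract0l i : ract 0 i = 0.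
Proof. by apply: cofree_ext => l t /=; rewrite comp0l raddf0. Qed.

Lemma ractM r s i : ract (r ∘ s) i = ract s (ract r i).
Proof. by apply: cofree_ext => l t /=; rewrite compA. Qed.

Lemma ract1 i : ract (idm G) i = i.
Proof. by apply: cofree_ext => l t /=; rewrite comp1l. Qed.

(** A module map to a cofree module amounts to a family of characters, through its values at
    [idm G]; so the extension is made by [QmodZ_extend] for each [l] separately. *)
Lemma cofree_extend (M : zmodType) (act : R -> M -> M) (Gr : M -> cofree -> Prop) :
  (forall r m n, act r (m + n) = act r m + act r n) ->
  (forall r s m, act (r + s) m = act r m + act s m) ->
  (forall r s m, act (r ∘ s) m = act s (act r m)) ->
  Gr 0 0 -> (forall m m' y y', Gr m y -> Gr m' y' -> Gr (m - m') (y - y')) ->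
  (forall r m y, Gr m y -> Gr (act r m) (ract r y)) ->
  (forall y, Gr 0 y -> y = 0) ->
  exists g : {additive M -> cofree},
    (forall r m, g (act r m) = ract r (g m)) /\ forall m y, Gr m y -> g m = y.
Proof.
move=> actD actDl actM Gr0 GrB Grr Gru.
have [|f fP] := @dep_choice L (fun=> {additive M -> QmodZ})
    (fun l f => forall m y, Gr m y -> f m = (y l : AbHom _ _) (idm G)).
  move=> l; have [|||f fP] := @QmodZ_extend M
      (fun m q => exists y, Gr m y /\ q = (y l : AbHom _ _) (idm G)).
  - by exists 0.
  - by move=> m m' _ _ [y [Gy ->]] [y' [Gy' ->]]; exists (y - y'); split=> //; exact: GrB.
  - by move=> _ [y [/Gru -> ->]].
  by exists f => m y Gy; apply: fP; exists y.
have gD m l (s t : R) : f l (act (s + t) m) = f l (act s m) + f l (act t m).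
  by rewrite actDl raddfD.
pose g m : cofree := fun l => additive_of (gD m l).
have gadd m n : g (m + n) = g m + g n.
  by apply: cofree_ext => l s /=; rewrite actD raddfD.
exists (additive_of gadd); split=> [r m|m y Gy].
  by apply: cofree_ext => l s /=; rewrite actM.
apply: cofree_ext => l s /=; rewrite (fP _ _ _ (Grr s _ _ Gy)) /=.
by rewrite comp1r.
Qed.

(* An injective hull of N inside the cofree module, presented by an
   idempotent: K is maximal with K /\ N = 0, J is maximal above N with
   J /\ K = 0, and e extends the projection of J + K onto J.  Maximality
   forces im e = J. *)
Lemma injective_hull (N : cofree -> Prop) : submod ract N ->
  exists e : {additive cofree -> cofree}, [/\ forall r i, e (ract r i) = ract r (e i),
    forall i, e (e i) = e i, forall i, N i -> e i = i &
    forall i, e i = i -> i <> 0 -> exists r, N (ract r i) /\ ract r i <> 0].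
Proof.
move=> Nsub.
have zsub : submod ract (fun i => i = 0).
  by split=> [|r x ->]; [split=> // x y -> ->; rewrite subrr | exact: ract0].
have [|K [Ksub _ NK Kmax]] := @maximal_complement _ _ ract N _ zsub; first by [].
have [|J [Jsub NJ KJ Jmax]] := @maximal_complement _ _ ract K _ Nsub.
  by move=> x Kx Nx; exact: NK.
have [Ks Kr] := Ksub; have [Js Jr] := Jsub; have [Ns Nr] := Nsub.
have [|||||||e [er eP]] := @cofree_extend cofree ract (fun m y => J y /\ K (m - y)).
- by move=> *; rewrite ractD.
- by move=> r s m; apply: cofree_ext => l t /=; rewrite compDl raddfD.
- by move=> *; rewrite ractM.
- by split; [exact: subgroup0 | rewrite subrr; exact: subgroup0].
- move=> m m' y y' [Jy Ky] [Jy' Ky']; split; first exact: subgroupB.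
  by rewrite opprD addrACA -opprD; exact: subgroupB.
- move=> r m y [Jy Ky]; split; first exact: Jr.
  by rewrite -ractB; exact: Kr.
- by move=> y [Jy]; rewrite sub0r => /(subgroupN Ks); rewrite opprK => Ky; exact: KJ.
have eJ i : J i -> e i = i.
  by move=> Ji; apply: eP; rewrite subrr; split=> //; exact: subgroup0.
have eK i : K i -> e i = 0.
  by move=> Ki; apply: eP; rewrite subr0; split=> //; exact: subgroup0.
(* The preimage of [K] under [e] contains [K] and still meets [N] trivially, so it equals [K] by
   maximality. *)
have kere i : K (e i) -> e i = 0.
  move=> Kei; apply: (eK); apply: (Kmax (fun m => K (e m))) => //.
  - split=> [|r x Kx]; last by rewrite er; exact: Kr.
    by split=> [|x y Kx Ky]; rewrite ?raddf0 ?raddfB; [exact: subgroup0|exact: subgroupB].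
  - by move=> x Kx; rewrite eK //; exact: subgroup0.
  - by move=> x Nx; rewrite eJ; [move=> Kx; exact: NK | exact: NJ].
have Je i : J (e i).
  apply: (Jmax (fun y => exists m, y = e m)); last by exists i.
  - split=> [|r _ [x ->]]; last by exists (ract r x); rewrite er.
    split=> [|_ _ [x ->] [y ->]]; first by exists 0; rewrite raddf0.
    by exists (x - y); rewrite raddfB.
  - by move=> x Jx; exists x; rewrite eJ.
  - by move=> x Kx [m xE]; rewrite xE in Kx *; exact: kere.
exists e; split=> //.
- by move=> i; rewrite eJ.
- by move=> i Ni; apply: eJ; exact: NJ.
move=> i ei i0; apply: contrapT => none.
have Ji : J i by rewrite -ei.
apply: i0; apply: (KJ) => //.
(* If no multiple of [i] were a nonzero element of [N], the submodule spanned by [K] and [i] would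
   meet [N] trivially; so [i] would lie in [K] as well as in [J]. *)
apply: (Kmax (fun y => exists k r, K k /\ y = k + ract r i)).
- split=> [|s _ [k [r [Kk ->]]]]; last first.
    by exists (ract s k), (r ∘ s); rewrite ractD ractM; split=> //; exact: Kr.
  split=> [|_ _ [k [r [Kk ->]]] [k' [r' [Kk' ->]]]].
    by exists 0, 0; rewrite ract0l addr0; split=> //; exact: subgroup0.
  exists (k - k'), (r - r'); rewrite ractBl opprD addrACA; split=> //.
  exact: subgroupB.
- by move=> x Kx; exists x, 0; rewrite ract0l addr0.
- move=> x Nx [k [r [Kk xE]]].
  have k0 : k = 0.
    apply: (KJ) => //; have -> : k = x - ract r i by rewrite xE addrK.
    by apply: subgroupB => //; [exact: NJ | exact: Jr].
  rewrite k0 add0r in xE; apply: contrapT => x0; apply: none; exists r.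
  by rewrite -xE.
- by exists 0, (idm G); rewrite ract1 add0r; split=> //; exact: subgroup0.
Qed.

End CofreeModules.

Section InjectiveCogenerator.
Variable A : preadditive.
Hypothesis abA : abelian A.
Hypothesis A_coproducts : has_coproducts A.
Variable G : A.
Hypothesis G_gen : generator G.
Hypothesis G_fin : forall (I : small) (F : I -> A) S (inj : forall i, Hom (F i) S),
  is_coproduct inj -> forall X (z : Hom G S) (n : Hom G X),
    (forall g : Hom G G, finspan inj (z ∘ g) -> n ∘ g = 0) -> n = 0.

Section Hull.
Variable X : A.

Let L : small := AbHom (Hom G X) QmodZ.
Let M : zmodType := cofree G L.

Let nu_D (x : Hom G X) (l : L) (s t : Hom G G) :
  (l : AbHom _ _) (x ∘ (s + t)) = (l : AbHom _ _) (x ∘ s) + (l : AbHom _ _) (x ∘ t).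
Proof. by rewrite compDr raddfD. Qed.

(** The embedding of the module [Hom G X] into the cofree module on its own characters; it is
    injective because characters separate points. *)
Let nu (x : Hom G X) : M := fun l => additive_of (nu_D x l).

Let nuD x y : nu (x + y) = nu x + nu y.
Proof. by apply: cofree_ext => l s /=; rewrite compDl raddfD. Qed.

Let nuM x r : nu (x ∘ r) = ract r (nu x).
Proof. by apply: cofree_ext => l s /=; rewrite compA. Qed.

Let nu_inj x : nu x = 0 -> x = 0.
Proof.
move=> nx; apply: QmodZ_cogen => f.
have := congr1 (fun i : M => (i (f : L) : AbHom _ _) (idm G)) nx.
by rewrite /= comp1r.
Qed.

Variable e : {additive M -> M}.
Hypothesis eR : forall r i, e (ract r i) = ract r (e i).
Hypothesis ee : forall i, e (e i) = e i.
Hypothesis enu : forall x, e (nu x) = nu x.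
Hypothesis ess : forall i, e i = i -> i <> 0 ->
  exists r x, ract r i = nu x /\ x <> 0.

(* Phi Y is the group of module maps from Hom(G, Y) to the image of e. *)
Let Phi_pred (Y : A) (p : AbHom (Hom G Y) M) : Prop :=
  (forall r y, p (y ∘ r) = ract r (p y)) /\ forall y, e (p y) = p y.

Let Phi_sub Y : subgroup (@Phi_pred Y).
Proof.
split; first by split=> *; rewrite /= ?ract0 ?raddf0.
move=> p q [pR pe] [qR qe]; split=> [r y|y] /=; first by rewrite pR qR ractB.
by rewrite raddfB pe qe.
Qed.

Let Phi0 (Y : op A) : zmodType := sub_zmod (Phi_sub Y).

Let Phi_arr_D (Y Z : A) (f : Hom Z Y) (p : AbHom (Hom G Y) M) (x y : Hom G Z) :
  p (f ∘ (x + y)) = p (f ∘ x) + p (f ∘ y).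
Proof. by rewrite compDr raddfD. Qed.

Let Phi_arr_pred (Y Z : A) (f : Hom Z Y) (p : Phi0 Y) :
  Phi_pred (additive_of (Phi_arr_D f (sval p))).
Proof.
case: p => p [pR pe] /=; split=> [r y|y] /=; last exact: pe.
by rewrite compA pR.
Qed.

Let Phi_arr (Y Z : op A) (f : @Hom (op A) Y Z) (p : Phi0 Y) : Phi0 Z :=
  exist _ _ (Phi_arr_pred (f : @Hom A Z Y) p).

Let Phi_D Y Z (f : @Hom (op A) Y Z) p q : Phi_arr f (p + q) = Phi_arr f p + Phi_arr f q.
Proof. by apply: sub_zmod_eq; apply: AbHom_eq. Qed.
Let Phi_Dl Y Z (f g : @Hom (op A) Y Z) p : Phi_arr (f + g) p = Phi_arr f p + Phi_arr g p.
Proof. by apply: sub_zmod_eq; apply: AbHom_eq => y /=; rewrite compDl raddfD. Qed.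
Let Phi_1 Y p : Phi_arr (@idm (op A) Y) p = p.
Proof. by apply: sub_zmod_eq; apply: AbHom_eq => y /=; rewrite comp1l. Qed.
Let Phi_M Y Z W (g : @Hom (op A) Z W) (f : @Hom (op A) Y Z) p :
  Phi_arr (g ∘ f) p = Phi_arr g (Phi_arr f p).
Proof. by apply: sub_zmod_eq; apply: AbHom_eq => y /=; rewrite compA. Qed.

Let Phi : additive_functor (op A) Ab := ab_functor Phi_D Phi_Dl Phi_1 Phi_M.

Let ev (Y : A) (p : Phi Y) (y : Hom G Y) : M := sval (p : Phi0 Y) y.

Let ev_pull (Y Z : A) (f : Hom Z Y) (p : Phi Y) y : ev (pull f p) y = ev p (f ∘ y).
Proof. by []. Qed.

Let ev_ext (Y : A) (p q : Phi Y) : (forall y, ev p y = ev q y) -> p = q.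
Proof. by move=> pq; apply: sub_zmod_eq; apply: AbHom_eq. Qed.

Let evR (Y : A) (p : Phi Y) r y : ev p (y ∘ r) = ract r (ev p y).
Proof. by case: p => p [pR pe]; exact: pR. Qed.

Let eve (Y : A) (p : Phi Y) y : e (ev p y) = ev p y.
Proof. by case: p => p [pR pe]; exact: pe. Qed.

Let evB (Y : A) (p : Phi Y) y z : ev p (y - z) = ev p y - ev p z.
Proof. exact: raddfB. Qed.

Let evD (Y : A) (p : Phi Y) y z : ev p (y + z) = ev p y + ev p z.
Proof. exact: raddfD. Qed.

Let ev0 (Y : A) (p : Phi Y) : ev p 0 = 0.
Proof. exact: raddf0. Qed.

(* By essentiality a nonzero p in Phi Y takes a nonzero value nu x. *)
Let Phi_eq0 (Y : A) (p : Phi Y) :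
  (forall z x, ev p z = nu x -> x = 0) -> p = 0.
Proof.
move=> h; apply: ev_ext => z; apply: contrapT => pz.
have [r [x [rx x0]]] := ess (eve p z) pz.
by apply: x0; apply: (h (z ∘ r)); rewrite evR.
Qed.

(** A map [z] from [G] need not lift along [c], but it does after an epic base change. So if [p]
    takes the value [nu x] at [z], then [x] vanishes after that base change, hence is zero; by
    [Phi_eq0] such values suffice. *)
Let Phi_epi (Y K : A) (c : Hom Y K) (p : Phi K) : epi c -> pull c p = 0 -> p = 0.
Proof.
move=> ec cp; apply: Phi_eq0 => z x zx.
have [P [p' [a [ep' pa]]]] := pullback_epi abA z ec.
apply: ((epiP p').1 ep'); apply: (gen_eq0 G_gen) => h; apply: nu_inj.
rewrite -compA nuM -zx -evR compA pa -compA -ev_pull cp.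
by [].
Qed.

(** The idempotent [e], applied after the cofree extension, moves all values into the hull and fixes
    the prescribed ones. *)
Let Phi_extend (Y : A) (Gr : Hom G Y -> M -> Prop) :
  Gr 0 0 -> (forall m m' y y', Gr m y -> Gr m' y' -> Gr (m - m') (y - y')) ->
  (forall r m y, Gr m y -> Gr (m ∘ r) (ract r y)) ->
  (forall y, Gr 0 y -> y = 0) -> (forall m y, Gr m y -> e y = y) ->
  exists p : Phi Y, forall m y, Gr m y -> ev p m = y.
Proof.
move=> G0 GB GR Gu Ge.
have [|||g [gR gP]] := @cofree_extend A G L (Hom G Y) (fun r m => m ∘ r) Gr _ _ _ G0 GB GR Gu.
- by move=> *; rewrite compDl.
- by move=> *; rewrite compDr.
- by move=> *; rewrite compA.
have egD x y : e (g (x + y)) = e (g x) + e (g y) by rewrite !raddfD.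
have gPhi : Phi_pred (additive_of egD).
  by split=> [r y|y] /=; rewrite ?gR ?eR ?ee.
exists (exist _ _ gPhi : Phi0 Y) => m y Gmy.
by rewrite /ev /= (gP _ _ Gmy) (Ge _ _ Gmy).
Qed.

(** On maps of the form [c ∘ y] the value is forced to be that of [p] at [y]. It is well defined
    since [p] kills the kernel of [c], and injectivity of the hull extends it to all maps. *)
Let Phi_exact (Z Y K : A) (f : Hom Z Y) (c : Hom Y K) (p : Phi Y) :
  is_cokernel f c -> pull f p = 0 -> exists q : Phi K, pull c q = p.
Proof.
move=> cP fp; have [I [e' [m [ee' mm me]]]] := abelian_image abA f.
have mp : pull m p = 0 by apply: (Phi_epi ee'); rewrite -pullM me.
have cm : is_cokernel m c.
  split=> [|W g gm]; first by apply: ((epiP e').1 ee'); rewrite -compA me (proj1 cP).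
  by apply: (proj2 cP); rewrite -me compA gm comp0l.
have [|||||q qP] := @Phi_extend K (fun z i => exists y, z = c ∘ y /\ i = ev p y).
- by exists 0; rewrite comp0r ev0.
- by move=> _ _ _ _ [y [-> ->]] [y' [-> ->]]; exists (y - y'); rewrite compBr evB.
- by move=> r _ _ [y [-> ->]]; exists (y ∘ r); rewrite compA evR.
- move=> _ [y [/esym cy ->]].
  have [h <-] := kernel_lift (mono_kernel_coker abA mm cm) cy.
  by rewrite -ev_pull mp.
- by move=> _ _ [y [_ ->]]; exact: eve.
by exists q; apply: ev_ext => y; apply: qP; exists y.
Qed.

Let Phi_mono (Z Y : A) (m : Hom Z Y) (p : Phi Z) :
  mono m -> exists q : Phi Y, pull m q = p.
Proof.
move=> /monoP mm.
have [|||||q qP] := @Phi_extend Y (fun z i => exists y, z = m ∘ y /\ i = ev p y).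
- by exists 0; rewrite comp0r ev0.
- by move=> _ _ _ _ [y [-> ->]] [y' [-> ->]]; exists (y - y'); rewrite compBr evB.
- by move=> r _ _ [y [-> ->]]; exists (y ∘ r); rewrite compA evR.
- by move=> _ [y [/esym/mm -> ->]]; exact: ev0.
- by move=> _ _ [y [_ ->]]; exact: eve.
by exists q; apply: ev_ext => y; apply: qP; exists y.
Qed.

(** Uniqueness combines essentiality with [G_fin]. For existence, the finite maps form a submodule
    of [Hom G S] on which the value is a finite sum of the [p i]; it is then extended to all
    maps. *)
Let Phi_products : preserves_products Phi.
Proof.
apply/preserves_products_elt => I F S inj injP p.
have un (q : Phi S) : (forall i, pull (inj i) q = 0) -> q = 0.
  move=> q0; apply: Phi_eq0 => z x zx; apply: (G_fin injP (z := z)) => g.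
  move=> zg; apply: nu_inj; rewrite nuM -zx -evR.
  elim: zg => [|i g' z' _ IH]; first exact: ev0.
  by rewrite evD -ev_pull q0 IH addr0.
have [pr [pr1 pr0]] := coproduct_proj injP.
pose sum r (z : Hom G S) : M := \sum_(i <- (r : seq {classic I})) ev (p i) (pr i ∘ z).
pose Gr (z : Hom G S) (i : M) := finspan inj z /\
  exists r : seq {classic I}, forall r', uniq r' -> {subset r <= r'} -> i = sum r' z.
have sumB r z z' : sum r (z - z') = sum r z - sum r z'.
  by rewrite /sum -sumrB; apply: eq_bigr => i _; rewrite compBr evB.
have [|||||q qP] := @Phi_extend S Gr.
- split; first exact: finspan0.
  by exists [::] => r' _ _; rewrite /sum big1 // => i _; rewrite comp0r ev0.
- move=> m m' y y' [mf [r rP]] [mf' [r' rP']]; split.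
    by apply: subgroupB => //; exact: finspan_subgroup.
  exists (r ++ r') => r2 ur2 rr2; rewrite sumB -rP -?rP' //.
    by move=> x xr; apply: rr2; rewrite mem_cat xr orbT.
  by move=> x xr; apply: rr2; rewrite mem_cat xr.
- move=> r m y [mf [s sP]]; split; first exact: finspan_comp.
  exists s => s' us' ss'; rewrite (sP s') // /sum.
  elim: (s') => [|i l IH]; first by rewrite !big_nil ract0.
  by rewrite !big_cons ractD IH compA evR.
- move=> y [_ [r rP]]; rewrite (rP (undup r)) ?undup_uniq //; last by move=> x; rewrite mem_undup.
  by rewrite /sum big1 // => i _; rewrite comp0r ev0.
- move=> m y [_ [r rP]]; rewrite (rP (undup r)) ?undup_uniq //; last by move=> x; rewrite mem_undup.
  by rewrite /sum raddf_sum; apply: eq_bigr => i _; rewrite eve.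
exists q; split=> [i|q' q'E]; last first.
  apply/eqP; rewrite -subr_eq0; apply/eqP/un => i; rewrite pullB q'E.
  apply/eqP; rewrite subr_eq0; apply/eqP; apply: ev_ext => y.
  rewrite ev_pull; apply: qP; split; first exact: finspan_inj.
  exists [:: (i : {classic I})] => r' ur' ir'.
  rewrite /sum (bigD1_seq (i : {classic I})) ?ir' ?inE //=.
  rewrite compA pr1 comp1l big1 ?addr0 // => j /eqP ji.
  by rewrite compA pr0 ?comp0l ?ev0 // => ij; apply: ji.
apply: ev_ext => y.
rewrite ev_pull; apply: qP; split; first exact: finspan_inj.
exists [:: (i : {classic I})] => r' ur' ir'.
rewrite /sum (bigD1_seq (i : {classic I})) ?ir' ?inE //=.
rewrite compA pr1 comp1l big1 ?addr0 // => j /eqP ji.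
by rewrite compA pr0 ?comp0l ?ev0 // => ij; apply: ji.
Qed.

(** [E] represents [Phi], so its injectivity is the extension property [Phi_mono]. The map from [X]
    corresponds to [nu] and is mono because [nu] is injective. *)
Lemma hull_representable : exists E (i : Hom X E), injective_object E /\ mono i.
Proof.
have [E [x U]] := right_exact_representable abA A_coproducts G_gen Phi_products Phi_epi Phi_exact.
have nuPhi : Phi_pred (additive_of nuD) by split=> *; rewrite /= ?nuM ?enu.
have [i [iE _]] := U X (exist _ _ nuPhi : Phi0 X).
exists E, i; split.
  move=> Z Y m f mm; have [q qE] := Phi_mono (pull f x) mm.
  have [g [gE _]] := U Y q; exists g.
  have [h [_ hu]] := U Z (pull f x).
  by rewrite -(hu f) // -(hu (g ∘ m)) // pullM gE qE.
apply/monoP => W a ia; apply: (gen_eq0 G_gen) => h; apply: nu_inj.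
rewrite -[LHS]/(ev (exist _ _ nuPhi : Phi0 X) (a ∘ h)) -iE ev_pull compA ia comp0l.
exact: ev0.
Qed.

End Hull.

Lemma enough_injectives (X : A) : exists E (i : Hom X E), injective_object E /\ mono i.
Proof.
pose L : small := AbHom (Hom G X) QmodZ.
have nu_D (x : Hom G X) (l : L) (s t : Hom G G) :
  (l : AbHom _ _) (x ∘ (s + t)) = (l : AbHom _ _) (x ∘ s) + (l : AbHom _ _) (x ∘ t).
  by rewrite compDr raddfD.
pose nu (x : Hom G X) : cofree G L := fun l => additive_of (nu_D x l).
have [|e [eR ee eN ess]] := @injective_hull A G L (fun i => exists x, i = nu x).
  split=> [|r _ [x ->]]; last first.
    by exists (x ∘ r); apply: cofree_ext => l s /=; rewrite compA.
  split; first by exists 0; apply: cofree_ext => l s /=; rewrite comp0l raddf0.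
  move=> _ _ [x ->] [y ->]; exists (x - y); apply: cofree_ext => l s /=.
  by rewrite compBl raddfB.
apply: (@hull_representable X e eR ee).
  by move=> x; apply: eN; exists x; apply: cofree_ext.
move=> i ei i0; have [r [[x rx] r0]] := ess i ei i0; exists r, x; split.
  by rewrite rx; apply: cofree_ext.
by move=> x0; apply: r0; rewrite rx x0; apply: cofree_ext => l s /=; rewrite comp0l raddf0.
Qed.

(* E contains the coproduct of all quotients of G, and every nonzero object
   contains a nonzero quotient of G. *)
Lemma injective_cogenerator : exists E : A, injective_object E /\ cogenerator E.
Proof.
have [D DP] := dep_choice (fun K : Hom G G -> Prop => kill_maps abA A_coproducts G_gen K).
have [X [inc incP]] := A_coproducts D.
have [pr [pr1 _]] := coproduct_proj incP.
have [E [i [Ei im]]] := enough_injectives X.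
exists E; split=> // Y Z f /G_gen[h fh].
pose K (g : Hom G G) := f ∘ h ∘ g = 0.
have [P [c [k [inj [injP kE cP lK]]]]] := DP K.
have [|f' f'E] := cokernel_desc (g := f ∘ h) cP.
  by apply: (coproduct_eq0 injP) => -[g Kg]; rewrite -compA kE.
have mf : mono f'.
  apply/monoP => W l fl; apply: lK => V p a ca g.
  by rewrite /K compA -f'E -[f' ∘ c ∘ a]compA ca compA fl !comp0l.
have [g gE] := Ei _ _ f' (i ∘ inc K) mf.
exists g => gf; apply: fh; rewrite -f'E.
have : i ∘ (inc K ∘ c) = 0 by rewrite compA -gE -compA f'E compA gf comp0l.
move=> /((monoP i).1 im) ic.
by rewrite -[c]comp1l -(pr1 K) -compA ic !comp0r.
Qed.

End InjectiveCogenerator.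

(** * Product-preserving functors on injectives *)

Lemma ff_ess_equivalent (C D : category) (F : functor C D) :
  (forall (X Y : C) (f g : Mor X Y), farr F f = farr F g -> f = g) ->
  (forall (X Y : C) (g : Mor (F X) (F Y)), exists f, farr F f = g) ->
  (forall Y : D, exists X, isomorphic (F X) Y) ->
  equivalent C D.
Proof.
move=> faith full ess.
have [G0 ess1] := dep_choice ess.
have [e ess2] := dep_choice ess1.
have [e' eP] := dep_choice ess2.
have ee' Y : ccomp (e' Y) (e Y) = cid _ by case: (eP Y).
have e'e Y : ccomp (e Y) (e' Y) = cid _ by case: (eP Y).
have [pre preE] := @dep_choice {XY : C * C & Mor (F XY.1) (F XY.2)}
  (fun t => Mor (projT1 t).1 (projT1 t).2) (fun t f => farr F f = projT2 t)
  (fun t => full _ _ (projT2 t)).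
pose pr (X Y : C) (g : Mor (F X) (F Y)) : Mor X Y :=
  pre (existT (fun XY : C * C => Mor (F XY.1) (F XY.2)) (X, Y) g).
have prE (X Y : C) (g : Mor (F X) (F Y)) : farr F (pr X Y g) = g.
  exact: (preE (existT (fun XY : C * C => Mor (F XY.1) (F XY.2)) (X, Y) g)).
pose garr (Y Y' : D) (g : Mor Y Y') : Mor (G0 Y) (G0 Y') :=
  pr _ _ (ccomp (e' Y') (ccomp g (e Y))).
have garrE Y Y' (g : Mor Y Y') : farr F (garr _ _ g) = ccomp (e' Y') (ccomp g (e Y)).
  exact: prE.
have g1 X : garr _ _ (cid X) = cid (G0 X).
  by apply: faith; rewrite garrE farr1 ccomp1l ee'.
have gM X Y Z (g : Mor Y Z) (f : Mor X Y) :
    garr _ _ (ccomp g f) = ccomp (garr _ _ g) (garr _ _ f).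
  apply: faith; rewrite farrM !garrE -!ccompA; congr ccomp; congr ccomp.
  by rewrite !ccompA e'e ccomp1l.
pose G := Functor g1 gM.
have GE Y Y' (g : Mor Y Y') : farr F (farr G g) = ccomp (e' Y') (ccomp g (e Y)).
  exact: garrE.
exists F, G, (fun X => pr _ _ (e' (F X))), e; split.
- move=> X; exists (pr _ _ (e (F X))).
  by split; apply: faith; rewrite farrM !prE farr1.
- by move=> Y; exists (e' Y).
- move=> X X' f; apply: faith; rewrite !farrM GE !prE -!ccompA.
  by rewrite e'e ccomp1r.
- move=> Y Y' g; rewrite GE; apply: etrans (ccompA _ _ _) _.
  by rewrite e'e ccomp1l.
Qed.

Lemma nat_trans_bijective_iso (A : preadditive) (F H : additive_functor A Ab)
    (a : nat_trans F H) :
  (forall X (x : F X), (a X : AbHom _ _) x = 0 -> x = 0) ->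
  (forall X (y : H X), exists x, (a X : AbHom _ _) x = y) ->
  is_iso (C := AddFun A Ab) a.
Proof.
move=> inj surj.
have ainj X (x x' : F X) : (a X : AbHom _ _) x = (a X : AbHom _ _) x' -> x = x'.
  by move=> e; apply/eqP; rewrite -subr_eq0; apply/eqP/inj; rewrite raddfB e subrr.
have [b bE] := @dep_choice A (fun X => H X -> F X)
  (fun X b => forall y, (a X : AbHom _ _) (b y) = y) (fun X => dep_choice (surj X)).
have bD X (y y' : H X) : b X (y + y') = b X y + b X y'.
  by apply: ainj; rewrite raddfD !bE.
pose b0 X : @Hom Ab (H X) (F X) := additive_of (bD X).
have bN X Y (f : Hom X Y) : b0 Y ∘ fmap H f = fmap F f ∘ b0 X.
  apply: AbHom_eq => y; apply: ainj; rewrite [LHS]bE.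
  have := congr1 (fun h : AbHom _ _ => h (b X y)) (ntcP a f).
  by rewrite /= bE => ->.
exists (NatTrans bN); split; apply: nat_trans_eq => X; apply: AbHom_eq => x /=.
  by apply: ainj; rewrite bE.
by rewrite bE.
Qed.

Section AntiEquivalence.
Variable A : preadditive.
Hypothesis abA : abelian A.
Hypothesis A_products : has_products A.
Variable E : A.
Hypothesis E_inj : injective_object E.
Hypothesis E_cogen : cogenerator E.

Lemma product_injective (I : small) (F : I -> A) P (pr : forall i, Hom P (F i)) :
  is_product pr -> (forall i, injective_object (F i)) -> injective_object P.
Proof.
move=> prP FI X Y m f mm.
have [g gE] := dep_choice (fun i => FI i _ _ m (pr i ∘ f) mm).
have [h [hE _]] := prP Y g.
exists h; have [x [_ xu]] := prP X (fun i => pr i ∘ f).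
by rewrite -(xu f) // -(xu (h ∘ m)) // => i; rewrite compA hE gE.
Qed.

Lemma product_eq0 (I : small) (F : I -> A) P (pr : forall i, Hom P (F i)) X
    (f : Hom X P) : is_product pr -> (forall i, pr i ∘ f = 0) -> f = 0.
Proof.
move=> prP f0; have [x [_ xu]] := prP X (fun i => 0).
by rewrite -(xu f) // -(xu 0) // => i; rewrite comp0r.
Qed.

Lemma embed_product (X : A) : exists P (pr : Hom X E -> Hom P E) (i : Hom X P),
  [/\ is_product pr, injective_object P & mono i].
Proof.
have [P [pr prP]] := A_products (fun _ : (Hom X E : zmodType) => E).
have [i [iE _]] := prP X (fun x => x).
exists P, pr, i; split=> //; first by apply: (product_injective prP).
apply/monoP => W g ig; apply: contrapT => /E_cogen[h]; apply.
by rewrite -(iE h) -compA ig comp0r.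
Qed.

(** The product formed in [A] of injectives is injective, so a product in [Inj A] is a retract of it
    compatibly with the projections. *)
Lemma product_in_Inj (I : small) (F : I -> Inj A) (P : Inj A)
    (pr : forall i, Hom P (F i)) :
  is_product (fun i => pr i : @Hom A (sval P) (sval (F i))) <-> is_product pr.
Proof.
split=> [prP Y f|prP]; first exact: (prP (sval Y) f).
have [P' [pr' prP']] := A_products (fun i => sval (F i)).
have P'I : injective_object P' by apply: (product_injective prP') => i; exact: (svalP (F i)).
have [u [uE _]] := prP' (sval P) pr.
have [v vE] : exists v : @Hom A P' (sval P),
    forall i, (pr i : @Hom A (sval P) (sval (F i))) ∘ v = pr' i.
  by have [v [vE _]] := prP (exist _ P' P'I) pr'; exists v.
have vu : v ∘ u = idm (sval P).
  have [w [_ wu]] := prP P pr.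
  transitivity w; last by apply: wu => i; exact: comp1r.
  by apply/esym/wu => i; rewrite /= compA vE uE.
move=> X f; have [x [xE _]] := prP' X f.
exists (v ∘ x); split=> [i|y yE].
  by rewrite compA vE xE.
apply/eqP; rewrite -subr_eq0; apply/eqP; rewrite -[LHS]comp1l -vu -compA.
suff -> : u ∘ (v ∘ x - y) = 0 by rewrite comp0r.
apply: (product_eq0 prP') => i; rewrite compA uE compBr compA.
by rewrite vE xE yE subrr.
Qed.

Section HomFunctor.
Variable X : A.
Let V (I : Inj A) : zmodType := Hom X (sval I).
Let a (I K : Inj A) (f : Hom I K) (x : V I) : V K := (f : @Hom A (sval I) (sval K)) ∘ x.
Let aD I K (f : Hom I K) x y : a f (x + y) = a f x + a f y.
Proof. exact: compDr. Qed.
Let aDl I K (f g : Hom I K) x : a (f + g) x = a f x + a g x.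
Proof. exact: compDl. Qed.
Let a1 I x : a (idm I) x = x.
Proof. exact: comp1l. Qed.
Let aM I K M (g : Hom K M) (f : Hom I K) x : a (g ∘ f) x = a g (a f x).
Proof. by rewrite /a compA. Qed.

Definition hom_Inj : additive_functor (Inj A) Ab := ab_functor aD aDl a1 aM.

Lemma hom_Inj_products : preserves_products hom_Inj.
Proof.
move=> I F P pr /product_in_Inj prP; apply/Ab_product_elt => x.
exact: (prP X x).
Qed.

End HomFunctor.

Section HomFunctorArrow.
Variables (X Y : A) (f : Hom Y X).

Let cD (I : Inj A) (x y : Hom X (sval I)) : (x + y) ∘ f = x ∘ f + y ∘ f.
Proof. exact: compDl. Qed.

Let c (I : Inj A) : @Hom Ab (hom_Inj X I) (hom_Inj Y I) := additive_of (@cD I).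

Let cN (I K : Inj A) (g : Hom I K) : c K ∘ fmap (hom_Inj X) g = fmap (hom_Inj Y) g ∘ c I.
Proof. by apply: AbHom_eq => x /=; rewrite /= compA. Qed.

Definition hom_Inj_arr : nat_trans (hom_Inj X) (hom_Inj Y) := NatTrans cN.

End HomFunctorArrow.

Definition hom_Inj_functor : functor (op A) (AddFunProd (Inj A)).
Proof.
refine (@Functor (op A) (AddFunProd (Inj A))
  (fun X => exist _ (hom_Inj X) (@hom_Inj_products X))
  (fun X Y f => hom_Inj_arr (f : @Hom A Y X)) _ _).
- by move=> X; apply: nat_trans_eq => I; apply: AbHom_eq => x /=; rewrite comp1r.
- by move=> X Y Z g f; apply: nat_trans_eq => I; apply: AbHom_eq => x /=; rewrite compA.
Defined.

Lemma hom_Inj_faithful (X Y : A) (f g : Hom Y X) :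
  hom_Inj_arr f = hom_Inj_arr g -> f = g.
Proof.
move=> fg; apply/eqP; rewrite -subr_eq0; apply/eqP; apply: contrapT => /E_cogen[h]; apply.
rewrite compBr; apply/eqP; rewrite subr_eq0; apply/eqP.
have := congr1 (fun n : nat_trans (hom_Inj X) (hom_Inj Y) =>
  (n (exist _ E E_inj) : AbHom _ _) h) fg.
by [].
Qed.

(** Embed [X] into an injective [P] and the cokernel into an injective [P1]. Naturality along
    [P -> P1] shows that the image of [i] under [n] factors through the kernel, which is [X]; every
    map from [X] to an injective extends to [P]. *)
Lemma hom_Inj_full (X Y : A) (n : nat_trans (hom_Inj X) (hom_Inj Y)) :
  exists f : Hom Y X, hom_Inj_arr f = n.
Proof.
have nN (I K : Inj A) (g : @Hom A (sval I) (sval K)) (x : Hom X (sval I)) :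
    (n K : AbHom _ _) (g ∘ x) = g ∘ ((n I : AbHom _ _) x : Hom Y (sval I)).
  exact: (congr1 (fun h : AbHom _ _ => h x) (ntcP n (g : @Hom (Inj A) I K))).
have [P [_ [i [_ PI im]]]] := embed_product X.
have [K [c cP]] := abelian_cokernel abA i.
have [P1 [_ [j [_ P1I jm]]]] := embed_product K.
pose P' : Inj A := exist _ P PI; pose P1' : Inj A := exist _ P1 P1I.
pose ni : Hom Y P := (n P' : AbHom _ _) i.
have [|f fE] := kernel_lift (g := ni) (mono_kernel_coker abA im cP).
  apply: ((monoP j).1 jm); rewrite compA /ni.
  rewrite -[LHS](nN P' P1' (j ∘ c) i) -compA (proj1 cP) comp0r.
  exact: raddf0.
exists f; apply: nat_trans_eq => I; apply: AbHom_eq => x /=.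
have [b <-] := svalP I _ _ i x im.
by rewrite [RHS](nN P' I b i) -compA fE.
Qed.

(** Dual to [right_exact_representable]: [X0] is the power of [E] indexed by [Phi E], with
    tautological element [x0], and [X] is the common kernel of the maps [X0 -> E] that kill [x0]. *)
Lemma hom_Inj_ess (Phi : additive_functor (Inj A) Ab) : preserves_products Phi ->
  exists X (a : nat_trans (hom_Inj X) Phi), is_iso (C := AddFun (Inj A) Ab) a.
Proof.
move=> Phi_prod.
have PhiP (I : small) (F : I -> Inj A) (P : Inj A) (pr : forall i, Hom P (F i)) :
    is_product (fun i => pr i : @Hom A (sval P) (sval (F i))) ->
    forall x : (forall i, Phi (F i) : zmodType),
    exists! y : Phi P, forall i, fap Phi (pr i) y = x i.
  by move=> /product_in_Inj prP; apply/Ab_product_elt; exact: Phi_prod.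
pose E' : Inj A := exist _ E E_inj.
have [X0 [pr prP]] := A_products (fun _ : (Phi E' : zmodType) => E).
have X0I : injective_object X0 by apply: (product_injective prP).
pose X0' : Inj A := exist _ X0 X0I.
have [x0 [x0E _]] := PhiP _ (fun _ => E') X0' pr prP (fun x => x).
pose fp (I : Inj A) (b : Hom X0 (sval I)) : Phi I := fap Phi (b : @Hom (Inj A) X0' I) x0.
have fpM (I K : Inj A) (g : Hom (sval I) (sval K)) b : fp K (g ∘ b) = fap Phi (g : @Hom (Inj A) I K) (fp I b).
  by rewrite /fp -fapM.
have fpB (I : Inj A) b b' : fp I (b - b') = fp I b - fp I b' by exact: fapBl.
have [P1 [q qP]] := A_products (fun _ : {g : Hom X0 E | fp E' g = 0} => E).
have P1I : injective_object P1 by apply: (product_injective qP).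
pose P1' : Inj A := exist _ P1 P1I.
have [g0 [g0E _]] := qP X0 (fun g => sval g).
have [X [k kP]] := abelian_kernel abA g0.
have fpg0 : fp P1' g0 = 0.
  have [z [_ zu]] := PhiP _ (fun _ => E') P1' q qP (fun=> 0).
  have <- : z = fp P1' g0.
    apply: zu => -[g gx]; rewrite -(fpM P1' E') g0E; exact: gx.
  by apply: zu => g; exact: fap0.
(* Such a [b] factors through the image of [g0], and injectivity of [I] extends the factor to [P1];
   so [b] is a multiple of [g0], which kills [x0]. *)
have kfp (I : Inj A) (b : Hom X0 (sval I)) : b ∘ k = 0 -> fp I b = 0.
  move=> bk; have [M [e [m [ee mm me]]]] := abelian_image abA g0.
  have ke : is_kernel e k.
    split=> [|W h eh]; first by apply: ((monoP m).1 mm); rewrite compA me (proj1 kP).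
    by apply: (proj2 kP); rewrite -me -compA eh comp0r.
  have [b' b'E] := cokernel_desc (epi_coker_kernel abA ee ke) bk.
  have [h hE] := svalP I _ _ m b' mm.
  by rewrite -b'E -hE -compA me (fpM P1') fpg0 fap0.
have fpk (I : Inj A) (b : Hom X0 (sval I)) : fp I b = 0 -> b ∘ k = 0.
  move=> b0; have [P [r [i [rP PI im]]]] := embed_product (sval I).
  apply: ((monoP i).1 im); apply: (product_eq0 rP) => s.
  have h : fp E' (r s ∘ i ∘ b) = 0 by rewrite (fpM I) b0 fap0.
  have e : q (exist _ _ h) ∘ g0 = r s ∘ i ∘ b := g0E _.
  by rewrite !compA -e -compA (proj1 kP) comp0r.
(* [I] is a retract of a power of [E], for which the elements of [Phi] are read off
   coordinatewise. *)
have fp_surj (I : Inj A) (y : Phi I) : exists b, fp I b = y.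
  have [P [r [i [rP PI im]]]] := embed_product (sval I).
  pose P' : Inj A := exist _ P PI.
  have [rho rhoE] := svalP I _ _ i (idm _) im.
  pose iy : Phi P' := fap Phi (i : @Hom (Inj A) I P') y.
  have [b [bE _]] := rP X0 (fun s => pr (fap Phi (r s : @Hom (Inj A) P' E') iy)).
  have biy : fp P' b = iy.
    have [z [_ zu]] := PhiP _ (fun _ => E') P' r rP (fun s => fap Phi (r s : @Hom (Inj A) P' E') iy).
    have <- : z = fp P' b by apply: zu => s; rewrite -(fpM P' E') bE; exact: x0E.
    by apply: zu => s.
  exists (rho ∘ b); rewrite (fpM P') biy /iy -fapM.
  by rewrite [_ ∘ _](rhoE : rho ∘ i = idm (sval I)); exact: fap1.
have kmono : mono k := is_kernel_mono kP.
(* The value at [x] is that of any extension [b] of [x] to [X0]; by [kfp] the choice does not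
   matter. *)
have [|al alP] := @dep_choice (Inj A) (fun I => Hom X (sval I) -> Phi I)
  (fun I al => forall x, exists b, b ∘ k = x /\ al x = fp I b).
  move=> I; have [|al alP] := @dep_choice (Hom X (sval I)) (fun=> Phi I) (fun x y => exists b, b ∘ k = x /\ y = fp I b).
    by move=> x; have [b bk] := svalP I _ _ k x kmono; exists (fp I b), b.
  by exists al.
have alE (I : Inj A) (b : Hom X0 (sval I)) : al I (b ∘ k) = fp I b.
  have [b' [b'k ->]] := alP I (b ∘ k).
  apply/eqP; rewrite -subr_eq0 -fpB; apply/eqP/kfp.
  by rewrite compBl b'k subrr.
have alD I x y : al I (x + y) = al I x + al I y.
  have [b [<- _]] := alP I x; have [b' [<- _]] := alP I y.
  rewrite -compDl !alE /fp /fap raddfD.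
  by [].
pose a0 I : @Hom Ab (hom_Inj X I) (Phi I) := additive_of (alD I).
have aN (I K : Inj A) (g : Hom I K) : a0 K ∘ fmap (hom_Inj X) g = fmap Phi g ∘ a0 I.
  apply: AbHom_eq => x /=; rewrite /a0 /=.
  have [b [bk ->]] := alP I x.
  by rewrite -bk -[RHS](fpM I K g b) -alE compA.
exists X, (NatTrans aN); apply: nat_trans_bijective_iso => I.
  move=> x; have [b [<- e]] := alP I x; rewrite /= e.
  exact: fpk.
move=> y; have [b <-] := fp_surj I y.
by exists (b ∘ k); exact: alE.
Qed.

Lemma anti_equivalence : equivalent (op A) (AddFunProd (Inj A)).
Proof.
apply: (ff_ess_equivalent (F := hom_Inj_functor)).
- by move=> X Y f g; exact: hom_Inj_faithful.
- by move=> X Y n; exact: hom_Inj_full.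
- move=> [Phi PhiP]; have [X [a ai]] := hom_Inj_ess PhiP.
  by exists X, a.
Qed.

End AntiEquivalence.

(** * Finite extensions and the heart *)

Section TriangleMaps.
Variable C : triangulated.
Let ax := triP C.
Variables (X Y Z X' Y' Z' : C) (u : Hom X Y) (v : Hom Y Z) (w : Hom Z (sh X)).
Variables (u' : Hom X' Y') (v' : Hom Y' Z') (w' : Hom Z' (sh X')).
Hypotheses (T : dist u v w) (T' : dist u' v' w').
Variables (a : Hom X X') (c : Hom Z Z').
Hypothesis ac : fmap sh a ∘ w = w' ∘ c.

Lemma dist_morphism_mid : exists b : Hom Y Y', b ∘ u = u' ∘ a /\ c ∘ v = v' ∘ b.
Proof.
have [b [bu cv]] := dist_morphism ax (rot (rot T)) (rot (rot T')) ac.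
have [b' bE] := sh_full b; rewrite -bE in bu cv.
exists b'; split; apply: sh_inj.
  by apply: oppr_inj; rewrite !fmapM -compNr bu compNl.
by apply: oppr_inj; rewrite !fmapM -compNr cv compNl.
Qed.

(** The middle map [b] is mono by a chase and has the right inverse [s]: lift [c' ∘ v'] to [z], then
    correct [z] by a map through [X]. *)
Lemma five_lemma : is_iso (C := C) a -> is_iso (C := C) c -> isomorphic (C := C) Y Y'.
Proof.
move=> /isoP[a' [a'a aa']] /isoP[c' [c'c cc']].
have [b [bu cv]] := dist_morphism_mid.
have binj W (f : Hom W Y) : b ∘ f = 0 -> f = 0.
  move=> bf; have vf : v ∘ f = 0.
    by rewrite -[LHS]comp1l -c'c -compA [c ∘ _]compA cv -[v' ∘ b ∘ f]compA bf !comp0r.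
  have [g gE] := tri_lift T vf.
  have [|t tE] := tri_lift3 T' (f := fmap sh (a ∘ g)).
    by rewrite -fmapM compA -bu -compA gE bf raddf0.
  have gE' : fmap sh g = w ∘ (c' ∘ t).
    have e : w' = fmap sh a ∘ w ∘ c' by rewrite ac -compA cc' comp1r.
    rewrite compA -[LHS]comp1l -fmap1 -a'a fmapM -compA -fmapM -tE e !compA -fmapM a'a fmap1.
    by rewrite comp1l.
  by apply: sh_inj; rewrite -gE fmapM gE' compA (tri_uw T) comp0l raddf0.
have [|z zE] := tri_lift2 T (f := c' ∘ v').
  have e : w = fmap sh a' ∘ w' ∘ c by rewrite -compA -ac compA -fmapM a'a fmap1 comp1l.
  by rewrite e -compA [c ∘ _]compA cc' comp1l -compA (tri_wv T') comp0r.
have [|g gE] := tri_lift T' (f := idm Y' - b ∘ z).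
  by rewrite compBr comp1r compA -cv -compA zE compA cc' comp1l subrr.
pose s := z + u ∘ (a' ∘ g).
have bs : b ∘ s = idm Y'.
  rewrite compDr compA bu -[u' ∘ a ∘ _]compA [a ∘ _]compA aa' comp1l gE.
  by rewrite addrC subrK.
apply/isomorphicP; exists b, s; split=> //.
apply/eqP; rewrite -subr_eq0; apply/eqP/binj.
by rewrite compBr compA bs comp1l comp1r subrr.
Qed.

End TriangleMaps.

Section FiniteExtensions.
Variables (C : triangulated) (I : small) (Qf : I -> C).
Hypothesis C_coproducts : has_coproducts C.
Hypothesis Qf_finfac : forall i, finfac (Qf i).
Let ax := triP C.
Let Q (X : C) := exists i, Qf i = X.
Let le := gen_le Q.

Inductive finext : C -> Prop :=
| finext_zero X : is_zero X -> finext X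
| finext_gen i n : finext (shn n (Qf i))
| finext_dist X Y Z (u : Hom X Y) (v : Hom Y Z) (w : Hom Z (sh X)) :
    dist u v w -> finext X -> finext Z -> finext Y.

Lemma finext_le X : finext X -> le X.
Proof.
elim=> [Y Y0|i n|Y Y' Z u v w T _ lY _ lZ].
- by case: (gen_le_ext Q) => h _; exact: h.
- by apply: gen_le_gen; exists i.
- by case: (gen_le_ext Q) => _; apply; [exact: T|exact: lY|exact: lZ].
Qed.

Lemma finext_finfac X : finext X -> finfac X.
Proof.
elim=> [Y Y0|i n|Y Y' Z u v w T _ lY _ lZ].
- exact: finfac_zero.
- exact: finfac_shn.
- exact: finfac_ext T lY lZ.
Qed.

(** Finite extensions range over a possibly large class of objects. The stages collect
    representatives in a small type, adding at each step a chosen extension for every connecting map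
    between earlier representatives. *)
Let stage0 : {T : small & T -> C} := existT (fun T : small => T -> C) (option (I * nat))
  (fun x => if x is Some (i, n) then shn n (Qf i) else sval (boolp.cid (zero_object C))).

Let next_stage (s : {T : small & T -> C}) : {T : small & T -> C} :=
  let F := projT2 s in
  existT (fun T : small => T -> C)
    (projT1 s + {a : projT1 s & {b : projT1 s & Hom (F b) (sh (F a))}})%type
    (fun x => match x with
      | inl t => F t
      | inr (existT a (existT b g)) => sval (boolp.cid (fiber3 g))
      end).

Let stage n := iter n next_stage stage0.

Lemma finext_skeleton : exists (T : small) (F : T -> C),
  (forall t, finext (F t)) /\
  forall X, finext X -> exists t, isomorphic (C := C) X (F t).
Proof.
exists {n : nat & projT1 (stage n)}, (fun t => projT2 (stage (projT1 t)) (projT2 t)).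
split=> [[n t] /=|X].
  elim: n t => [|n IH] /= [].
  - by move=> [i m]; exact: finext_gen.
  - by apply: finext_zero; exact: svalP.
  - by move=> t; exact: IH.
  - move=> [a [b g]]; have [u [v T]] := svalP (boolp.cid (fiber3 g)).
    by apply: (finext_dist T); exact: IH.
(* Two representatives from different stages have to be brought to a common stage before they can be
   extended by one another. *)
have later n m (t : projT1 (stage n)) : (n <= m)%N ->
    exists t' : projT1 (stage m), projT2 (stage m) t' = projT2 (stage n) t.
  move=> nm; rewrite -(subnKC nm) addnC; elim: (m - n)%N => [|k [t' IH]]; first by exists t.
  by exists (inl t').
elim=> [Y Y0|i n|Y Y' Z u v w T _ [[n t] /= IHY] _ [[m s] /= IHZ]].
- exists (existT _ 0%N None) => /=; case: (boolp.cid _) => /= O O0.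
  by apply/isomorphicP; exists 0, 0; rewrite !comp0l; split; apply/esym; exact: zero_from.
- by exists (existT _ 0%N (Some (i, n))); exact: isomorphic_refl.
have [a aE] := later _ (maxn n m) t (leq_maxl n m).
have [b bE] := later _ (maxn n m) s (leq_maxr n m).
rewrite -aE in IHY; rewrite -bE in IHZ.
set F := projT2 (stage (maxn n m)) in IHY IHZ *.
have /isomorphicP[f [f' [f'f ff']]] := IHY.
have /isomorphicP[g [g' [g'g gg']]] := IHZ.
pose h : Hom (F b) (sh (F a)) := fmap sh f ∘ w ∘ g'.
exists (existT _ (maxn n m).+1 (inr (existT _ a (existT _ b h)))) => /=.
have [u' [v' T']] := svalP (boolp.cid (fiber3 h)).
apply: (five_lemma T T' (a := f) (c := g)).
- by rewrite /h -compA g'g comp1r.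
- by exists f'.
- by exists g'.
Qed.

Lemma finext_sum X Y : finext X -> finext Y ->
  exists P (i1 : Hom X P) (i2 : Hom Y P) (p1 : Hom P X) (p2 : Hom P Y),
  finext P /\ [/\ p1 ∘ i1 = idm X, p2 ∘ i2 = idm Y, p1 ∘ i2 = 0, p2 ∘ i1 = 0
      & i1 ∘ p1 + i2 ∘ p2 = idm P].
Proof.
move=> fX fY; have [_ /(_ X Y)[P [i1 [i2 [p1 [p2 e]]]]]] := tri_additive ax.
exists P, i1, i2, p1, p2; split=> //.
exact: finext_dist (dist_biproduct e) fX fY.
Qed.

Let factors (M : C) : Prop := forall c (f : Hom c M), finfac c ->
  exists d (a : Hom c d) (b : Hom d M), finext d /\ b ∘ a = f.

Let factors_add M c d d' (a : Hom c d) (b : Hom d M) (a' : Hom c d') (b' : Hom d' M) :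
  finext d -> finext d' -> exists d (a2 : Hom c d) (b2 : Hom d M),
    finext d /\ b2 ∘ a2 = b ∘ a + b' ∘ a'.
Proof.
move=> fd fd'; have [P [i1 [i2 [p1 [p2 [fP [e11 e22 e12 e21 _]]]]]]] := finext_sum fd fd'.
exists P, (i1 ∘ a + i2 ∘ a'), (b ∘ p1 + b' ∘ p2); split=> //.
rewrite !compDl !compDr -!compA (compA p1 i1) (compA p1 i2) (compA p2 i1) (compA p2 i2) e11 e22 e12 e21.
by rewrite !comp1l !comp0l !comp0r add0r addr0.
Qed.

(** By minimality of [gen_le], it is enough that factorization through finite extensions survives
    extensions and coproducts and holds for the generators. *)
Lemma finext_factor M : le M -> factors M.
Proof.
apply.
- split=> [Z Z0 c f _|X Y Z u v w T PX PZ c f cf].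
    by exists Z, f, (idm Z); split; [exact: finext_zero | rewrite comp1l].
  have [d2 [a2 [b2 [fd2 e2]]]] := PZ c (v ∘ f) cf.
  have [g gE] := to_sh (w ∘ b2).
  have [d1 [a1 [b1 [fd1 e1]]]] := PX _ g (finfac_unsh (finext_finfac fd2)).
  pose del := fmap sh a1 ∘ eta d2.
  have delE : fmap sh b1 ∘ del = w ∘ b2 by rewrite compA -fmapM e1 gE.
  (* [h] is the obstruction to lifting [a2] to the extension of [d2] by [d1]. It dies in [X], so
     [d1] is replaced by [d4], reached through the cone of [h], where it vanishes. *)
  have [h hE] := to_sh (del ∘ a2).
  have b1h : b1 ∘ h = 0.
    apply: sh_inj; rewrite raddf0 -[LHS]comp1r -etaK compA fmapM -[_ ∘ eta c]compA -hE.
    by rewrite [fmap sh b1 ∘ _]compA delE -[w ∘ b2 ∘ a2]compA e2 compA (tri_wv T) !comp0l.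
  have [d3 [k [l Th]]] := dist_cone ax h.
  have [b3 b3E] := tri_desc Th b1h.
  have [d4 [a4 [b4 [fd4 e4]]]] : exists d4 (a4 : Hom d3 d4) (b4 : Hom d4 X),
      finext d4 /\ b4 ∘ a4 = b3.
    apply: PX; apply: (finfac_ext (rot Th)); first exact: finext_finfac.
    by apply/finfac_sh/finfac_unsh.
  pose j := a4 ∘ k.
  have bj : b4 ∘ j = b1 by rewrite compA e4 b3E.
  have jh : j ∘ h = 0 by rewrite -compA (tri_vu Th) comp0r.
  have [d [p [r Td]]] := fiber3 (fmap sh j ∘ del).
  have [|e [ep re]] := @dist_morphism_mid C _ _ _ _ _ _ _ _ _ _ _ _ Td T b4 b2.
    by rewrite compA -fmapM bj delE.
  have [|ct ctE] := tri_lift2 (proj2 (dist_rotate ax _ _ _) (rot Td)) (f := a2).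
    by rewrite -compA hE compA -fmapM jh raddf0 comp0l.
  (* [e ∘ ct] agrees with [f] after [v]; the difference comes from [X] and is factored
     separately. *)
  have [|h' h'E] := tri_lift T (f := f - e ∘ ct).
    by rewrite compBr compA -re -compA ctE e2 subrr.
  have [d5 [a5 [b5 [fd5 e5]]]] := PX c h' cf.
  have [|d6 [a6 [b6 [fd6 e6]]]] := factors_add ct e a5 (u ∘ b5) _ fd5.
    exact: finext_dist Td fd4 fd2.
  exists d6, a6, b6; split=> //.
  by rewrite e6 -compA e5 h'E addrC subrK.
- move=> J F S inj injP PF c f cf.
  elim: (cf _ _ _ _ injP f) => [|i g z _ [d [a [b [fd <-]]]]].
    have [O O0] := zero_object C; exists O, 0, 0.
    by split; [exact: finext_zero | rewrite comp0r].
  have [d' [a' [b' [fd' <-]]]] := PF i c g cf.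
  by rewrite compA; exact: factors_add.
- move=> n Y [_ [[i <-] /isomorphicP[a [b [ba ab]]]]] c f cf.
  exists (shn n (Qf i)), (a ∘ f), b; split; first exact: finext_gen.
  by rewrite compA ba comp1l.
Qed.

Lemma finext_factor_sh M c (f : Hom c (sh M)) : le M -> finfac c ->
  exists d (a : Hom c (sh d)) (b : Hom (sh d) (sh M)), finext d /\ b ∘ a = f.
Proof.
move=> lM cf; have [f' ->] := to_sh f.
have [d [a [b [fd <-]]]] := finext_factor lM f' (finfac_unsh cf).
by exists d, (fmap sh a ∘ eta c), (fmap sh b); rewrite compA -fmapM.
Qed.

End FiniteExtensions.

(** * A small generating family of the heart *)

Section HeartFamily.
Variables (C : triangulated) (I : small) (Qf : I -> C).
Hypothesis C_coproducts : has_coproducts C.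
Hypothesis Qf_finfac : forall i, finfac (Qf i).
Let Q (X : C) := exists i, Qf i = X.
Let le := gen_le Q.
Let ge := gen_ge Q.
Let tP : t_structure le ge := gen_t_structure C_coproducts Qf_finfac.
Local Notation Ht := (t_heart le ge).

(** The obstruction to lifting [z] is a map from [d] to [sh F]; it factors through [sh e] for a
    finite extension [e], and [d'] is the fiber of [d -> sh e]. A map from [d] killed by [r] factors
    through [sh e], which has no nonzero maps to t>=0. *)
Lemma finext_cover (F Y Z d : C) (i : Hom F Y) (p : Hom Y Z) (w : Hom Z (sh F))
    (z : Hom d Z) : dist i p w -> le F -> finext Qf d ->
  exists d' (r : Hom d' d) (y : Hom d' Y), [/\ finext Qf d', p ∘ y = z ∘ r &
    forall N, ge N -> forall n : Hom d N, n ∘ r = 0 -> n = 0].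
Proof.
move=> T lF fd.
have [e [a [b [fe ab]]]] := finext_factor_sh Qf_finfac (w ∘ z) lF (finext_finfac Qf_finfac fd).
have [d' [j [r T']]] := fiber3 a.
have [|y yE] := tri_lift2 T (f := z ∘ r).
  by rewrite compA -ab -compA (tri_wv T') comp0r.
exists d', r, y; split=> //; first exact: finext_dist T' fe fd.
move=> N gN n nr; have [n' <-] := tri_desc2 T' nr.
by rewrite (orth_sh tP n' (finext_le fe) gN) comp0l.
Qed.

(** [B] is H^0(d), the truncation of [d] to degrees >= 0. Since decompositions separate degrees <= 0
    from degrees >= 1, it is [unsh d] that is decomposed, and the result is shifted back. *)
Lemma heart_reflection (d : C) : le d -> exists (B : Ht) (b : Hom d (sval B)),
  (forall N, ge N -> forall n : Hom d N, exists n', n' ∘ b = n) /\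
  (forall N, ge N -> forall n : Hom (sval B) N, n ∘ b = 0 -> n = 0).
Proof.
move=> ld; have [L [R [u [v [w [T lL gR]]]]]] := t_decomp1 tP (unsh d).
have T' := dist_sh T.
have HB : in_heart le ge (sh R).
  split=> //; apply: (le_cofiber tP T'); first exact: (le_sh tP).
  by apply: (t_le_iso tP) ld; exact: isomorphic_eta.
exists (exist _ _ HB), (fmap sh v ∘ eta d); split=> N gN n.
  have [|n' n'E] := tri_desc T' (f := n ∘ eti d); first exact: (orth_sh tP).
  by exists n'; rewrite compA n'E -compA etiK comp1r.
move=> nb; have [|n' <-] := tri_desc2 T' (f := n).
  by rewrite -[LHS]comp1r -etaK compA -[n ∘ _ ∘ _]compA nb comp0l.
by rewrite (orth_sh tP n' _ gN) ?comp0l //; exact: (le_sh tP).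
Qed.

Lemma heart_mono_le (X Y : Ht) (m : Hom X Y) (d : C) (x : Hom d (sval X)) :
  mono m -> le d -> (m : Hom (sval X) (sval Y)) ∘ x = 0 -> x = 0.
Proof.
move=> /monoP mm ld mx; have [B [b [bE b0]]] := heart_reflection ld.
have [x' x'E] := bE _ (proj2 (svalP X)) x.
suff x'0 : x' = 0 by rewrite -x'E x'0 comp0l.
apply: (mm B x'); apply: (b0 _ (proj2 (svalP Y)) ((m : Hom (sval X) (sval Y)) ∘ x')).
by rewrite -compA x'E.
Qed.

Lemma heart_coproduct_in (J : small) (F : J -> Ht) S (inj : forall j, Hom (sval (F j)) S) :
  is_coproduct inj -> in_heart le ge S.
Proof.
move=> injP; split.
  by apply: (gen_le_coproduct injP) => j; exact: (proj1 (svalP (F j))).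
by apply: (proj2 (gen_t_smashing C_coproducts Qf_finfac) _ _ _ _ injP) => j; exact: (proj2 (svalP (F j))).
Qed.

Lemma heart_coproducts : has_coproducts Ht.
Proof.
move=> J F; have [S [inj injP]] := C_coproducts (fun j => sval (F j)).
exists (exist _ S (heart_coproduct_in injP)), inj => Y f.
exact: (injP (sval Y) f).
Qed.

(** The heart is closed under coproducts of [C], so [S] is a retract of such a coproduct compatibly
    with the injections. *)
Lemma heart_coproduct (J : small) (F : J -> Ht) (S : Ht) (inj : forall j, Hom (F j) S) :
  is_coproduct inj ->
  is_coproduct (fun j => inj j : @Hom C (sval (F j)) (sval S)).
Proof.
move=> injP; have [S' [inj' inj'P]] := C_coproducts (fun j => sval (F j)).
have [u uE] := coproduct_desc inj'P (fun j => inj j : @Hom C (sval (F j)) (sval S)).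
have [v vE] : exists v : @Hom C (sval S) S',
    forall j, v ∘ (inj j : @Hom C (sval (F j)) (sval S)) = inj' j.
  by have [v [vE _]] := injP (exist _ S' (heart_coproduct_in inj'P)) inj'; exists v.
have uv : u ∘ v = idm (sval S).
  apply: (coproduct_ext injP (Y := S) (g := u ∘ v) (h := idm (sval S))) => j.
  by rewrite /= -compA vE uE comp1l.
apply: coproductP => [Y f|Y g g0].
  have [f' f'E] := coproduct_desc inj'P f.
  by exists (f' ∘ v) => j; rewrite -compA vE f'E.
rewrite -[g]comp1r -uv compA.
suff -> : g ∘ u = 0 by rewrite comp0l.
by apply: (coproduct_eq0 inj'P) => j; rewrite -compA uE g0.
Qed.

(** [B t] is H^0 of a finite extension [F t]. Maps from [B t] to the heart are maps from [F t], so
    covers and finiteness carry over from finite extensions. *)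
Lemma heart_family : exists (T : small) (B : T -> Ht),
  [/\ forall (X Y : Ht) (f : Hom X Y), f <> 0 -> exists t (g : Hom (B t) X), f ∘ g <> 0,
      forall (Y Z : Ht) (p : Hom Y Z) t (z : Hom (B t) Z), epi p ->
        exists t' (r : Hom (B t') (B t)) y, epi r /\ p ∘ y = z ∘ r
    & forall t, finfac (B t)].
Proof.
have [T [F [fF Fsk]]] := finext_skeleton Qf.
have [B BP] := dep_choice (fun t => heart_reflection (finext_le (fF t))).
have [b bP] := dep_choice BP.
have bE t (N : Ht) (n : Hom (F t) (sval N)) : exists n' : Hom (B t) N,
    (n' : @Hom C (sval (B t)) (sval N)) ∘ b t = n.
  exact: (proj1 (bP t) _ (proj2 (svalP N)) n).
have b0 t (N : Ht) (n : Hom (B t) N) : (n : @Hom C (sval (B t)) (sval N)) ∘ b t = 0 -> n = 0.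
  exact: (proj2 (bP t) _ (proj2 (svalP N)) n).
exists T, B; split.
- move=> X Y f f0; have [M [e [m [ee mm me]]]] := abelian_image (heart_abelian tP) f.
  (* An image [M] that received no nonzero map from any q would lie in t<=0 and in t>=1, hence
     vanish. *)
  have [i [x x0]] : exists i (x : Hom (Qf i) (sval M)), x <> 0.
    apply: contrapT => none; apply: f0; rewrite -me.
    suff M0 : idm (sval M) = 0 by rewrite -[e]comp1l [idm M]M0 comp0l comp0r.
    apply: (gen_le_orth (proj1 (svalP M))) => _ [|n] [i <-] _ x.
      by apply: contrapT => x0; apply: none; exists i, x.
    by apply: (proj1 (gen_geP Q (sval M)) (proj2 (svalP M))) => //; exists i.
  have [K [k [w Te]]] := fiber (e : @Hom C (sval X) (sval M)).
  have [d [r [y [fd yE rP]]]] := finext_cover x Te (proj1 (heart_epi_fiber tP ee Te)) (finext_gen Qf i 0).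
  have [t /isomorphicP[a [a' [a'a aa']]]] := Fsk d fd.
  have [g gE] := bE t X (y ∘ a').
  exists t, g => fg; apply: x0; apply: (rP _ (proj2 (svalP M))).
  apply: (heart_mono_le mm (finext_le fd)).
  have me' : @comp C _ _ _ m e = f by exact: me.
  have fg' : @comp C _ _ _ f g = 0 by exact: fg.
  have fy : @comp C _ _ _ f y = 0.
    by rewrite -[LHS]comp1r -a'a compA -[_ ∘ a']compA -gE compA fg' !comp0l.
  by rewrite -yE compA me'.
- move=> Y Z p t z ep.
  have [K [k [w Tp]]] := fiber (p : @Hom C (sval Y) (sval Z)).
  have [d [r [y [fd yE rP]]]] := finext_cover ((z : @Hom C (sval (B t)) (sval Z)) ∘ b t) Tp
    (proj1 (heart_epi_fiber tP ep Tp)) (fF t).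
  have [t' /isomorphicP[a [a' [a'a aa']]]] := Fsk d fd.
  have [r' r'E] := bE t' (B t) (b t ∘ r ∘ a').
  have [y' y'E] := bE t' Y (y ∘ a').
  exists t', r', y'; split.
    apply/epiP => N n nr; apply: (b0 t); apply: (rP _ (proj2 (svalP N))).
    have nr' : (n : @Hom C (sval (B t)) (sval N)) ∘ r' = 0 by exact: nr.
    rewrite -[LHS]comp1r -a'a compA -[_ ∘ b t ∘ r ∘ a']compA -[_ ∘ b t ∘ _]compA [b t ∘ _]compA -r'E.
    by rewrite [_ ∘ (_ ∘ b t')]compA nr' !comp0l.
  apply/eqP; rewrite -subr_eq0; apply/eqP/(b0 t').
  rewrite [LHS]compBl; apply/eqP; rewrite subr_eq0; apply/eqP.
  by rewrite -[LHS]compA y'E compA yE -[RHS]compA r'E !compA.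
- move=> t J G S inj injP z.
  have injP' := heart_coproduct injP.
  suff h (y : Hom (F t) (sval S)) : finspan (fun j => inj j : @Hom C (sval (G j)) (sval S)) y ->
      exists z' : Hom (B t) S, finspan inj z' /\ (z' : @Hom C (sval (B t)) (sval S)) ∘ b t = y.
    have [z' [z's z'E]] := h _ (finext_finfac Qf_finfac (fF t) injP' ((z : @Hom C (sval (B t)) (sval S)) ∘ b t)).
    suff -> : z = z' by [].
    apply/eqP; rewrite -subr_eq0; apply/eqP/(b0 t).
    by rewrite [LHS]compBl z'E subrr.
  elim=> [|i g y' _ [z' [z's z'E]]].
    by exists 0; split; [exact: finspan0 | exact: comp0l].
  have [g' g'E] := bE t (G i) g.
  exists (inj i ∘ g' + z'); split; first exact: finspanD.
  by rewrite [LHS]compDl z'E -[_ ∘ _ ∘ b t]compA g'E.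
Qed.

End HeartFamily.

(** * The adjacent weight structure *)

Section Brown.
Variable C : triangulated.
Hypothesis brown : brown_representability C.

Lemma brown_universal (H : additive_functor (op C) Ab) :
  (forall X Y Z (u : Hom X Y) (v : Hom Y Z) (w : Hom Z (sh X)), dist u v w ->
    forall y : H Y, pull u y = 0 <-> exists z : H Z, pull v z = y) ->
  preserves_products H -> exists X (x : H X), universal x.
Proof.
move=> Hc Hp; have [X XH] := proj2 brown H Hc Hp.
by have [x xU] := iso_universal XH; exists X, x.
Qed.

Lemma brown_products : has_products C.
Proof.
move=> I F; have [||P [pr prU]] := @brown_universal (prod_functor F).
- move=> X Y Z u v w T y; split=> [yu|[z <-]].
    have [|z zE] := @dep_choice I (fun i => Hom Z (F i)) (fun i z => z ∘ v = y i).
      move=> i; apply: (tri_desc T); exact: (congr1 (fun h => h i) yu).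
    by exists z; apply: functional_extensionality_dep => i; exact: zE.
  apply: functional_extensionality_dep => i.
  by rewrite !prod_functorE -compA (tri_vu T) comp0r.
- exact: prod_functor_preserves.
by exists P, pr; exact: prod_functor_universal.
Qed.

Section SplitIdempotent.
Variables (Y : C) (e : Hom Y Y).
Hypothesis ee : e ∘ e = e.

Let fixed (M : C) (f : Hom M Y) : Prop := e ∘ f = f.

Let fixed_sub M : subgroup (@fixed M).
Proof.
by split=> [|f g]; rewrite /fixed; [rewrite comp0r | move=> ef eg; rewrite compBr ef eg].
Qed.

Let V (M : op C) : zmodType := sub_zmod (fixed_sub M).

Let a_fixed (M N : op C) (f : @Hom (op C) M N) (x : V M) :
  fixed (sval x ∘ (f : @Hom C N M)).
Proof. by rewrite /fixed compA (svalP x). Qed.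

Let a (M N : op C) (f : @Hom (op C) M N) (x : V M) : V N := exist _ _ (a_fixed f x).

Let aD M N (f : @Hom (op C) M N) x y : a f (x + y) = a f x + a f y.
Proof. by apply: sub_zmod_eq; exact: compDl. Qed.
Let aDl M N (f g : @Hom (op C) M N) x : a (f + g) x = a f x + a g x.
Proof. by apply: sub_zmod_eq; exact: compDr. Qed.
Let a1 M x : a (@idm (op C) M) x = x.
Proof. by apply: sub_zmod_eq; exact: comp1r. Qed.
Let aM M N K (g : @Hom (op C) N K) (f : @Hom (op C) M N) x : a (g ∘ f) x = a g (a f x).
Proof. by apply: sub_zmod_eq; exact: compA. Qed.

(** The maps fixed by [e] form a direct summand of Hom(-, Y), so they give a cohomological functor;
    its representing object is the image of [e]. *)
Lemma split_idempotent : exists N (i : Hom N Y) (p : Hom Y N),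
  p ∘ i = idm N /\ i ∘ p = e.
Proof.
have [||N [i iU]] := @brown_universal (ab_functor aD aDl a1 aM).
- move=> X X' Z u v w T y; split=> [yu|[z <-]].
    have [z zE] := tri_desc T (congr1 sval yu : sval y ∘ u = 0).
    have ez : fixed (e ∘ z) by rewrite /fixed compA ee.
    exists (exist _ _ ez : V Z); apply: sub_zmod_eq; rewrite /= -compA zE.
    exact: (svalP y).
  by apply: sub_zmod_eq; rewrite /= -compA (tri_vu T) comp0r.
- apply/preserves_products_elt => I F S inj injP x.
  have [y yE] := coproduct_desc injP (fun i => sval (x i : V (F i))).
  have ey : fixed y.
    apply: (coproduct_ext injP) => i; rewrite -compA yE; exact: (svalP (x i : V (F i))).
  exists (exist _ _ ey : V S); split=> [i|y' y'E]; apply: sub_zmod_eq; first exact: yE.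
  by apply: (coproduct_ext injP) => i; rewrite /= yE -y'E.
have [p [pE _]] := iU Y (exist _ _ ee : V Y).
have {}pE : sval (i : V N) ∘ p = e by exact: (congr1 sval pE).
have ei : e ∘ sval (i : V N) = sval (i : V N) by exact: (svalP (i : V N)).
exists N, (sval (i : V N)), p; split=> //.
have [x [_ xu]] := iU N i.
transitivity x; last by apply: xu; apply: sub_zmod_eq; exact: comp1r.
by apply/esym/xu; apply: sub_zmod_eq; rewrite /= compA pE.
Qed.

End SplitIdempotent.

(** The functor is cohomological because characters extend, and turns coproducts into products
    because [q] is compact. *)
Lemma BC_exists (q : C) : compact q -> exists qhat, BC_dual q qhat.
Proof.
move=> qc; apply: (proj2 brown).
  move=> X Y Z u v w T y; split=> [yu|[z <-]].
    have [|||f fP] := @QmodZ_extend (Hom q Z)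
        (fun x t => exists x', x = v ∘ x' /\ t = (y : AbHom _ _) x').
    - by exists 0; rewrite comp0r raddf0.
    - move=> _ _ _ _ [x [-> ->]] [x' [-> ->]]; exists (x - x').
      by rewrite compBr raddfB.
    - move=> _ [x [/esym /(tri_lift T)[g <-] ->]].
      exact: (congr1 (fun h : AbHom _ _ => h g) yu).
    by exists f; apply: AbHom_eq => x; apply: fP; exists x.
  apply: AbHom_eq => x /=.
  by rewrite compA (tri_vu T) comp0l raddf0.
apply/preserves_products_elt => I F S inj injP x.
exact: (qc I F S inj injP QmodZ x).
Qed.

End Brown.

(** This is what the orthogonality arguments use of Brown-Comenetz duality; in this form it is
    stable under shifts. *)
Definition detects (C : tri_data) (q qhat : C) : Prop :=
  forall M' M (g : Hom M' M),
    (forall f : Hom M qhat, f ∘ g = 0) <-> (forall x : Hom q M', g ∘ x = 0).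

Section Detects.
Variable C : triangulated.

Lemma BC_detects (q qhat : C) : BC_dual q qhat -> detects q qhat.
Proof.
case/iso_universal=> t tU M' M g; split=> h x.
  apply: QmodZ_cogen => phi; have [f [fE _]] := tU M phi.
  rewrite -fE; change ((t : AbHom (Hom q qhat) QmodZ) (f ∘ (g ∘ x)) = 0).
  by rewrite compA h comp0l raddf0.
have [f [_ fu]] := tU M' 0.
rewrite -(fu (x ∘ g)) ?(fu 0) //; first exact: pull0l.
apply: AbHom_eq => y; change ((t : AbHom (Hom q qhat) QmodZ) (x ∘ g ∘ y) = 0).
by rewrite -compA h comp0r raddf0.
Qed.

Lemma detects_sh (q qhat : C) : detects q qhat -> detects (sh q) (sh qhat).
Proof.
move=> D M' M g; split=> h.
  have h' : forall x : Hom q (unsh M'), fmap unsh g ∘ x = 0.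
    apply: (proj1 (D _ _ _)) => f; apply: sh_inj; rewrite raddf0 -[LHS]comp1r -etaK compA fmapM.
    by rewrite -[_ ∘ eta M']compA -eta_nat compA h comp0l.
  by move=> x; have [x' ->] := from_sh x; rewrite compA -eti_nat -compA -fmapM h' raddf0 comp0r.
move=> f; have [f' ->] := to_sh f.
rewrite -compA eta_nat compA -fmapM (_ : f' ∘ _ = 0) ?raddf0 ?comp0l //.
apply: (proj2 (D _ _ _)) => x; apply: sh_inj; rewrite raddf0 -[LHS]comp1l -etaK fmapM -compA.
by rewrite [eti M ∘ _]compA eti_nat -compA h comp0r.
Qed.

Lemma detects_shn n (q qhat : C) : detects q qhat -> detects (shn n q) (shn n qhat).
Proof. by move=> D; elim: n => [|n IH] //; exact: detects_sh. Qed.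

End Detects.

(* Big hulls in the opposite category, in terms of C: the cone of a morphism
   becomes its fiber and the homotopy colimit the homotopy limit. *)
Definition holim (C : triangulated) (Y : nat -> C) (phi : forall k, Hom (Y k.+1) (Y k))
    (H : C) : Prop :=
  exists (S : C) (pr : forall k, Hom S (Y k)) (s : Hom S S) (v : Hom H S)
      (w : Hom (unsh S) H),
    [/\ is_product pr, forall k, pr k ∘ s = pr k - phi k ∘ pr k.+1
      & dist w v (eta S ∘ s)].

Lemma op_big_hullE (C : triangulated) (P : C -> Prop) (X : C) :
  op_big_hull P X <-> exists H (Y : nat -> C) (phi : forall k, Hom (Y k.+1) (Y k)),
  [/\ @coproduct_closure (op C) P (Y 0%N),
      forall k, exists Z (j : Hom Z (Y k.+1)) (w : Hom (unsh (Y k)) Z),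
        dist w j (eta (Y k) ∘ phi k) /\ @coproduct_closure (op C) P Z,
      holim phi H & retract X H].
Proof.
split=> [[H [[Y [phi [Y0 Yk Hh]]] [i [p pi]]]]|[H [Y [phi [Y0 Yk Hh [i [p pi]]]]]]].
  by exists H, Y, phi; split=> //; exists p, i.
by exists H; split; [exists Y, phi | exists p, i].
Qed.

(** * The dual tower and the big hull *)

Section WeightStructure.
Variables (C : triangulated) (I : small) (Qf : I -> C).
Hypothesis C_products : has_products C.
Let ax := triP C.
Let Q (X : C) := exists i, Qf i = X.

(* The right orthogonal of t>=1. *)
Definition orth_ge1 (X : C) : Prop :=
  forall M, right_of Q 0 M -> forall f : Hom M X, f = 0.

Local Notation hull := (op_big_hull (BC_shifts Q)).

Lemma orth_ge1_iso : iso_closed orth_ge1.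
Proof. by move=> X Y XY Xo M MQ; apply: (iso_vanish XY); exact: Xo. Qed.

Lemma orth_ge1_retract : retract_closed orth_ge1.
Proof.
move=> X Y [i [p pi]] Yo M MQ f.
by rewrite -[f]comp1l -pi -compA (Yo M MQ (i ∘ f)) comp0r.
Qed.

Lemma orth_ge1_sh X : orth_ge1 X -> orth_ge1 (sh X).
Proof.
move=> Xo M MQ f; have [f' ->] := to_sh f.
rewrite (Xo _ _ f') ?raddf0 ?comp0l //.
apply/right_of_sh; apply: (right_of_iso (isomorphic_eta M)).
exact: right_of_le MQ.
Qed.

Lemma orth_ge1_product (J : small) (F : J -> C) P (pr : forall j, Hom P (F j)) :
  is_product pr -> (forall j, orth_ge1 (F j)) -> orth_ge1 P.
Proof.
by move=> prP Fo M MQ f; apply: (product_eq0 prP) => j; exact: Fo.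
Qed.

Lemma BC_shifts_orth X : BC_shifts Q X -> orth_ge1 X.
Proof.
case=> q [qhat [n [Qq qq Xq]]].
apply: (orth_ge1_iso (isomorphic_sym Xq)) => M MQ f.
rewrite -[f]comp1r; apply: (proj2 (detects_shn n (BC_detects qq) (idm M))) => x.
by rewrite comp1l; exact: MQ.
Qed.

Lemma closure_orth X :
  @coproduct_closure (op C) (BC_shifts Q) X -> orth_ge1 X.
Proof.
apply; last exact: BC_shifts_orth.
move=> J F P pr prP; exact: (@orth_ge1_product J F P pr prP).
Qed.

(* The lim^1 term vanishes since the transition maps are surjective on
   Hom(M[1], -). *)
Lemma hull_orth X : hull X -> orth_ge1 X.
Proof.
case/op_big_hullE=> H [Y [phi [Y0 Yk [S [pr [s [v [w [prP sE T]]]]]] XH]]].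
apply: (orth_ge1_retract XH).
have Z k : exists Z (j : Hom Z (Y k.+1)) (w : Hom (unsh (Y k)) Z),
    dist w j (eta (Y k) ∘ phi k) /\ orth_ge1 Z.
  have [Z [j [w' [Tk Zo]]]] := Yk k.
  by exists Z, j, w'; split=> //; exact: closure_orth.
have Yo k : orth_ge1 (Y k).
  elim: k => [|k IH]; first exact: closure_orth.
  have [Zk [v' [w' [Tk Zo]]]] := Z k; move=> M MQ f.
  have [|g <-] := tri_lift2 Tk (f := f).
    by rewrite -compA (IH M MQ (phi k ∘ f)) comp0r.
  by rewrite (Zo M MQ g) comp0r.
move=> M MQ f.
have vf : v ∘ f = 0.
  by apply: (product_eq0 prP) => k; exact: Yo.
have [g gE] := tri_lift T vf.
have surj k (x : Hom (sh M) (Y k)) : exists y, phi k ∘ y = x.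
  have [Zk [v' [w' [Tk Zo]]]] := Z k.
  have [|y yE] := tri_lift3 Tk (f := eta (Y k) ∘ x).
    have [h hE] := sh_full (fmap sh w' ∘ (eta (Y k) ∘ x)).
    by rewrite -hE (Zo M MQ h) raddf0.
  exists y; rewrite -[LHS]comp1l -etiK -[_ ∘ _ ∘ (phi k ∘ y)]compA [eta _ ∘ _]compA yE.
  by rewrite compA etiK comp1l.
pose z : Hom (sh M) S := eti S ∘ fmap sh g.
have [nx nxE] := dep_choice (fun kx : {k : nat & Hom (sh M) (Y k)} =>
  surj _ (projT2 kx - pr (projT1 kx) ∘ z)).
(* Surjectivity of the transition maps lets the telescope equation be solved recursively, from 0 at
   stage 0. *)
pose t := fix t k : Hom (sh M) (Y k) :=
  if k is k'.+1 then nx (existT (fun k => Hom (sh M) (Y k)) k' (t k')) else 0.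
have tE k : t k - phi k ∘ t k.+1 = pr k ∘ z.
  rewrite [phi k ∘ _](nxE (existT (fun k => Hom (sh M) (Y k)) k (t k))) /=.
  by rewrite opprB addrC subrK.
have [x [xE _]] := prP (sh M) t.
have sx : s ∘ x = z.
  apply/eqP; rewrite -subr_eq0; apply/eqP/(product_eq0 prP) => k.
  rewrite compBr [pr k ∘ (_ ∘ _)]compA [pr k ∘ _]sE compBl -compA.
  by rewrite [pr k ∘ x]xE [pr k.+1 ∘ x]xE tE subrr.
rewrite -gE; apply: sh_inj; rewrite raddf0 fmapM.
have -> : fmap sh g = eta S ∘ s ∘ x.
  by rewrite -compA sx /z compA etaK comp1l.
by rewrite compA (tri_uw T) comp0l.
Qed.

Section Tower.
Variable qh : I -> C.
Hypothesis qhP : forall i, BC_dual (Qf i) (qh i).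

Let detect i n : detects (shn n (Qf i)) (shn n (qh i)) := detects_shn n (BC_detects (qhP i)).

Let closure := @coproduct_closure (op C) (BC_shifts Q).

Let closure_product (J : small) (F : J -> C) P (pr : forall j, Hom P (F j)) :
  is_product pr -> (forall j, BC_shifts Q (F j)) -> closure P.
Proof.
move=> prP FS P' P'c P'S; apply: (P'c J F P pr); first exact: prP.
by move=> j; exact: P'S.
Qed.

Let BC_shifts_qh i n : BC_shifts Q (shn n (qh i)).
Proof.
exists (Qf i), (qh i), n; split=> //; first by exists i.
exact: isomorphic_refl.
Qed.

(** Take the product of the duals qh[n], one factor for each map from [M] to qh[n]; duality turns
    detection by these maps into injectivity on maps from q[n]. *)
Lemma cotower_start (M : C) : exists Y (f : Hom M Y), closure Y /\
  forall i n (x : Hom (shn n (Qf i)) M), f ∘ x = 0 -> x = 0.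
Proof.
have [Y [pr prP]] := C_products
  (fun t : {i : I & {n : nat & Hom M (shn n (qh i))}} => shn (projT1 (projT2 t)) (qh (projT1 t))).
have [f [fE _]] := prP M (fun t => projT2 (projT2 t)).
exists Y, f; split; first by apply: (closure_product prP).
move=> i n x fx; rewrite -[x]comp1r; move: (idm _); apply: (proj1 (@detect i n _ _ x)) => z.
have zE : pr (existT _ i (existT _ n z)) ∘ f = z := fE (existT _ i (existT _ n z)).
by rewrite -zE -compA fx comp0r.
Qed.

(** [Y'] is the fiber of all maps from [Y] to qh[n+1], n >= 0, that kill [f]. Every map from the
    cone of [f] to qh[n+1] gives one of these, so it vanishes on [Y']; by duality maps from q[n+1]
    to [Y'] die in the cone of [f], hence come from [M] in [Y]. *)
Lemma cotower_step (M Y : C) (f : Hom M Y) :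
  exists Y' (f' : Hom M Y') (r : Hom Y' Y), [/\ r ∘ f' = f,
    exists Z (j : Hom Z Y') (w : Hom (unsh Y) Z), dist w j (eta Y ∘ r) /\ closure Z &
    forall i n (y : Hom (shn n.+1 (Qf i)) Y'), exists m, r ∘ y = f ∘ m].
Proof.
have [Z [pr prP]] := C_products
  (fun t : {i : I & {n : nat & {z : Hom Y (sh (shn n (qh i))) | z ∘ f = 0}}} =>
    shn (projT1 (projT2 t)) (qh (projT1 t))).
have prP' := sh_products prP.
have [p [pE _]] := prP' Y (fun t => sval (projT2 (projT2 t))).
have [Y' [j [r T]]] := fiber3 p.
have [|f' f'E] := tri_lift2 T (f := f).
  apply: (product_eq0 prP') => -[i [n [z zf]]].
  by rewrite compA pE.
exists Y', f', r; split=> //.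
  have [w wE] := sh_full (p ∘ eti Y).
  exists Z, j, (- w); split; last by apply: (closure_product prP).
  apply: (proj2 (dist_rotate ax _ _ _)); rewrite raddfN opprK wE.
  apply: (dist_iso ax (iso_id _) (iso_id _) (sh_unit_iso ax Y) _ _ _ T).
  - by rewrite comp1l comp1r.
  - by rewrite comp1r.
  - by rewrite fmap1 comp1l -compA [eti Y ∘ _]etiK comp1r.
move=> i n y; have [N [c [d Tf]]] := dist_cone ax f.
have cry : c ∘ r ∘ y = 0.
  move: y; apply: (proj1 (@detect i n.+1 _ _ (c ∘ r))) => z.
  have zcf : (z ∘ c : Hom Y (sh (shn n (qh i)))) ∘ f = 0.
    by rewrite -compA (tri_vu Tf) comp0r.
  pose t := existT _ i (existT _ n (exist _ _ zcf))
    : {i : I & {n : nat & {z : Hom Y (sh (shn n (qh i))) | z ∘ f = 0}}}.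
  have zE : (fmap sh (pr t) : Hom _ (sh (shn n (qh i)))) ∘ p = z ∘ c := pE t.
  by rewrite [LHS]compA -zE -compA (tri_wv T) comp0r.
have [|m mE] := tri_lift Tf (f := r ∘ y); first by rewrite compA.
by exists m.
Qed.

(** On maps from q[n+1], every transition map has its image inside that of [M], and [M] injects into
    every stage. So maps into the homotopy limit come from [M] up to a lim^1 term, which vanishes
    for the same reason. *)
Lemma weight_tower (M : C) : exists L H (u : Hom L M) (v : Hom M H) (w : Hom H (sh L)),
  [/\ dist u v w, right_of Q 0 L & hull H].
Proof.
have [Y0 [f0 [cY0 f0P]]] := cotower_start M.
pose st := {Y : C & Hom M Y}.
have nx (s : st) : exists (s' : st) (r : Hom (projT1 s') (projT1 s)), 
    [/\ r ∘ projT2 s' = projT2 s,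
    exists Z (j : Hom Z (projT1 s')) (w : Hom (unsh (projT1 s)) Z),
      dist w j (eta (projT1 s) ∘ r) /\ closure Z &
    forall i n (y : Hom (shn n.+1 (Qf i)) (projT1 s')), exists m, r ∘ y = projT2 s ∘ m].
  case: s => Y f; have [Y' [f' [r h]]] := cotower_step f.
  by exists (existT _ Y' f'), r.
have [nxt nxtP] := dep_choice nx.
have [rr rrP] := dep_choice nxtP.
pose s k : st := iter k nxt (existT _ Y0 f0).
pose Y k := projT1 (s k).
pose f k : Hom M (Y k) := projT2 (s k).
pose r k : Hom (Y k.+1) (Y k) := rr (s k).
have rP k : [/\ r k ∘ f k.+1 = f k,
    exists Z (j : Hom Z (Y k.+1)) (w : Hom (unsh (Y k)) Z),
      dist w j (eta (Y k) ∘ r k) /\ closure Z &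
    forall i n (y : Hom (shn n.+1 (Qf i)) (Y k.+1)), exists m, r k ∘ y = f k ∘ m].
  exact: rrP.
have fr k : r k ∘ f k.+1 = f k by case: (rP k).
have rim k i n (y : Hom (shn n.+1 (Qf i)) (Y k.+1)) : exists m, r k ∘ y = f k ∘ m.
  by case: (rP k) => _ _; exact.
have finj k i n (x : Hom (shn n (Qf i)) M) : f k ∘ x = 0 -> x = 0.
  elim: k => [|k IH]; first exact: f0P.
  by move=> fx; apply: IH; rewrite -fr -compA fx comp0r.
have [S [pr prP]] := C_products Y.
have [t [tE _]] := prP S (fun k => pr k - r k ∘ pr k.+1).
have [H [w [v T]]] := fiber3 (eta S ∘ t).
have [F [FE _]] := prP M f.
have [|fi fiE] := tri_lift2 T (f := F).
  suff -> : eta S ∘ t ∘ F = 0 by [].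
  rewrite -compA (_ : t ∘ F = 0) ?comp0r //; apply: (product_eq0 prP) => k.
  by rewrite compA tE compBl -compA !FE fr subrr.
have fik k : pr k ∘ v ∘ fi = f k by rewrite -compA fiE FE.
have [L [u [d TL]]] := fiber fi.
exists L, H, u, fi, d; split=> //; last first.
  apply/op_big_hullE; exists H, Y, r; split=> //.
  - by move=> k; have [_ [Z [j [w' [Tk cZ]]]] _] := rP k; exists Z, j, w'.
  - by exists S, pr, t, v, w.
  - by exists (idm H), (idm H); exact: comp1l.
move=> _ n [i <-] _ x.
have ux : u ∘ x = 0.
  apply: (finj 0%N); rewrite -fik -compA (compA fi) (tri_vu TL) comp0l comp0r.
  by [].
have [|y yE] := tri_lift3 TL (f := fmap sh x); first by rewrite -fmapM ux raddf0.
have step (a : Hom (shn n.+1 (Qf i)) H) k : pr k ∘ v ∘ a = r k ∘ (pr k.+1 ∘ v ∘ a).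
  have e : t ∘ v = 0.
    by rewrite -[LHS]comp1l -etiK -compA (compA (eta S)) (tri_wv T) comp0r.
  have := congr1 (fun h => h ∘ a) (congr1 (comp (pr k)) e).
  rewrite (compA (pr k)) tE !compBl comp0r comp0l => /eqP.
  by rewrite subr_eq0 => /eqP ->; rewrite !compA.
have [m mE] := dep_choice (fun k => rim k i n (pr k.+1 ∘ v ∘ y)).
have {}mE k : pr k ∘ v ∘ y = f k ∘ m k by rewrite step.
(* The elements of [M] found at the various stages coincide, because [f k] is injective on maps from
   q[n+1]. *)
have m0 k : m k = m 0%N.
  elim: k => // k <-; apply/esym/eqP; rewrite -subr_eq0; apply/eqP/(finj k i n.+1).
  by rewrite compBr -mE -fr -[r k ∘ _ ∘ _]compA -mE -step subrr.
have vy : v ∘ (y - fi ∘ m 0%N) = 0.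
  apply: (product_eq0 prP) => k.
  by rewrite compBr compBr !compA mE fik m0 subrr.
have [g gE] := tri_lift T vy.
suff g0 : y = fi ∘ m 0%N.
  by apply: sh_inj; rewrite raddf0 -yE g0 compA (tri_wv TL) comp0l.
apply/eqP; rewrite -subr_eq0; apply/eqP; rewrite -gE.
pose z : Hom (shn n.+2 (Qf i)) S := eti S ∘ fmap sh g.
have [n_ nE] := dep_choice (fun k => rim k i n.+1 (pr k.+1 ∘ z)).
(* Mittag-Leffler: pushing [z] down one stage gives the image of [n_ k] from [M]. The solution is
   [z] corrected by the images of [N k], which accumulates these terms so that the sum
   telescopes. *)
pose N := fix N k : Hom (shn n.+2 (Qf i)) M := if k is k'.+1 then N k' - n_ k' else 0.
have [x' [x'E _]] := prP _ (fun k => pr k ∘ z + f k ∘ N k).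
have tx : t ∘ x' = z.
  apply/eqP; rewrite -subr_eq0; apply/eqP/(product_eq0 prP) => k.
  rewrite compBr compA tE compBl -compA !x'E compDr nE (compA (r k)) fr.
  rewrite [N k.+1]/(N k - n_ k) compBr addrCA subrr addr0 addrK.
  by rewrite subrr.
apply: sh_inj; rewrite raddf0 fmapM.
have -> : fmap sh g = eta S ∘ t ∘ x' by rewrite -compA tx compA etaK comp1l.
by rewrite compA (tri_uw T) comp0l.
Qed.

(** An object of the orthogonal receives only zero from its part [L] in t>=1, so it is a retract of
    its part in the hull. *)
Lemma hullP X : hull X <-> orth_ge1 X.
Proof.
split; first exact: hull_orth.
move=> Xo; have [L [H [u [v [w [T LQ Hh]]]]]] := weight_tower X.
have [|h hE] := tri_desc T (f := idm X); first by rewrite comp1l; exact: Xo.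
have /op_big_hullE[K [Y [phi [h1 h2 h3 [a [b ba]]]]]] := Hh.
apply/op_big_hullE; exists K, Y, phi; split=> //; exists (a ∘ v), (h ∘ b).
by rewrite -compA (compA b) ba comp1l.
Qed.

End Tower.

End WeightStructure.

(** * Weight decompositions and the heart of the weight structure *)

Section AdjacentWeights.
Variables (C : triangulated) (I : small) (Qf : I -> C).
Hypothesis C_coproducts : has_coproducts C.
Hypothesis Qf_compact : forall i, compact (Qf i).
Hypothesis brown : brown_representability C.
Let ax := triP C.
Let Q (X : C) := exists i, Qf i = X.
Let le := gen_le Q.
Let ge := gen_ge Q.
Let hull := op_big_hull (BC_shifts Q).

Let Qf_finfac i : finfac (Qf i) := compact_finfac (@Qf_compact i).
Let tP : t_structure le ge := gen_t_structure C_coproducts Qf_finfac.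
Let C_products : has_products C := brown_products brown.
Local Notation Ht := (t_heart le ge).

Let ge1P (X : C) : ge (sh X) <-> right_of Q 0 X.
Proof. by split=> [/gen_geP/right_of_sh|h]; last by apply/gen_geP/right_of_sh. Qed.

Lemma adjacent_tower (M : C) : exists L H (u : Hom L M) (v : Hom M H) (w : Hom H (sh L)),
  [/\ dist u v w, right_of Q 0 L & hull H].
Proof.
have [qh qhP] := dep_choice (fun i => BC_exists brown (@Qf_compact i)).
exact: (weight_tower C_products qhP M).
Qed.

Lemma adjacent_hullP (X : C) : hull X <-> orth_ge1 Qf X.
Proof.
have [qh qhP] := dep_choice (fun i => BC_exists brown (@Qf_compact i)).
exact: (hullP C_products qhP X).
Qed.

Lemma adjacent_w_structure : w_structure ge hull.
Proof.
split.
- by move=> X Y XY /gen_geP YQ; apply/gen_geP; exact: right_of_retract XY YQ.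
- by move=> X Y XY /adjacent_hullP Yo; apply/adjacent_hullP; exact: orth_ge1_retract XY Yo.
- by move=> X gX; exact: (t_ge_shift tP gX).
- move=> X [Y [/adjacent_hullP Yo XY]]; apply/adjacent_hullP.
  by apply: (orth_ge1_iso (isomorphic_sym XY)); exact: orth_ge1_sh.
- move=> X Y f gX [Z [/adjacent_hullP Zo /isomorphicP[a [b [ba ab]]]]].
  have [f' f'E] := to_sh (a ∘ f : Hom X (sh Z)).
  have f'0 : f' = 0.
    apply: Zo; apply/ge1P; exact: (t_ge_iso tP (isomorphic_eta X) gX).
  by rewrite -[f]comp1l -ba -compA f'E f'0 raddf0 comp0l comp0r.
- move=> M; have [L [H [u [v [w [T LQ Hh]]]]]] := adjacent_tower (unsh M).
  exists (sh L), (sh H), (eti M ∘ fmap sh u), (fmap sh v ∘ eta M), (- fmap sh w); split.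
  + have iM : is_iso (C := C) (eti M) by exists (eta M); split; [exact: etaK | exact: etiK].
    apply: (dist_iso ax (iso_id _) iM (iso_id _) _ _ _ (dist_sh T)).
    * by rewrite comp1r.
    * by rewrite comp1l -compA etaK comp1r.
    * by rewrite fmap1 comp1l comp1r.
  + exact/ge1P.
  + by exists H; split=> //; exact: isomorphic_refl.
Qed.

Local Notation Hw := (w_heart ge hull).

Let orth_R (R N : C) (f : Hom R N) : ge (sh R) -> orth_ge1 Qf N -> f = 0.
Proof. by move=> /ge1P RQ No; exact: No. Qed.

(** [L] is H^0(N), as [N] lies in t>=0. Objects t>=1 have no nonzero maps to [N]; since the fiber of
    a monomorphism of the heart is such an object, maps to [N], and with them maps to [L], extend
    along it. For the same reason maps from [L] to the weight heart extend uniquely to [N]. *)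
Lemma w_heart_coreflection (N : Hw) : exists (L : Ht) (l : Hom (sval L) (sval N)),
  [/\ injective_object L,
      forall (X : Ht) (g : Hom (sval X) (sval N)), exists h : Hom (sval X) (sval L), l ∘ h = g,
      forall (X : Ht) (h : Hom (sval X) (sval L)), l ∘ h = 0 -> h = 0,
      forall (N' : Hw) (g : Hom (sval L) (sval N')), exists g' : Hom (sval N) (sval N'), g' ∘ l = g
    & forall (N' : Hw) (g : Hom (sval N) (sval N')), g ∘ l = 0 -> g = 0].
Proof.
case: N => N /= [gN hN].
have [L [R [l [v [w [T lL gR]]]]]] := t_decomp1 tP N.
have HL : in_heart le ge L by split=> //; apply: (ge_fiber tP T gN); exact: (ge_unsh tP).
have up (X : Ht) (g : Hom (sval X) N) : exists h : Hom (sval X) L, l ∘ h = g.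
  by apply: (tri_lift T); exact: (orth1 tP _ (proj1 (svalP X)) gR).
have un (X : Ht) (h : Hom (sval X) L) : l ∘ h = 0 -> h = 0.
  move=> lh; have [|t tE] := tri_lift3 T (f := fmap sh h); first by rewrite -fmapM lh raddf0.
  apply: sh_inj; rewrite raddf0 -tE (orth_sh tP t (proj1 (svalP X))) ?comp0r //.
  exact: (ge_unsh tP).
exists (exist _ _ HL), l; split=> //.
- move=> X Y m f mm; have [F [i [z Tm]]] := fiber (m : @Hom C (sval X) (sval Y)).
  have HF := heart_mono_fiber tP mm Tm.
  have [|g gE] := tri_desc Tm (f := l ∘ f).
    apply: orth_R; first exact: (proj2 HF).
    exact/adjacent_hullP.
  have [h hE] := up Y g.
  exists h; apply/eqP; rewrite -subr_eq0; apply/eqP/(un X).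
  by rewrite [l ∘ _]compBr [l ∘ _]compA hE gE subrr.
- move=> [N' [gN' hN']] /= g; have hN'o := proj1 (adjacent_hullP N') hN'.
  have [|g' g'E] := tri_desc3 T (f := fmap sh g).
    by apply: orth_R => //; exact: orth_ge1_sh.
  have [k kE] := sh_full g'; exists k.
  by apply: sh_inj; rewrite fmapM kE.
- move=> [N' [gN' hN']] /= g gl; have hN'o := proj1 (adjacent_hullP N') hN'.
  have [g' <-] := tri_desc T gl.
  by rewrite (orth_R g') ?comp0l.
Qed.

(** The equivalence is N |-> H^0(N), fully faithful by the two universal properties of
    [w_heart_coreflection]. An injective [X] embeds in H^0(H) for the hull part [H] of its tower, as
    a direct summand. *)
Lemma adjacent_heart : equivalent Hw (Inj Ht).
Proof.
have [L LP] := dep_choice w_heart_coreflection.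
have [l lP] := dep_choice LP.
pose I0 (N : Hw) : Inj Ht := exist _ (L N) (let: And5 h _ _ _ _ := lP N in h).
have up N (X : Ht) (g : Hom (sval X) (sval N)) :
    exists h : Hom (sval X) (sval (L N)), l N ∘ h = g by case: (lP N).
have un N (X : Ht) (h : Hom (sval X) (sval (L N))) : l N ∘ h = 0 -> h = 0.
  by case: (lP N) => _ _ h0 _ _; exact: h0.
have ex N (N' : Hw) (g : Hom (sval (L N)) (sval N')) :
    exists g' : Hom (sval N) (sval N'), g' ∘ l N = g by case: (lP N).
have ex0 N (N' : Hw) (g : Hom (sval N) (sval N')) : g ∘ l N = 0 -> g = 0.
  by case: (lP N) => _ _ _ _; exact.
have un2 N (X : Ht) (h h' : Hom (sval X) (sval (L N))) : l N ∘ h = l N ∘ h' -> h = h'.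
  by move=> e; apply/eqP; rewrite -subr_eq0; apply/eqP/un; rewrite compBr e subrr.
have ex2 N (N' : Hw) (g g' : Hom (sval N) (sval N')) : g ∘ l N = g' ∘ l N -> g = g'.
  by move=> e; apply/eqP; rewrite -subr_eq0; apply/eqP/ex0; rewrite compBl e subrr.
have [arr arrE] := @dep_choice {NN : Hw * Hw & Hom (sval NN.1) (sval NN.2)}
  (fun t => Hom (sval (L (projT1 t).1)) (sval (L (projT1 t).2)))
  (fun t h => l (projT1 t).2 ∘ h = projT2 t ∘ l (projT1 t).1) (fun t => up _ _ _).
pose ar (N N' : Hw) (g : Hom (sval N) (sval N')) : Hom (sval (L N)) (sval (L N')) :=
  arr (existT (fun NN : Hw * Hw => Hom (sval NN.1) (sval NN.2)) (N, N') g).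
have arE (N N' : Hw) (g : Hom (sval N) (sval N')) : l N' ∘ ar N N' g = g ∘ l N.
  exact: (arrE (existT (fun NN : Hw * Hw => Hom (sval NN.1) (sval NN.2)) (N, N') g)).
have ar1 N : ar N N (idm (sval N)) = idm (sval (L N)).
  by apply: (un2 N (L N)); rewrite arE comp1l comp1r.
have arM N1 N2 N3 (g : Hom (sval N2) (sval N3)) (f : Hom (sval N1) (sval N2)) :
    ar N1 N3 (g ∘ f) = ar N2 N3 g ∘ ar N1 N2 f.
  by apply: (un2 N3 (L N1)); rewrite arE compA arE -!compA arE.
pose F : functor Hw (Inj Ht) := @Functor Hw (Inj Ht) I0 ar ar1 arM.
have ar_inj (N N' : Hw) (f g : Hom (sval N) (sval N')) : ar N N' f = ar N N' g -> f = g.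
  by move=> e; apply: ex2; rewrite -!arE e.
have ar_full (N N' : Hw) (h : Hom (sval (L N)) (sval (L N'))) : exists g, ar N N' g = h.
  have [g gE] := ex N N' (l N' ∘ h).
  by exists g; apply: (un2 N' (L N)); rewrite arE gE.
apply: (ff_ess_equivalent (F := F)).
- exact: ar_inj.
- exact: ar_full.
move=> [[X HX] XI]; have [K [H [u [v [w [T KQ Hh]]]]]] := adjacent_tower X.
have gH : ge H.
  by case: (ge_ext tP) => _; apply; [exact: (rot T) | exact: (proj2 HX) | exact/ge1P].
pose H' : Hw := exist _ H (conj gH Hh).
pose X' : Ht := exist _ X HX.
have [j jE] : exists j : @Hom C X (sval (L H')), l H' ∘ j = v := up H' X' v.
have jm : mono (j : @Hom Ht X' (L H')).
  apply/monoP => W g jg.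
  have vg : v ∘ (g : @Hom C (sval W) X) = 0.
    rewrite -jE -compA; have -> : @comp C _ _ _ j g = 0 by exact: jg.
    by rewrite comp0r.
  have [g' g'E] := tri_lift T vg.
  have g'0 : g' = 0 by apply: (orth1 tP _ (proj1 (svalP W))); exact/ge1P.
  by rewrite -g'E g'0 comp0r.
have [r rE] : exists r : @Hom C (sval (L H')) X, r ∘ j = idm X.
  exact: (XI _ _ (j : @Hom Ht X' (L H')) (idm X') jm).
(* The projector of H^0(H) onto [X] lifts to an idempotent of [H], which Brown representability
   splits; H^0 of its image is [X]. *)
have [e eE] := ar_full H' H' (j ∘ r).
have ee : e ∘ e = e.
  apply: (ar_inj H' H'); rewrite arM eE.
  by rewrite -compA (compA r) rE comp1l.
have [N [i [p [pi ip]]]] := split_idempotent brown ee.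
have NH : retract N H by exists i, p.
have gN : ge N by apply/gen_geP; apply: (right_of_retract NH); exact/gen_geP.
have hN : hull N by apply/adjacent_hullP; apply: (orth_ge1_retract NH); exact/adjacent_hullP.
pose N' : Hw := exist _ N (conj gN hN).
have pi' : ar H' N' p ∘ ar N' H' i = idm _ by rewrite -arM pi ar1.
have ip' : ar N' H' i ∘ ar H' N' p = j ∘ r by rewrite -arM ip eE.
exists N', (r ∘ ar N' H' i), (ar H' N' p ∘ j); split.
  change (@comp C _ _ _ (ar H' N' p ∘ j) (r ∘ ar N' H' i) = idm (sval (L N'))).
  by rewrite -compA (compA j) -ip' -!compA pi' comp1r pi'.
change (@comp C _ _ _ (r ∘ ar N' H' i) (ar H' N' p ∘ j) = idm X).
by rewrite -compA (compA (ar N' H' i)) ip' -!compA rE comp1r rE.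
Qed.

End AdjacentWeights.

Theorem corollary4p3p9 (C : triangulated) (Q : C -> Prop)
    (C_coproducts : has_coproducts C)
    (Q_small : small_class Q)
    (Q_compact : forall q : C, Q q -> compact q) :
  let tle : C -> Prop := gen_le Q in
  let tge : C -> Prop := gen_ge Q in
  let Ht : preadditive := t_heart tle tge in
  [/\ t_structure tle tge,
      t_smashing tge,
      exists E : Ht, injective_object E /\ cogenerator E,
      AB3star Ht
    & equivalent (op Ht) (AddFunProd (Inj Ht))] /\
  (brown_representability C ->
     (forall q : C, Q q -> exists qhat : C, BC_dual q qhat) /\
     exists wle wge : C -> Prop,
       [/\ w_structure wle wge,
           forall X : C, wle X <-> tge X,
           equivalent (w_heart wle wge) (Inj Ht)
         & forall X : C, wge X <-> op_big_hull (BC_shifts Q) X]) /\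
  (t_nondegenerate tle tge -> grothendieck_abelian Ht).
Proof.
case: Q_small => I [Qf QfE].
have QE : Q = (fun X => exists i, Qf i = X).
  by apply: functional_extensionality_dep => X; apply: propositional_extensionality.
subst Q => tle tge Ht.
have Qf_compact i : compact (Qf i) by apply: Q_compact; exists i.
have Qf_fin i : finfac (Qf i) by exact: compact_finfac (Qf_compact i).
have tP : t_structure tle tge by exact: gen_t_structure.
have abH : abelian Ht := heart_abelian tP.
have coH : has_coproducts Ht by exact: heart_coproducts.
have [T [B [Bgen Blift Bfin]]] := heart_family C_coproducts Qf_fin.
have [G [Ggen Gfin]] := family_generator coH Bgen Bfin.
have prH : has_products Ht := generated_products abH coH Ggen.
have [E [Einj Ecogen]] := injective_cogenerator abH coH Ggen Gfin.
split; first split=> //.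
- exact: gen_t_smashing.
- by exists E.
- exact: anti_equivalence prH E Einj Ecogen.
split=> [brown|_].
  split=> [q Qq|]; first exact: BC_exists (Q_compact q Qq).
  exists tge, (op_big_hull (BC_shifts (fun X => exists i, Qf i = X))); split=> //.
    exact: adjacent_w_structure.
  exact: adjacent_heart.
split=> //; last by exists G.
exact: filtered_exact abH coH T B Bgen Blift Bfin.
Qed.
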